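(* Let $n\in\mathbb{N}$, $n\ge 2$, and let $f,g\in\mathscr{E}'(\mathbb{T})$. Let $I,J\subset\mathbb{T}$ be closed intervals such that $\mathop{\rm supp} f\subset\mathscr{R}_n(I)$ and $\mathop{\rm supp} g\subset\mathscr{R}_n(J)$, and such that there is no closed interval $I'\subsetneq I$ with $\mathop{\rm supp} f\subset\mathscr{R}_n(I')$ and no closed interval $J'\subsetneq J$ with $\mathop{\rm supp} g\subset\mathscr{R}_n(J')$. Assume $|I|+|J|<\frac{2\pi}{n}$. Let $K\subset I+J$ be a closed interval such that $\mathop{\rm supp} f\ast g\subset\mathscr{R}_n(K)$. If $\lambda:=\inf K-\inf I-\inf J>0$, then there exist $\alpha,\beta\in\mathbb{C}$ with $\alpha^n=\beta^n=1$ and $\alpha\ne\beta$ such that \[ \Big(\sum_{k\in\mathbb{Z}_n}\alpha^k S_{\frac{2\pi k}{n}}f\Big)\Big|_{(\sup I-\frac{2\pi}{n},\,\inf I+\lambda)}=0, \qquad \inf\mathop{\rm supp}\Big(\sum_{k\in\mathbb{Z}_n}\alpha^k S_{\frac{2\pi k}{n}}g\Big)\Big|_{(\sup J-\frac{2\pi}{n},\,\inf J+\lambda)}=\inf J, \] \[ \inf\mathop{\rm supp}\Big(\sum_{k\in\mathbb{Z}_n}\beta^k S_{\frac{2\pi k}{n}}f\Big)\Big|_{(\sup I-\frac{2\pi}{n},\,\inf I+\lambda)}=\inf I, \qquad \Big(\sum_{k\in\mathbb{Z}_n}\beta^k S_{\frac{2\pi k}{n}}g\Big)\Big|_{(\sup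 J-\frac{2\pi}{n},\,\inf J+\lambda)}=0. \]
   Context: $\mathbb{T}=\mathbb{R}/2\pi\mathbb{Z}$ and $\mathscr{E}'(\mathbb{T})$ is the space of distributions on $\mathbb{T}$. For $y\in\mathbb{T}$ the shift $S_y$ is defined by $(S_yf)(\omega)=f(\omega-y)$ in the sense of distributions. $\mathbb{Z}_n=\mathbb{Z}\bmod n$. For $I\subset\mathbb{T}$, $\mathscr{R}_n(I)=\bigcup_{k\in\mathbb{Z}_n}S_{\frac{2\pi k}{n}}I$. A closed interval of $\mathbb{T}$ is the image of an interval $[a,b]\subset\mathbb{R}$ (lifted), with $\inf I=a$, $\sup I=b$, $|I|=b-a$; $I+J$ is the interval with endpoints $\inf I+\inf J$ and $\sup I+\sup J$, and $K\subset I+J$ is lifted accordingly. Open intervals such as $(\sup I-\frac{2\pi}{n},\inf I+\lambda)$ are understood via the same lift and projected to $\mathbb{T}$; $h|_U$ denotes restriction of a distribution to an open set $U$, and $\inf\mathop{\rm supp}$ of such a restriction is computed in the lifted coordinate.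
   Formalization: The formal statement assumes in addition that supp f and supp g are nonempty (f and g nonzero), i.e. the empty interval counts among the excluded I′ and J′; for f = 0 with I a single point the claim as worded fails. *)

(* Defs.v *)
From Stdlib Require Import Reals ZArith.
From Coquelicot Require Import Coquelicot.
Open Scope R_scope.

(* Points of T = R/2piZ are represented by their lifts x : R; all sets below are
   2pi-periodic subsets of R. *)

Definition test_fun (phi : R -> R) : Prop :=
  (forall x, phi (x + 2 * PI) = phi x) /\ (forall k x, ex_derive_n phi k x).

(* A (complex) distribution on T, i.e. an element of E'(T), given by its action
   on real test functions (a C-linear continuous functional on C^oo(T;C) is the
   same as an R-linear continuous C-valued functional on C^oo(T;R)).
   Continuity: |<f,phi>| <= C0 * max_{j<=N} sup |phi^(j)|. *)
Definition distribution (f : (R -> R) -> C) : Prop :=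
  (forall phi psi, test_fun phi -> test_fun psi ->
     f (fun x => phi x + psi x) = (f phi + f psi)%C) /\
  (forall (a : R) phi, test_fun phi -> f (fun x => a * phi x) = (RtoC a * f phi)%C) /\
  (exists (N : nat) (C0 : R), forall phi, test_fun phi -> forall M : R,
     (forall j x, (j <= N)%nat -> Rabs (Derive_n phi j x) <= M) ->
     Cmod (f phi) <= C0 * M).

Definition pairC (f : (R -> R) -> C) (h : R -> C) : C :=
  (f (fun x => fst (h x)) + Ci * f (fun x => snd (h x)))%C.

(* Shift S_y f : <S_y f, phi> = <f, phi(. + y)>, i.e. (S_y f)(w) = f(w - y). *)
Definition shift (y : R) (f : (R -> R) -> C) : (R -> R) -> C :=
  fun phi => f (fun x => phi (x + y)).

Definition conv (f g : (R -> R) -> C) : (R -> R) -> C :=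
  fun phi => pairC f (fun x => g (fun y => phi (x + y))).

Fixpoint csum (m : nat) (F : nat -> C) : C :=
  match m with
  | O => RtoC 0
  | S m' => (csum m' F + F m')%C
  end.

Definition rot_sum (n : nat) (alpha : C) (f : (R -> R) -> C) : (R -> R) -> C :=
  fun phi => csum n (fun k => (Cpow alpha k * shift (2 * PI * INR k / INR n) f phi)%C).

(* phi is a test function of the open set (p,q) + 2piZ : its support is compact
   in it, i.e. contained in [p+delta, q-delta] + 2piZ for some delta > 0. *)
Definition supported_in (p q : R) (phi : R -> R) : Prop :=
  exists delta, 0 < delta /\
    forall x, phi x <> 0 ->
      exists z : Z, p + delta <= x + 2 * PI * IZR z <= q - delta.

Definition in_supp (f : (R -> R) -> C) (x : R) : Prop :=
  forall eps, 0 < eps ->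
    exists phi, test_fun phi /\ supported_in (x - eps) (x + eps) phi /\ f phi <> RtoC 0.

Definition zero_on (f : (R -> R) -> C) (p q : R) : Prop :=
  forall phi, test_fun phi -> supported_in p q phi -> f phi = RtoC 0.

Definition rot_set (n : nat) (a b : R) (x : R) : Prop :=
  exists z : Z, a <= x - 2 * PI * IZR z / INR n <= b.

Definition supp_sub (f : (R -> R) -> C) (S : R -> Prop) : Prop :=
  forall x, in_supp f x -> S x.

Definition is_glb (S : R -> Prop) (m : R) : Prop :=
  (forall x, S x -> m <= x) /\ (forall m', (forall x, S x -> m' <= x) -> m' <= m).

Definition inf_supp_restr_eq (f : (R -> R) -> C) (p q m : R) : Prop :=
  is_glb (fun x => p < x < q /\ in_supp f x) m.

(* [a,b] is a minimal closed interval with supp f in R_n([a,b]): no closed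
   interval (including the empty one) properly contained in [a,b] works. *)
Definition minimal_interval (n : nat) (f : (R -> R) -> C) (a b : R) : Prop :=
  supp_sub f (rot_set n a b) /\
  (exists x, in_supp f x) /\
  (forall a' b', a <= a' -> a' <= b' -> b' <= b -> (a' <> a \/ b' <> b) ->
     ~ supp_sub f (rot_set n a' b')).

(* Main.v *)
Require Import Defs.
From Stdlib Require Import Reals ZArith Lra Lia FunctionalExtensionality Classical IndefiniteDescription.
From Coquelicot Require Import Coquelicot.
Open Scope R_scope.

(** Cutting the circle near [I] and [J], the rotation sums of [f] and [g] for an [n]-th root of
    unity [alpha] become compactly supported distributions [U], [V] on the line, and up to a factor
    [U * V] is the corresponding piece of the rotation sum of [f * g]; hence it vanishes below
    [inf K].  Since [f] is the average of its rotation sums, minimality of [I] yields some [beta]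
    for which [inf supp U = inf I], and the Titchmarsh convolution theorem forces the [V] of [beta]
    to vanish below [inf J + lambda]; exchanging [f] and [g] gives [alpha].

    Titchmarsh's theorem is proved by real methods through the samples [F(e^(-mx))], [m >= 1], of
    the Laplace transform, which multiply under convolution.  A distribution [F] vanishes below [s]
    iff these samples are [O(m^N e^(-ms))]: one direction is a cut-off, the other approximates test
    functions by combinations of [e^(-mx)] with controlled coefficients, obtained from the expansion
    of [1 - exp (- e^(n(s-x)))].  This gives [inf supp (F * F) = 2 inf supp F] at once, and the
    argument of Lions and Hormander with the derivation [F |-> xF] does the rest. *)


(** * Smooth functions and cut-offs *)

(** The usual proofs of Titchmarsh's theorem use entire functions of exponential type. Integer rates
    suffice here because the expansion of [1 - exp (- e^(n(s-x)))] only contains the exponents [n],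
    [2n], [3n], and so on. The polynomial factor in the decay is harmless for two reasons: its
    square root is again bounded by a power of [m], and vanishing below [s] is tested by functions
    that stop at some [s' < s], so that half of the gap absorbs any power of [m].

    The obstacle on the circle is that it has no half-lines. A rotation sum for a root of unity is
    only multiplied by a constant under rotation by [2 PI / n], so it is determined by its behaviour
    near a single copy of the interval; this is what makes one lift faithful. The condition on
    [|I| + |J|] keeps the copies of [I + J] apart, so the convolution of two lifts does not wrap
    around. The left end [sup I - 2 PI / n] in the statement is the top of the copy of [I] that
    precedes [I]. *)

Definition smooth (phi : R -> R) : Prop := forall k x, ex_derive_n phi k x.

Lemma Derive_n_Sl (phi : R -> R) (k : nat) (x : R) :
  Derive_n phi (S k) x = Derive_n (Derive phi) k x.
Proof.
  change (Derive phi) with (Derive_n phi 1).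
  rewrite Derive_n_comp. f_equal. lia.
Qed.

Lemma ex_derive_n_Sl (phi phi' : R -> R) (k : nat) :
  (forall x, is_derive phi x (phi' x)) ->
  (forall x, ex_derive_n phi' k x) -> forall x, ex_derive_n phi (S k) x.
Proof.
  intros H Hk x.
  assert (E : Derive phi = phi').
  { apply functional_extensionality; intros y; apply is_derive_unique, H. }
  destruct k as [|k].
  - simpl. exists (phi' x). apply H.
  - change (ex_derive (Derive_n phi (S k)) x).
    apply ex_derive_ext with (Derive_n phi' k).
    + intros t. now rewrite Derive_n_Sl, E.
    + apply Hk.
Qed.

Lemma smooth_of_derive (phi phi' : R -> R) :
  (forall x, is_derive phi x (phi' x)) -> smooth phi' -> smooth phi.
Proof.
  intros H H' k. destruct k; [intros x; exact I|].
  apply ex_derive_n_Sl with phi'; auto.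
Qed.

Lemma smooth_is_derive (phi : R -> R) (x : R) :
  smooth phi -> is_derive phi x (Derive phi x).
Proof. intros H. apply Derive_correct. exact (H 1%nat x). Qed.

Lemma smooth_Derive (phi : R -> R) : smooth phi -> smooth (Derive phi).
Proof.
  intros H k x. destruct k; [exact I|].
  simpl. apply ex_derive_ext with (Derive_n phi (S k)).
  - intros t. apply Derive_n_Sl.
  - exact (H (S (S k)) x).
Qed.

Lemma smooth_Derive_n (phi : R -> R) (j : nat) : smooth phi -> smooth (Derive_n phi j).
Proof.
  intros H. induction j; [exact H|]. simpl. now apply smooth_Derive.
Qed.

Lemma smooth_continuous (phi : R -> R) (x : R) : smooth phi -> continuous phi x.
Proof. intros H. apply (ex_derive_continuous (V := R_NormedModule)). exact (H 1%nat x). Qed.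

Lemma smooth_const (c : R) : smooth (fun _ => c).
Proof.
  intros k x. revert x. induction k; intros x; [exact I|].
  apply ex_derive_n_const.
Qed.

Lemma smooth_plus (phi psi : R -> R) :
  smooth phi -> smooth psi -> smooth (fun x => phi x + psi x).
Proof.
  intros H1 H2 k x. apply ex_derive_n_plus; apply filter_forall; intros; auto.
Qed.

Lemma smooth_scal (a : R) (phi : R -> R) : smooth phi -> smooth (fun x => a * phi x).
Proof. intros H k x. now apply ex_derive_n_scal_l. Qed.

Lemma smooth_opp (phi : R -> R) : smooth phi -> smooth (fun x => - phi x).
Proof. intros H k x. now apply ex_derive_n_opp. Qed.

Lemma smooth_minus (phi psi : R -> R) :
  smooth phi -> smooth psi -> smooth (fun x => phi x - psi x).
Proof. intros H1 H2. apply (smooth_plus phi); auto using smooth_opp. Qed.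


Lemma is_derive_Rmult (f g : R -> R) (x df dg : R) :
  is_derive f x df -> is_derive g x dg ->
  is_derive (fun y => f y * g y) x (df * g x + f x * dg).
Proof. intros H1 H2. apply (is_derive_mult (K := R_AbsRing)); auto. intros; apply Rmult_comm. Qed.

Lemma smooth_mult (phi psi : R -> R) :
  smooth phi -> smooth psi -> smooth (fun x => phi x * psi x).
Proof.
  intros H1 H2 k. revert phi psi H1 H2.
  (* [ex_derive_n_plus] asks for every order up to the current one, hence the strong induction. *)
  induction k as [k IH] using (well_founded_induction lt_wf); intros phi psi H1 H2.
  destruct k; [intros x; exact I|].
  apply ex_derive_n_Sl with (fun x => Derive phi x * psi x + phi x * Derive psi x).
  - intros x. apply is_derive_Rmult; now apply smooth_is_derive.
  - intros x. apply ex_derive_n_plus; apply filter_forall; intros y j Hj;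
      apply (IH j); auto using smooth_Derive; lia.
Qed.

Lemma smooth_trans (phi : R -> R) (t : R) : smooth phi -> smooth (fun x => phi (x + t)).
Proof. intros H k x. apply ex_derive_n_comp_trans, H. Qed.

Lemma smooth_comp_scal (phi : R -> R) (a : R) : smooth phi -> smooth (fun x => phi (a * x)).
Proof. intros H k x. apply ex_derive_n_comp_scal, filter_forall. auto. Qed.

Lemma smooth_id : smooth (fun x => x).
Proof.
  apply smooth_of_derive with (fun _ => 1); [|apply smooth_const].
  intros x. auto_derive; auto.
Qed.

Lemma smooth_pow (k : nat) : smooth (fun x => x ^ k).
Proof.
  induction k; [exact (smooth_const 1)|]. apply (smooth_mult (fun x => x)); auto using smooth_id.
Qed.

Lemma smooth_exp (m : R) : smooth (fun x => exp (m * x)).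
Proof.
  apply (smooth_comp_scal exp). intros k. induction k; [intros x; exact I|].
  apply ex_derive_n_Sl with exp; auto. intros x. apply is_derive_exp.
Qed.

Lemma smooth_sum (F : nat -> R -> R) (n : nat) :
  (forall i, smooth (F i)) -> smooth (fun x => sum_f_R0 (fun i => F i x) n).
Proof.
  intros H. induction n; simpl; auto. apply smooth_plus; auto.
Qed.

Lemma Derive_n_Rplus (phi psi : R -> R) (j : nat) (x : R) : smooth phi -> smooth psi ->
  Derive_n (fun x => phi x + psi x) j x = Derive_n phi j x + Derive_n psi j x.
Proof. intros H1 H2. apply Derive_n_plus; apply filter_forall; auto. Qed.

Lemma Derive_n_Rminus (phi psi : R -> R) (j : nat) (x : R) : smooth phi -> smooth psi ->
  Derive_n (fun x => phi x - psi x) j x = Derive_n phi j x - Derive_n psi j x.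
Proof. intros H1 H2. apply Derive_n_minus; apply filter_forall; auto. Qed.

Lemma Derive_n_exp (m : R) (j : nat) (x : R) :
  Derive_n (fun x => exp (m * x)) j x = m ^ j * exp (m * x).
Proof.
  revert x. induction j; intros x; simpl; [ring|].
  rewrite (Derive_ext _ _ _ IHj). apply is_derive_unique. auto_derive; auto. ring.
Qed.

Lemma Derive_n_locally_eq (phi psi : R -> R) (j : nat) (x p q : R) :
  p < x < q -> (forall y, p < y < q -> phi y = psi y) -> Derive_n phi j x = Derive_n psi j x.
Proof.
  intros Hx H. apply Derive_n_ext_loc.
  apply (locally_interval _ x p q); simpl; try apply Hx. intros y H1 H2. apply H; split; auto.
Qed.

(** These are the seminorms of the smooth functions on the line; a linear functional continuous for
    one of them is a distribution of compact support. The bound is a relation, so no supremum has to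
    be formed. *)
Definition bnd (N : nat) (L M : R) (phi : R -> R) : Prop :=
  forall j x, (j <= N)%nat -> Rabs x <= L -> Rabs (Derive_n phi j x) <= M.

Lemma bnd_weaken (N N' : nat) (L L' M M' : R) (phi : R -> R) :
  (N' <= N)%nat -> L' <= L -> M <= M' -> bnd N L M phi -> bnd N' L' M' phi.
Proof. intros HN HL HM H j x Hj Hx. apply Rle_trans with M; auto. apply H; [lia|lra]. Qed.

Lemma bnd_plus (N : nat) (L A B : R) (phi psi : R -> R) : smooth phi -> smooth psi ->
  bnd N L A phi -> bnd N L B psi -> bnd N L (A + B) (fun x => phi x + psi x).
Proof.
  intros S1 S2 H1 H2 j x Hj Hx. rewrite Derive_n_Rplus by auto.
  eapply Rle_trans; [apply Rabs_triang|]. apply Rplus_le_compat; auto.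
Qed.

Lemma bnd_Derive (N : nat) (L M : R) (phi : R -> R) : bnd (S N) L M phi -> bnd N L M (Derive phi).
Proof. intros H j x Hj Hx. rewrite <- Derive_n_Sl. apply H; auto. lia. Qed.

(** Each differentiation turns one product into two, whence the factor [2 ^ N]. *)
Lemma bnd_mult (N : nat) (L A B : R) (phi psi : R -> R) : smooth phi -> smooth psi ->
  bnd N L A phi -> bnd N L B psi -> bnd N L (2 ^ N * A * B) (fun x => phi x * psi x).
Proof.
  revert phi psi. induction N; intros phi psi S1 S2 H1 H2 j x Hj Hx.
  - replace j with 0%nat by lia. simpl. rewrite Rabs_mult, Rmult_1_l.
    apply Rmult_le_compat; try apply Rabs_pos; [apply (H1 0%nat)|apply (H2 0%nat)]; auto.
  - assert (E : forall y, Derive (fun x => phi x * psi x) y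
        = Derive phi y * psi y + phi y * Derive psi y).
    { intros y. apply is_derive_unique, is_derive_Rmult; now apply smooth_is_derive. }
    assert (HA : 0 <= A).
    { eapply Rle_trans; [apply Rabs_pos|apply (H1 0%nat x); auto; lia]. }
    assert (HB : 0 <= B).
    { eapply Rle_trans; [apply Rabs_pos|apply (H2 0%nat x); auto; lia]. }
    assert (HP := pow_le 2 N ltac:(lra)).
    destruct j.
    + simpl. rewrite Rabs_mult.
      apply Rle_trans with (A * B).
      * apply Rmult_le_compat; try apply Rabs_pos; [apply (H1 0%nat)|apply (H2 0%nat)]; auto; lia.
      * assert (H := pow_R1_Rle 2 (S N) ltac:(lra)). simpl in H.
        assert (0 <= A * B) by now apply Rmult_le_pos. nra.
    + rewrite Derive_n_Sl.
      rewrite (Derive_n_ext _ _ j x E).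
      replace (2 ^ S N * A * B) with (2 ^ N * A * B + 2 ^ N * A * B) by (simpl; ring).
      apply bnd_plus with N L; auto using smooth_mult, smooth_Derive; try lia.
      * apply IHN; auto using smooth_Derive, bnd_Derive.
        apply bnd_weaken with (S N) L B; auto; lra.
      * apply IHN; auto using smooth_Derive, bnd_Derive.
        apply bnd_weaken with (S N) L A; auto; lra.
Qed.

Lemma continuous_bounded (phi : R -> R) (a b : R) :
  (forall x, continuous phi x) -> exists M, 0 <= M /\ forall x, a <= x <= b -> Rabs (phi x) <= M.
Proof.
  intros H. destruct (Rle_or_lt a b) as [Hab|Hab].
  - destruct (continuity_ab_maj (fun x => Rabs (phi x)) a b Hab) as [m [Hm _]].
    + intros c _. apply continuity_pt_filterlim.
      apply (continuous_comp phi Rabs); [apply H|apply continuous_Rabs].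
    + exists (Rabs (phi m)). split; [apply Rabs_pos|auto].
  - exists 0. split; [lra|]. intros; lra.
Qed.

Lemma smooth_bnd (phi : R -> R) (N : nat) (L : R) :
  smooth phi -> exists M, 0 <= M /\ bnd N L M phi.
Proof.
  intros H. induction N.
  - destruct (continuous_bounded phi (- L) L) as [M [HM0 HM]].
    + intros; now apply smooth_continuous.
    + exists M. split; auto. intros j x Hj Hx. replace j with 0%nat by lia.
      apply HM. now apply Rabs_le_between.
  - destruct IHN as [M1 [HM1 HN]].
    destruct (continuous_bounded (Derive_n phi (S N)) (- L) L) as [M [HM0 HM]].
    + intros; now apply smooth_continuous, smooth_Derive_n.
    + exists (M1 + M). split; [lra|]. intros j x Hj Hx.
      destruct (Nat.eq_dec j (S N)) as [->|Hne].
      * apply Rle_trans with M; [|lra]. apply HM. now apply Rabs_le_between.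
      * apply Rle_trans with M1; [|lra]. apply HN; auto. lia.
Qed.


(** * Flat functions and smooth steps *)

Lemma is_derive_quadratic (f : R -> R) (x l A : R) :
  (forall h, Rabs h <= 1 -> Rabs (f (x + h) - f x - h * l) <= A * h ^ 2) -> is_derive f x l.
Proof.
  intros H. apply is_derive_Reals. intros eps Heps.
  assert (HA : 0 <= Rabs A) by apply Rabs_pos.
  assert (Hd : 0 < Rmin 1 (eps / (Rabs A + 1))).
  { apply Rmin_pos; [lra|]. apply Rdiv_lt_0_compat; lra. }
  exists (mkposreal _ Hd). simpl. intros h Hh0 Hh.
  assert (Hh1 : Rabs h < 1) by (eapply Rlt_le_trans; [exact Hh|apply Rmin_l]).
  assert (Hh2 : Rabs h < eps / (Rabs A + 1)) by (eapply Rlt_le_trans; [exact Hh|apply Rmin_r]).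
  assert (Hp := Rabs_pos_lt h Hh0).
  replace ((f (x + h) - f x) / h - l) with ((f (x + h) - f x - h * l) / h) by (field; auto).
  rewrite Rabs_div by auto.
  apply Rle_lt_trans with (Rabs A * Rabs h).
  - apply Rmult_le_reg_r with (Rabs h); auto.
    unfold Rdiv. rewrite Rmult_assoc, Rinv_l, Rmult_1_r by lra.
    eapply Rle_trans; [apply H; lra|].
    rewrite <- (pow2_abs h). simpl. rewrite Rmult_1_r, <- Rmult_assoc.
    apply Rmult_le_compat_r; [lra|]. apply Rmult_le_compat_r; [lra|]. apply Rle_abs.
  - apply Rmult_lt_compat_r with (r := Rabs A + 1) in Hh2; [|lra].
    unfold Rdiv in Hh2. rewrite Rmult_assoc, Rinv_l, Rmult_1_r in Hh2 by lra. nra.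
Qed.

Lemma is_derive_locally_eq (f g : R -> R) (x l p q : R) : p < x < q ->
  (forall y, p < y < q -> g y = f y) -> is_derive g x l -> is_derive f x l.
Proof.
  intros Hx H. apply is_derive_ext_loc.
  apply (locally_interval _ x p q); simpl; try apply Hx. intros y H1 H2. apply H; split; auto.
Qed.

(** For positive [m], [exp y = exp (y / m) ^ m >= (y / m) ^ m], so [m ^ m] serves as the
    constant. *)
Lemma pow_exp_bound (m : nat) : exists A, 0 < A /\ forall y, 0 <= y -> y ^ m * exp (- y) <= A.
Proof.
  destruct m.
  - exists 1. split; [lra|]. intros y Hy. simpl. rewrite Rmult_1_l, <- exp_0.
    destruct Hy as [Hy|<-]; [left; apply exp_increasing; lra|right; f_equal; lra].
  - assert (Hm : 0 < INR (S m)) by (apply lt_0_INR; lia).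
    exists (INR (S m) ^ S m). split; [now apply pow_lt|]. intros y Hy.
    assert (H : (y / INR (S m)) ^ S m <= exp y).
    { replace (exp y) with (exp (y / INR (S m)) ^ S m).
      - apply pow_incr. split; [apply Rdiv_le_0_compat; lra|].
        assert (E := exp_ineq1_le (y / INR (S m))). lra.
      - rewrite <- Rpower_pow by apply exp_pos. unfold Rpower. rewrite ln_exp. f_equal. field. lra. }
    rewrite exp_Ropp. assert (He := exp_pos y).
    apply Rmult_le_reg_r with (exp y); auto. rewrite Rmult_assoc, Rinv_l, Rmult_1_r by lra.
    replace (y ^ S m) with (INR (S m) ^ S m * (y / INR (S m)) ^ S m).
    + apply Rmult_le_compat_l; auto. apply pow_le; lra.
    + rewrite <- Rpow_mult_distr. f_equal. field. lra.
Qed.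

(* The functions [x^-m exp (-1/x)] form a family closed under differentiation. *)
Definition flat (m : nat) (x : R) : R := if Rlt_dec 0 x then (/ x) ^ m * exp (- / x) else 0.

Lemma is_derive_flat (m : nat) (x : R) :
  is_derive (flat m) x (- INR m * flat (S m) x + flat (S (S m)) x).
Proof.
  destruct (Rtotal_order x 0) as [H|[->|H]].
  - apply is_derive_locally_eq with (fun _ => 0) (x - 1) 0; [lra| |].
    + intros y Hy. unfold flat. destruct (Rlt_dec 0 y); lra.
    + unfold flat. destruct (Rlt_dec 0 x); [lra|]. rewrite Rmult_0_r, Rplus_0_r.
      apply @is_derive_const.
  (* With [y = / h], the bound on [y ^ (m + 2) * exp (- y)] says that [flat m h] is at most
     [A * h ^ 2], so the derivative at the origin is 0. *)
  - destruct (pow_exp_bound (m + 2)) as [A [HA Hb]].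
    apply is_derive_quadratic with A. intros h _. rewrite Rplus_0_l.
    assert (E : forall j, flat j 0 = 0).
    { intros j. unfold flat. destruct (Rlt_dec 0 0); lra. }
    rewrite !E. replace (flat m h - 0 - h * (- INR m * 0 + 0)) with (flat m h) by ring.
    unfold flat. destruct (Rlt_dec 0 h) as [Hh|Hh].
    + assert (Hi := Rinv_0_lt_compat h Hh). specialize (Hb (/ h) ltac:(lra)).
      rewrite Rabs_pos_eq.
      * apply Rmult_le_reg_r with ((/ h) ^ 2); [apply pow_lt; lra|].
        rewrite (Rmult_assoc A), <- Rpow_mult_distr, Rinv_r, pow1, Rmult_1_r by lra.
        eapply Rle_trans; [|exact Hb]. rewrite pow_add. right; ring.
      * apply Rmult_le_pos; [apply pow_le; lra|left; apply exp_pos].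
    + rewrite Rabs_R0. assert (0 <= h ^ 2) by apply pow2_ge_0. nra.
  - apply is_derive_locally_eq with (fun y => (/ y) ^ m * exp (- / y)) 0 (x + 1); [lra| |].
    + intros y Hy. unfold flat. destruct (Rlt_dec 0 y); lra.
    + unfold flat. destruct (Rlt_dec 0 x); [|lra].
      assert (D1 : is_derive (fun y => / y) x (- (/ x) ^ 2)).
      { auto_derive; [lra|]. field. lra. }
      assert (D2 : is_derive (fun y => exp (- / y)) x ((/ x) ^ 2 * exp (- / x))).
      { auto_derive; [lra|]. field. lra. }
      replace (- INR m * ((/ x) ^ S m * exp (- / x)) + (/ x) ^ S (S m) * exp (- / x))
        with ((INR m * (- (/ x) ^ 2) * (/ x) ^ pred m) * exp (- / x)
              + (/ x) ^ m * ((/ x) ^ 2 * exp (- / x))).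
      * apply (is_derive_Rmult (fun y => (/ y) ^ m) (fun y => exp (- / y))); [|exact D2]. apply (is_derive_pow (fun y => / y)), D1.
      * destruct m; simpl pred; [simpl INR|]; simpl pow; ring.
Qed.

Lemma smooth_flat (m : nat) : smooth (flat m).
Proof.
  intros k. revert m. induction k as [k IH] using (well_founded_induction lt_wf); intros m.
  destruct k; [intros x; exact I|].
  apply ex_derive_n_Sl with (fun x => - INR m * flat (S m) x + flat (S (S m)) x).
  - apply is_derive_flat.
  - intros x. apply ex_derive_n_plus; apply filter_forall; intros y j Hj.
    + apply ex_derive_n_scal_l, IH. lia.
    + apply IH. lia.
Qed.

Lemma flat0_pos (x : R) : 0 < x -> 0 < flat 0 x.
Proof.
  intros H. unfold flat. destruct (Rlt_dec 0 x); [|lra]. simpl. rewrite Rmult_1_l. apply exp_pos.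
Qed.

Lemma flat0_zero (x : R) : x <= 0 -> flat 0 x = 0.
Proof. intros H. unfold flat. destruct (Rlt_dec 0 x); lra. Qed.

Lemma smooth_ex_RInt (phi : R -> R) (a b : R) : smooth phi -> ex_RInt phi a b.
Proof.
  intros H. apply (ex_RInt_continuous (V := R_CompleteNormedModule)).
  intros x _. now apply smooth_continuous.
Qed.

Lemma smooth_step_exists : exists sg : R -> R, smooth sg /\
  (forall x, x <= 0 -> sg x = 0) /\ (forall x, 1 <= x -> sg x = 1).
Proof.
  (* A bump that is positive exactly on (0, 1); its normalized primitive is the step. The argument
     [1 - x] is written as a scaled translate to fit [smooth_trans] and [smooth_comp_scal]. *)
  set (beta := fun x => flat 0 x * flat 0 (-1 * (x + - (1)))).
  assert (Sb : smooth beta).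
  { apply smooth_mult; [apply smooth_flat|].
    apply (smooth_trans (fun x => flat 0 (-1 * x))), smooth_comp_scal, smooth_flat. }
  assert (Z : forall x, x <= 0 \/ 1 <= x -> beta x = 0).
  { intros x [H|H]; unfold beta.
    - rewrite (flat0_zero x) by lra. ring.
    - rewrite (flat0_zero (-1 * _)) by lra. ring. }
  assert (Hc : 0 < RInt beta 0 1).
  { apply RInt_gt_0; [lra| |].
    - intros x Hx. apply Rmult_lt_0_compat; apply flat0_pos; lra.
    - intros x _. now apply smooth_continuous. }
  exists (fun x => / RInt beta 0 1 * RInt beta 0 x). repeat split.
  - apply smooth_scal. apply smooth_of_derive with beta; auto.
    intros x. apply (is_derive_RInt beta (RInt beta 0) 0 x).
    + apply filter_forall. intros y. apply (RInt_correct (V := R_CompleteNormedModule)).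
      now apply smooth_ex_RInt.
    + now apply smooth_continuous.
  - intros x Hx. rewrite (RInt_ext beta (fun _ => 0) 0 x).
    + rewrite RInt_const. unfold scal; simpl; unfold mult; simpl. ring.
    + intros y Hy. rewrite Rmin_right, Rmax_left in Hy by lra. apply Z. lra.
  - intros x Hx.
    assert (C := RInt_Chasles beta 0 1 x (smooth_ex_RInt _ _ _ Sb) (smooth_ex_RInt _ _ _ Sb)).
    rewrite <- C. rewrite (RInt_ext beta (fun _ => 0) 1 x).
    + rewrite RInt_const. unfold plus, scal; simpl; unfold mult; simpl. field. lra.
    + intros y Hy. rewrite Rmin_left, Rmax_right in Hy by lra. apply Z. lra.
Qed.

Lemma smooth_step_at (p q : R) : p < q -> exists sg : R -> R, smooth sg /\
  (forall x, x <= p -> sg x = 0) /\ (forall x, q <= x -> sg x = 1).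
Proof.
  intros Hpq. destruct smooth_step_exists as [sg [S [H0 H1]]].
  exists (fun x => sg (/ (q - p) * (x + - p))).
  assert (Hi : 0 < / (q - p)) by (apply Rinv_0_lt_compat; lra).
  repeat split.
  - apply (smooth_trans (fun x => sg (/ (q - p) * x))), smooth_comp_scal, S.
  - intros x Hx. apply H0. nra.
  - intros x Hx. apply H1.
    apply Rmult_le_reg_l with (q - p); [lra|]. rewrite <- Rmult_assoc, Rinv_r by lra. lra.
Qed.

Lemma smooth_bump_at (p' p q q' : R) : p' < p -> q < q' -> exists rho : R -> R, smooth rho /\
  (forall x, p <= x <= q -> rho x = 1) /\ (forall x, x <= p' \/ q' <= x -> rho x = 0).
Proof.
  intros Hp Hq.
  destruct (smooth_step_at p' p Hp) as [s1 [S1 [A1 B1]]].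
  destruct (smooth_step_at q q' Hq) as [s2 [S2 [A2 B2]]].
  exists (fun x => s1 x * (1 - s2 x)). repeat split.
  - apply smooth_mult; auto. apply smooth_minus; auto. apply smooth_const.
  - intros x Hx. rewrite B1, A2 by lra. ring.
  - intros x [Hx|Hx]; [rewrite A1 by lra|rewrite B2 by lra]; ring.
Qed.

(** * Approximation by exponentials *)

Lemma Derive_n_vanish (phi : R -> R) (R0 : R) (j : nat) (x : R) :
  (forall x, R0 < Rabs x -> phi x = 0) -> R0 < Rabs x -> Derive_n phi j x = 0.
Proof.
  intros H Hx.
  assert (E : exists p q, p < x < q /\ forall y, p < y < q -> R0 < Rabs y).
  { unfold Rabs in Hx. destruct (Rcase_abs x).
    - exists (x - 1), (Rmin 0 (- R0)). split; [split; [lra|apply Rmin_glb_lt; lra]|].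
      intros y [_ Hy]. assert (y < 0) by (eapply Rlt_le_trans; [exact Hy|apply Rmin_l]).
      assert (y < - R0) by (eapply Rlt_le_trans; [exact Hy|apply Rmin_r]).
      rewrite Rabs_left by auto. lra.
    (* The case [x = 0] occurs only for negative [R0], where any neighbourhood will do. *)
    - destruct (Req_dec x 0) as [->|Hx0].
      + exists (-1), 1. split; [lra|]. intros y _. assert (Hy := Rabs_pos y). lra.
      + exists (Rmax 0 R0), (x + 1). split; [split; [apply Rmax_lub_lt; lra|lra]|].
        intros y [Hy _]. assert (0 < y) by (eapply Rle_lt_trans; [apply Rmax_l|exact Hy]).
        assert (R0 < y) by (eapply Rle_lt_trans; [apply Rmax_r|exact Hy]).
        rewrite Rabs_right by lra. lra. }
  destruct E as [p [q [Hpq Hy]]].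
  rewrite (Derive_n_locally_eq phi (fun _ => 0) j x p q); auto.
  destruct j; [reflexivity|]. apply Derive_n_const.
Qed.

(* Expanding [1 - exp (- e^(n(s-x)))], a smoothed indicator of [s > x], in powers of
   [e^(-nx)] turns [phi x = - \int phi' 1_(s > x) ds] into the series whose partial sums are
   [gsum].  The size of the coefficients is controlled by the right end of the support. *)
Definition gcoef (phi : R -> R) (r : R) (n k : nat) : R :=
  (-1) ^ k / INR (fact (S k)) *
  - RInt (fun s => Derive phi s * exp (INR (S k * n) * s)) (- r) r.

Definition gsum (phi : R -> R) (r : R) (n K : nat) (x : R) : R :=
  sum_f_R0 (fun k => gcoef phi r n k * exp (- INR (S k * n) * x)) K.

(** Taylor polynomial of degree [K + 1] of [1 - exp (- y)]; the constant term cancels, hence the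
    shift to [S k]. *)
Definition exp_tail (K : nat) (y : R) : R :=
  sum_f_R0 (fun k => (-1) ^ k / INR (fact (S k)) * y ^ S k) K.

Lemma exp_tail_approx (K : nat) (y : R) : 0 <= y ->
  Rabs (exp_tail K y - (1 - exp (- y))) <= y ^ S (S K) / INR (fact (S (S K))).
Proof.
  intros [Hy|<-].
  - assert (S1 := smooth_exp (-1)).
    destruct (Taylor_Lagrange (fun t => exp (-1 * t)) (S K) 0 y Hy) as [z [Hz E]].
    { intros t _ k _. apply S1. }
    assert (E1 : sum_f_R0 (fun m => (y - 0) ^ m / INR (fact m)
        * Derive_n (fun t => exp (-1 * t)) m 0) (S K) = 1 - exp_tail K y).
    { unfold exp_tail. rewrite decomp_sum by lia. rewrite Derive_n_exp. simpl pred.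
      rewrite Rmult_0_r, exp_0.
      set (t := sum_f_R0 (fun k => (-1) ^ k / INR (fact (S k)) * y ^ S k) K).
      replace (1 - t) with (1 + -1 * t) by ring. unfold t. f_equal.
      - simpl. field.
      - rewrite scal_sum. apply sum_eq. intros i _. rewrite Derive_n_exp, Rmult_0_r, exp_0, Rminus_0_r.
        change ((-1) ^ S i) with (-1 * (-1) ^ i). field. apply INR_fact_neq_0. }
    rewrite E1, Derive_n_exp, Rminus_0_r in E.
    replace (-1 * y) with (- y) in E by ring.
    replace (exp_tail K y - (1 - exp (- y))) with
      (y ^ S (S K) / INR (fact (S (S K))) * ((-1) ^ S (S K) * exp (-1 * z))) by (rewrite E; ring).
    assert (Hp : 0 <= y ^ S (S K) / INR (fact (S (S K)))).
    { apply Rdiv_le_0_compat; [apply pow_le; lra|apply INR_fact_lt_0]. }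
    rewrite Rabs_mult, (Rabs_pos_eq _ Hp), Rabs_mult, pow_1_abs, Rmult_1_l.
    rewrite Rabs_pos_eq by (left; apply exp_pos).
    assert (exp (-1 * z) <= 1).
    { rewrite <- exp_0. left. apply exp_increasing. lra. }
    nra.
  - replace (exp_tail K 0) with 0.
    + rewrite Ropp_0, exp_0. rewrite pow_i by lia. unfold Rdiv. rewrite Rmult_0_l.
      replace (0 - (1 - 1)) with 0 by ring. rewrite Rabs_R0. lra.
    + unfold exp_tail. symmetry. apply sum_eq_R0. intros i _. rewrite pow_i by lia. ring.
Qed.

Section Gumbel.

Variables (phi : R -> R) (r : R).
Hypothesis phi_smooth : smooth phi.
Hypothesis r_large : 1 <= r.
Hypothesis phi_supp : forall x, r - 1 < Rabs x -> phi x = 0.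

(** Integration by parts; the boundary terms vanish because [phi] is already zero for [|x| > r - 1].
    Hence [gsum] commutes with differentiation, and one estimate in the sup norm serves all
    derivatives. *)
Lemma gcoef_Derive (n k : nat) :
  gcoef (Derive phi) r n k = - INR (S k * n) * gcoef phi r n k.
Proof.
  unfold gcoef. set (m := INR (S k * n)).
  assert (I1 : is_RInt (fun s => Derive (Derive phi) s * exp (m * s)
      + Derive phi s * (m * exp (m * s))) (- r) r 0).
  { assert (Sp := smooth_Derive _ phi_smooth).
    assert (Z : forall x, Rabs x = r -> Derive phi x = 0).
    { intros x Hx. apply (Derive_n_vanish phi (r - 1) 1 x); auto. lra. }
    replace 0 with (minus (Derive phi r * exp (m * r)) (Derive phi (- r) * exp (m * - r))).
    - apply (is_RInt_derive (V := R_CompleteNormedModule) (fun s => Derive phi s * exp (m * s))).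
      + intros x _. apply (is_derive_Rmult (Derive phi) (fun s => exp (m * s))); [now apply smooth_is_derive|].
        auto_derive; auto. ring.
      + intros x _. apply smooth_continuous. apply smooth_plus; apply smooth_mult;
          auto using smooth_Derive, smooth_exp, smooth_scal.
    - rewrite (Z r), (Z (- r)).
      + unfold minus, plus, opp; simpl. ring.
      + rewrite Rabs_Ropp, Rabs_pos_eq; lra.
      + rewrite Rabs_pos_eq; lra. }
  assert (Sp := smooth_Derive _ phi_smooth).
  assert (I2 := RInt_plus (V := R_CompleteNormedModule)
    (fun s => Derive (Derive phi) s * exp (m * s)) (fun s => m * (Derive phi s * exp (m * s))) (- r) r
    (smooth_ex_RInt _ _ _ (smooth_mult _ _ (smooth_Derive _ Sp) (smooth_exp m)))
    (smooth_ex_RInt _ _ _ (smooth_scal m _ (smooth_mult _ _ Sp (smooth_exp m))))).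
  assert (I3 := RInt_scal (V := R_CompleteNormedModule) (fun s => Derive phi s * exp (m * s)) (- r) r m
    (smooth_ex_RInt _ _ _ (smooth_mult _ _ Sp (smooth_exp m)))).
  apply (is_RInt_unique (V := R_CompleteNormedModule)) in I1.
  unfold plus, scal in *; simpl in I2, I3; unfold mult in I3; simpl in I3. 
  rewrite I3 in I2.
  rewrite (RInt_ext _ (fun s => Derive (Derive phi) s * exp (m * s)
      + Derive phi s * (m * exp (m * s)))) in I2 by (intros; simpl; ring).
  assert (I4 : RInt (fun s => Derive (Derive phi) s * exp (m * s)) (- r) r
    = - m * RInt (fun s => Derive phi s * exp (m * s)) (- r) r) by lra.
  rewrite I4. ring.
Qed.

Lemma Derive_gsum (n K : nat) (x : R) : Derive (gsum phi r n K) x = gsum (Derive phi) r n K x.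
Proof.
  apply is_derive_unique. unfold gsum. induction K; simpl sum_f_R0.
  - rewrite gcoef_Derive. set (m := INR _). set (c := gcoef _ _ _ _). auto_derive; auto. ring.
  - apply (is_derive_plus (V := R_NormedModule)); [exact IHK|].
    rewrite gcoef_Derive. set (m := INR _). set (c := gcoef _ _ _ _). auto_derive; auto. ring.
Qed.

Lemma smooth_gsum (n K : nat) : smooth (gsum phi r n K).
Proof. apply smooth_sum. intros i. apply smooth_scal, smooth_exp. Qed.

(** Each power of [exp (n (s - x))] is a function of [s] times a function of [x], and the former
    integrates against [phi'] to a coefficient. The sign comes from [phi x] being minus the integral
    of [phi'] from [x] to [r]. *)
Lemma is_RInt_gsum (n K : nat) (x : R) :
  is_RInt (fun s => Derive phi s * exp_tail K (exp (INR n * (s - x)))) (- r) r (- gsum phi r n K x).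
Proof.
  assert (T : forall k, is_RInt (fun s => Derive phi s *
      ((-1) ^ k / INR (fact (S k)) * exp (INR n * (s - x)) ^ S k)) (- r) r
      (- (gcoef phi r n k * exp (- INR (S k * n) * x)))).
  { intros k. unfold gcoef. set (m := INR (S k * n)). set (c := (-1) ^ k / INR (fact (S k))).
    apply (is_RInt_ext (fun s => scal (c * exp (- m * x)) (Derive phi s * exp (m * s)))).
    - intros s _.
      change (c * exp (- m * x) * (Derive phi s * exp (m * s))
        = Derive phi s * (c * exp (INR n * (s - x)) ^ S k)).
      replace (exp (INR n * (s - x)) ^ S k) with (exp (- m * x) * exp (m * s)); [ring|].
      { rewrite <- exp_plus, <- Rpower_pow by apply exp_pos. unfold Rpower. rewrite ln_exp.
        f_equal. unfold m. rewrite mult_INR. ring. }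
    - replace (- (c * - RInt (fun s => Derive phi s * exp (m * s)) (- r) r * exp (- m * x)))
        with (scal (c * exp (- m * x)) (RInt (fun s => Derive phi s * exp (m * s)) (- r) r))
        by (unfold scal; simpl; unfold mult; simpl; ring).
      apply (is_RInt_scal (V := R_NormedModule)), (RInt_correct (V := R_CompleteNormedModule)).
      apply smooth_ex_RInt, smooth_mult; auto using smooth_Derive, smooth_exp. }
  unfold gsum, exp_tail. induction K; [apply T|].
  simpl sum_f_R0. rewrite Ropp_plus_distr.
  eapply is_RInt_ext; [|apply (is_RInt_plus (V := R_NormedModule)); [exact IHK|exact (T (S K))]].
  intros s _. unfold plus; simpl. ring.
Qed.

(** With [y = exp (n (s - x))], the smoothed indicator [1 - exp (- y)] is at most [y] for [s < x]
    and differs from 1 by at most [1 / y] for [s > x]; each error integrates to at most [1 / n]. The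
    last term is the Taylor error, over a length of at most [2 * r] on each side of [x]. *)
Lemma gsum_approx (n K : nat) (M x : R) : (1 <= n)%nat -> Rabs x <= r ->
  (forall s, Rabs s <= r -> Rabs (Derive phi s) <= M) ->
  Rabs (gsum phi r n K x - phi x) <=
    M * (2 / INR n + 4 * r * (exp (INR n * (2 * r)) ^ S (S K) / INR (fact (S (S K))))).
Proof.
  intros Hn Hx HM. apply Rabs_le_between in Hx.
  assert (Hn' : 0 < INR n) by (apply lt_0_INR; lia).
  set (e := exp (INR n * (2 * r)) ^ S (S K) / INR (fact (S (S K)))).
  assert (HM0 : 0 <= M).
  { eapply Rle_trans; [apply Rabs_pos|apply (HM 0)]. rewrite Rabs_R0; lra. }
  assert (He : 0 <= e).
  { apply Rdiv_le_0_compat; [apply pow_le; left; apply exp_pos|apply INR_fact_lt_0]. }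
  assert (T : forall s, - r <= s <= r ->
    Rabs (exp_tail K (exp (INR n * (s - x))) - (1 - exp (- exp (INR n * (s - x))))) <= e).
  { intros s Hs. eapply Rle_trans; [apply exp_tail_approx; left; apply exp_pos|].
    apply Rmult_le_compat_r; [left; apply Rinv_0_lt_compat, INR_fact_lt_0|].
    apply pow_incr. split; [left; apply exp_pos|].
    assert (INR n * (s - x) <= INR n * (2 * r)) by (apply Rmult_le_compat_l; lra).
    destruct H as [H| ->]; [left; now apply exp_increasing|lra]. }
  assert (C1 : ex_RInt (fun s => Derive phi s * exp_tail K (exp (INR n * (s - x)))) (- r) x).
  { apply (ex_RInt_Chasles_1 (V := R_CompleteNormedModule)) with r; [lra|]. eexists; apply is_RInt_gsum. }
  assert (C2 : ex_RInt (fun s => Derive phi s * exp_tail K (exp (INR n * (s - x)))) x r).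
  { apply (ex_RInt_Chasles_2 (V := R_CompleteNormedModule)) with (- r); [lra|]. eexists; apply is_RInt_gsum. }
  destruct C1 as [A HA]. destruct C2 as [B HB].
  assert (E : - gsum phi r n K x = A + B).
  { apply (is_RInt_unique (V := R_CompleteNormedModule)) in HA as HA'.
    assert (U := is_RInt_Chasles (V := R_NormedModule) _ _ _ _ _ _ HA HB).
    apply (is_RInt_unique (V := R_CompleteNormedModule)) in U. unfold plus in U; simpl in U.
    assert (W := is_RInt_gsum n K x).
    apply (is_RInt_unique (V := R_CompleteNormedModule)) in W.
    rewrite <- W. exact U. }
  assert (P : is_RInt (Derive phi) x r (- phi x)).
  { replace (- phi x) with (minus (phi r) (phi x)).
    - apply (is_RInt_derive (V := R_CompleteNormedModule)).
      + intros y _. now apply smooth_is_derive.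
      + intros y _. now apply smooth_continuous, smooth_Derive.
    - rewrite phi_supp; [unfold minus, plus, opp; simpl; ring|]. rewrite Rabs_pos_eq; lra. }
  assert (BA : Rabs A <= M * (1 / INR n + 2 * r * e)).
  { apply Rle_trans with (M * ((1 - exp (INR n * (- r - x))) / INR n + (x + r) * e)).
    - apply (norm_RInt_le (V := R_NormedModule)
        (fun s => Derive phi s * exp_tail K (exp (INR n * (s - x))))
        (fun s => M * (exp (INR n * (s - x)) + e)) (- r) x); [lra| |exact HA|].
      + intros s Hs. unfold norm; simpl; unfold abs; simpl. rewrite Rabs_mult.
        apply Rmult_le_compat; try apply Rabs_pos.
        * apply HM, Rabs_le_between. lra.
        * specialize (T s ltac:(lra)). set (y := exp (INR n * (s - x))) in *.
          assert (0 < y) by apply exp_pos.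
          assert (1 - y <= exp (- y)) by (assert (E1 := exp_ineq1_le (- y)); lra).
          assert (exp (- y) <= 1) by (rewrite <- exp_0; left; apply exp_increasing; lra).
          apply Rabs_le_between in T. apply Rabs_le_between. lra.
      + replace (M * ((1 - exp (INR n * (- r - x))) / INR n + (x + r) * e)) with
          (minus (M * (exp (INR n * (x - x)) / INR n + e * x))
                 (M * (exp (INR n * (- r - x)) / INR n + e * - r))).
        * apply (is_RInt_derive (V := R_CompleteNormedModule)
            (fun s => M * (exp (INR n * (s - x)) / INR n + e * s))).
          -- intros s _. auto_derive; auto. change (s + - x) with (s - x). field. lra.
          -- intros s _. apply (ex_derive_continuous (V := R_NormedModule)). auto_derive; auto.
        * unfold minus, plus, opp; simpl. rewrite Rminus_diag_eq, Rmult_0_r, exp_0 by auto. field. lra.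
    - apply Rmult_le_compat_l; auto. apply Rplus_le_compat.
      + apply Rmult_le_compat_r; [left; now apply Rinv_0_lt_compat|].
        assert (H := exp_pos (INR n * (- r - x))). lra.
      + apply Rmult_le_compat_r; lra. }
  assert (BB : Rabs (B - - phi x) <= M * (1 / INR n + 2 * r * e)).
  { apply Rle_trans with (M * ((1 - exp (- INR n * (r - x))) / INR n + (r - x) * e)).
    - apply (norm_RInt_le (V := R_NormedModule)
        (fun s => minus (Derive phi s * exp_tail K (exp (INR n * (s - x)))) (Derive phi s))
        (fun s => M * (exp (- INR n * (s - x)) + e)) x r); [lra| | |].
      + intros s Hs. unfold norm, minus, plus, opp; simpl; unfold abs; simpl.
        replace (Derive phi s * exp_tail K (exp (INR n * (s - x))) + - Derive phi s)
          with (Derive phi s * (exp_tail K (exp (INR n * (s - x))) - 1)) by ring.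
        rewrite Rabs_mult. apply Rmult_le_compat; try apply Rabs_pos.
        * apply HM, Rabs_le_between. lra.
        * specialize (T s ltac:(lra)).
          replace (- INR n * (s - x)) with (- (INR n * (s - x))) by ring. rewrite exp_Ropp.
          set (y := exp (INR n * (s - x))) in *.
          assert (Hy : 0 < y) by apply exp_pos.
          assert (exp (- y) <= / y).
          { rewrite exp_Ropp. apply Rinv_le_contravar; auto.
            assert (E1 := exp_ineq1_le y). lra. }
          assert (0 < exp (- y)) by apply exp_pos.
          apply Rabs_le_between in T. apply Rabs_le_between. lra.
      + apply (is_RInt_minus (V := R_NormedModule)); auto.
      + replace (M * ((1 - exp (- INR n * (r - x))) / INR n + (r - x) * e)) with
          (minus (M * (- exp (- INR n * (r - x)) / INR n + e * r))
                 (M * (- exp (- INR n * (x - x)) / INR n + e * x))).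
        * apply (is_RInt_derive (V := R_CompleteNormedModule)
            (fun s => M * (- exp (- INR n * (s - x)) / INR n + e * s))).
          -- intros s _. auto_derive; auto. change (s + - x) with (s - x). field. lra.
          -- intros s _. apply (ex_derive_continuous (V := R_NormedModule)). auto_derive; auto.
        * unfold minus, plus, opp; simpl. replace (- INR n * (x - x)) with 0 by ring. rewrite exp_0. field. lra.
    - apply Rmult_le_compat_l; auto. apply Rplus_le_compat.
      + apply Rmult_le_compat_r; [left; now apply Rinv_0_lt_compat|].
        assert (H := exp_pos (- INR n * (r - x))). lra.
      + apply Rmult_le_compat_r; lra. }
  replace (gsum phi r n K x - phi x) with (- (A + (B - - phi x))) by lra.
  rewrite Rabs_Ropp. eapply Rle_trans; [apply Rabs_triang|].
  replace (M * (2 / INR n + 4 * r * e)) with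
    (M * (1 / INR n + 2 * r * e) + M * (1 / INR n + 2 * r * e)) by (field; lra).
  lra.
Qed.

Lemma gcoef_bound (n k : nat) (M s0 : R) :
  (forall s, Rabs s <= r -> Rabs (Derive phi s) <= M) ->
  (forall s, s0 <= s -> phi s = 0) ->
  Rabs (gcoef phi r n k) <= 2 * r * M / INR (fact (S k)) * exp (INR (S k * n) * s0).
Proof.
  intros HM Hs. unfold gcoef. set (m := INR (S k * n)).
  assert (Hf := INR_fact_lt_0 (S k)).
  assert (Hm : 0 <= m) by apply pos_INR.
  assert (HM0 : 0 <= M).
  { eapply Rle_trans; [apply Rabs_pos|apply (HM 0)]. rewrite Rabs_R0; lra. }
  rewrite Rabs_mult, Rabs_Ropp. unfold Rdiv at 1. rewrite Rabs_mult, pow_1_abs, Rmult_1_l.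
  rewrite Rabs_pos_eq by (left; now apply Rinv_0_lt_compat).
  replace (2 * r * M / INR (fact (S k)) * exp (m * s0))
    with (/ INR (fact (S k)) * ((r - - r) * (M * exp (m * s0)))) by (field; lra).
  apply Rmult_le_compat_l; [left; now apply Rinv_0_lt_compat|].
  apply abs_RInt_le_const; [lra| |].
  - apply smooth_ex_RInt, smooth_mult; auto using smooth_Derive, smooth_exp.
  - intros s Hsr. rewrite Rabs_mult, (Rabs_pos_eq (exp _)) by (left; apply exp_pos).
    destruct (Rle_or_lt s s0) as [H|H].
    + apply Rmult_le_compat; try apply Rabs_pos; try (left; apply exp_pos).
      * apply HM, Rabs_le_between. lra.
      * assert (m * s <= m * s0) by (apply Rmult_le_compat_l; lra).
        destruct H0 as [H0| ->]; [left; now apply exp_increasing|lra].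
    + replace (Derive phi s) with 0.
      * rewrite Rabs_R0, Rmult_0_l. apply Rmult_le_pos; [lra|left; apply exp_pos].
      * symmetry. apply is_derive_unique.
        apply is_derive_locally_eq with (fun _ => 0) s0 (s + 1); [lra| |apply @is_derive_const].
        intros y Hy. symmetry. apply Hs. lra.
Qed.

End Gumbel.

Lemma Derive_n_gsum (phi : R -> R) (r : R) (n K j : nat) (x : R) : smooth phi -> 1 <= r ->
  (forall x, r - 1 < Rabs x -> phi x = 0) ->
  Derive_n (gsum phi r n K) j x = gsum (Derive_n phi j) r n K x.
Proof.
  intros Sm Hr H. revert x. induction j; intros x; [reflexivity|].
  simpl. rewrite (Derive_ext _ _ x IHj). apply Derive_gsum; auto using smooth_Derive_n.
  intros y Hy. now apply Derive_n_vanish with (r - 1).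
Qed.

(** The Taylor error contains [exp (2 r n)] to the power [K + 2], so [K] has to be chosen after
    [n]. *)
Lemma gsum_density (phi : R -> R) (r : R) (N : nat) (eps : R) : smooth phi -> 1 <= r ->
  (forall x, r - 1 < Rabs x -> phi x = 0) -> 0 < eps ->
  exists n0, forall n, (n0 <= n)%nat -> (1 <= n)%nat ->
  exists K0, forall K, (K0 <= K)%nat -> bnd N r eps (fun x => gsum phi r n K x - phi x).
Proof.
  intros Sm Hr H Heps.
  (* Order [N + 1], since the estimate for the derivative of order [j] uses the one of order
     [j + 1]. *)
  destruct (smooth_bnd phi (S N) r Sm) as [M [HM0 HM]].
  destruct (INR_unbounded (4 * M / eps)) as [n0 Hn0].
  exists n0. intros n Hn Hn1.
  assert (Hn' : 0 < INR n) by (apply lt_0_INR; lia).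
  assert (Hnn : INR n0 <= INR n) by now apply le_INR.
  (* [M + 1] keeps the denominator positive when [M = 0]. *)
  assert (HD : 0 < eps / (8 * r * (M + 1))) by (apply Rdiv_lt_0_compat; nra).
  destruct (cv_speed_pow_fact (exp (INR n * (2 * r))) _ HD) as [K0 HK0].
  exists K0. intros K HK j x Hj Hx.
  specialize (HK0 (S (S K)) ltac:(lia)). unfold R_dist in HK0. rewrite Rminus_0_r in HK0.
  apply Rabs_lt_between in HK0. destruct HK0 as [_ HK0].
  rewrite (Derive_n_Rminus (gsum phi r n K) phi) by auto using smooth_gsum.
  rewrite Derive_n_gsum by auto.
  eapply Rle_trans.
  - apply gsum_approx with (M := M); auto using smooth_Derive_n.
    + intros y Hy. now apply Derive_n_vanish with (r - 1).
    + intros s Hs. apply (HM (S j)); auto. lia.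
  - set (e := exp (INR n * (2 * r)) ^ S (S K) / INR (fact (S (S K)))) in *.
    assert (A1 : M * (2 / INR n) <= eps / 2).
    { replace (M * (2 / INR n)) with (2 * M / INR n) by (field; lra).
      apply Rmult_le_reg_r with (2 * INR n / eps); [apply Rdiv_lt_0_compat; lra|].
      replace (2 * M / INR n * (2 * INR n / eps)) with (4 * M / eps) by (field; lra).
      replace (eps / 2 * (2 * INR n / eps)) with (INR n) by (field; lra). lra. }
    assert (A2 : M * (4 * r * e) <= eps / 2).
    { apply Rle_trans with (M * (4 * r * (eps / (8 * r * (M + 1))))).
      - apply Rmult_le_compat_l; auto. apply Rmult_le_compat_l; lra.
      - replace (M * (4 * r * (eps / (8 * r * (M + 1))))) with (eps / 2 * (M / (M + 1))) by (field; lra).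
        assert (M / (M + 1) <= 1).
        { apply Rmult_le_reg_r with (M + 1); [lra|]. unfold Rdiv.
          rewrite Rmult_assoc, Rinv_l by lra. lra. }
        nra. }
    rewrite Rmult_plus_distr_l. lra.
Qed.

(** * Compactly supported distributions and their Laplace samples *)

(** The class [Q] is a parameter: [smooth] gives distributions of compact support on the line,
    [test_fun] those on the circle, and both share the lemmas on differentiation and pairing. *)
Definition fdist (Q : (R -> R) -> Prop) (F : (R -> R) -> C) : Prop :=
  (forall phi psi, Q phi -> Q psi -> F (fun x => phi x + psi x) = (F phi + F psi)%C) /\
  (forall a phi, Q phi -> F (fun x => a * phi x) = (RtoC a * F phi)%C) /\
  (exists (N : nat) (C0 L : R), 0 <= C0 /\ 0 <= L /\ forall phi, Q phi -> forall M,
     bnd N L M phi -> Cmod (F phi) <= C0 * M).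

Notation cdist := (fdist smooth).

(** The tests stop at some [s' < s]: this is vanishing on the open half-line, so a supremum of
    admissible [s] is admissible. Towards the left the tests may be unbounded, as [F] will have
    compact support. *)
Definition vanishes_below (F : (R -> R) -> C) (s : R) : Prop :=
  forall phi s', smooth phi -> s' < s -> (forall x, s' <= x -> phi x = 0) -> F phi = RtoC 0.

Definition laplace (F : (R -> R) -> C) (m : nat) : C := F (fun x => exp (- INR m * x)).

(** The power of [m] allows for the order of the distribution: differentiating a distribution
    multiplies its sample by [m], up to sign. *)
Definition decays (A : nat -> C) (s : R) : Prop :=
  exists (N : nat) (C0 : R), 0 <= C0 /\
    forall m, (1 <= m)%nat -> Cmod (A m) <= C0 * INR m ^ N * exp (- INR m * s).

Lemma fdist_zero Q F phi : fdist Q F -> Q phi -> F (fun _ => 0) = RtoC 0.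
Proof.
  intros [_ [H _]] Hq. replace (fun _ : R => 0) with (fun x => 0 * phi x).
  - rewrite H by auto. ring.
  - apply functional_extensionality; intros x; ring.
Qed.

Lemma fdist_opp Q F phi : fdist Q F -> Q phi -> F (fun x => - phi x) = (- F phi)%C.
Proof.
  intros [_ [H _]] Hq. replace (fun x : R => - phi x) with (fun x => - (1) * phi x).
  - rewrite H by auto. rewrite RtoC_opp. ring.
  - apply functional_extensionality; intros x; ring.
Qed.

Lemma cdist_minus F phi psi : cdist F -> smooth phi -> smooth psi ->
  F (fun x => phi x - psi x) = (F phi - F psi)%C.
Proof.
  intros H H1 H2. unfold Rminus. rewrite (proj1 H phi (fun x => - psi x)) by auto using smooth_opp.
  now rewrite (fdist_opp smooth).
Qed.

Lemma cdist_sum_bound F (c : nat -> R) (e : nat -> R -> R) (K : nat) : cdist F ->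
  (forall k, smooth (e k)) ->
  Cmod (F (fun x => sum_f_R0 (fun k => c k * e k x) K)) <=
  sum_f_R0 (fun k => Rabs (c k) * Cmod (F (e k))) K.
Proof.
  intros HF He. induction K; simpl sum_f_R0.
  - rewrite (proj1 (proj2 HF)), Cmod_mult, Cmod_R by auto. lra.
  - rewrite (proj1 HF) by (auto using smooth_scal; apply (smooth_sum (fun k x => c k * e k x)); auto using smooth_scal).
    eapply Rle_trans; [apply Cmod_triangle|]. apply Rplus_le_compat; auto.
    rewrite (proj1 (proj2 HF)), Cmod_mult, Cmod_R by auto. lra.
Qed.

Lemma Cmod_le_eps (z : C) : (forall eps, 0 < eps -> Cmod z <= eps) -> z = RtoC 0.
Proof.
  intros H. apply Cmod_eq_0. assert (H0 := Cmod_ge_0 z).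
  destruct H0 as [H0|H0]; auto. specialize (H (Cmod z / 2) ltac:(lra)). lra.
Qed.

(** The functional only sees derivatives on [[-L, L]]; the margin 1 makes the two functions agree on
    a neighbourhood of that interval, hence with all their derivatives. *)
Lemma cdist_local F : cdist F -> exists L, 0 <= L /\ forall phi psi, smooth phi -> smooth psi ->
  (forall x, Rabs x < L + 1 -> phi x = psi x) -> F phi = F psi.
Proof.
  intros HF. assert (HF' := HF). destruct HF' as [_ [_ [N [C0 [L [HC [HL H]]]]]]].
  exists L. split; auto. intros phi psi S1 S2 E.
  assert (Z : (F phi - F psi)%C = RtoC 0).
  { rewrite <- cdist_minus by auto. apply Cmod_eq_0. apply Rle_antisym; [|apply Cmod_ge_0].
    replace 0 with (C0 * 0) by ring. apply H; [now apply smooth_minus|].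
    intros j x Hj Hx. apply Rabs_le_between in Hx.
    rewrite (Derive_n_locally_eq _ (fun _ => 0) j x (- L - 1) (L + 1)); [|lra|].
    2:{ intros y Hy. rewrite E; [ring|]. apply Rabs_lt_between. lra. }
    destruct j; [simpl|rewrite Derive_n_const]; rewrite Rabs_R0; lra. }
  replace (F phi) with ((F phi - F psi) + F psi)%C by ring. rewrite Z. ring.
Qed.

Lemma bounded_all_orders (psi : R -> R) (N : nat) : smooth psi ->
  (exists r0, forall j x, r0 <= Rabs x -> Rabs (Derive_n psi j x) <= 1) ->
  exists M, 0 <= M /\ forall j x, (j <= N)%nat -> Rabs (Derive_n psi j x) <= M.
Proof.
  intros S [r0 H]. destruct (smooth_bnd psi N r0 S) as [M [HM0 HM]].
  exists (Rmax M 1). split; [eapply Rle_trans; [exact HM0|apply Rmax_l]|].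
  intros j x Hj. destruct (Rle_or_lt (Rabs x) r0).
  - eapply Rle_trans; [apply HM; auto|apply Rmax_l].
  - eapply Rle_trans; [apply H; lra|apply Rmax_r].
Qed.

(* Cut [e^(-mx)] off below [s] at scale [1/m]: each derivative costs one factor [m]. *)
Lemma vanishes_below_decays F s : cdist F -> vanishes_below F s -> decays (laplace F) s.
Proof.
  intros HF HV. assert (HF' := HF). destruct HF' as [_ [_ [N [C0 [L [HC [HL H]]]]]]].
  (* The step sits left of 0, so that after rescaling the discarded part of the exponential is
     supported left of [s - / m], strictly below [s]. *)
  destruct (smooth_step_at (-2) (-1) ltac:(lra)) as [sg [S1 [Z0 Z1]]].
  set (psi := fun y => sg y * exp (-1 * y)).
  assert (Sp : smooth psi) by (apply smooth_mult; [exact S1|apply smooth_exp]).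
  destruct (bounded_all_orders psi N Sp) as [M [HM0 HM]].
  { exists 3. intros j x Hx. unfold Rabs in Hx. destruct (Rcase_abs x).
    - rewrite (Derive_n_locally_eq psi (fun _ => 0) j x (x - 1) (-2)).
      + destruct j; [simpl|rewrite Derive_n_const]; rewrite Rabs_R0; lra.
      + lra.
      + intros y Hy. unfold psi. rewrite Z0 by lra. ring.
    - rewrite (Derive_n_locally_eq psi (fun y => exp (-1 * y)) j x (-1) (x + 1)).
      + rewrite Derive_n_exp, Rabs_mult, pow_1_abs, Rabs_pos_eq by (left; apply exp_pos).
        rewrite Rmult_1_l, <- exp_0. left; apply exp_increasing; lra.
      + lra.
      + intros y Hy. unfold psi. rewrite Z1 by lra. ring. }
  exists N, (C0 * M). split; [now apply Rmult_le_pos|]. intros m Hm.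
  assert (Hm1 : 1 <= INR m) by (apply (le_INR 1); auto).
  set (sgm := fun x => sg (INR m * (x + - s))).
  set (psm := fun x => exp (- INR m * s) * psi (INR m * (x + - s))).
  assert (Ssg : smooth sgm) by (apply (smooth_trans (fun x => sg (INR m * x))), smooth_comp_scal, S1).
  assert (Sps : smooth psm).
  { apply smooth_scal, (smooth_trans (fun x => psi (INR m * x))), smooth_comp_scal, Sp. }
  assert (E : laplace F m = F psm).
  { unfold laplace.
    replace (fun x => exp (- INR m * x)) with
      (fun x => (1 - sgm x) * exp (- INR m * x) + psm x).
    - assert (Sc : smooth (fun x => (1 - sgm x) * exp (- INR m * x))).
      { apply smooth_mult; [|apply smooth_exp]. apply smooth_minus; [apply smooth_const|exact Ssg]. }
      rewrite (proj1 HF) by auto.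
      rewrite (HV _ (s - / INR m)).
      + ring.
      + exact Sc.
      + assert (0 < / INR m) by (apply Rinv_0_lt_compat; lra). lra.
      + intros x Hx. unfold sgm. rewrite Z1; [ring|].
        assert (INR m * / INR m = 1) by (apply Rinv_r; lra). nra.
    - apply functional_extensionality. intros x. unfold sgm, psm, psi.
      assert (E : exp (- INR m * s) * exp (-1 * (INR m * (x + - s))) = exp (- INR m * x)).
      { rewrite <- exp_plus. f_equal. ring. }
      rewrite <- E. ring. }
  rewrite E. replace (C0 * M * INR m ^ N * exp (- INR m * s))
    with (C0 * (M * INR m ^ N * exp (- INR m * s))) by ring.
  apply H; auto. intros j x Hj Hx. unfold psm. rewrite Derive_n_scal_l.
  rewrite (Derive_n_comp_trans (fun x => psi (INR m * x))), Derive_n_comp_scal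
    by (apply filter_forall; intros; apply Sp).
  rewrite !Rabs_mult, (Rabs_pos_eq (exp _)) by (left; apply exp_pos).
  rewrite Rabs_pos_eq by (apply pow_le; lra).
  replace (M * INR m ^ N * exp (- INR m * s)) with (exp (- INR m * s) * (INR m ^ N * M)) by ring.
  apply Rmult_le_compat_l; [left; apply exp_pos|].
  apply Rmult_le_compat; auto using Rabs_pos.
  - apply pow_le; lra.
  - apply Rle_pow; auto.
Qed.

Lemma sum_inv_fact_le (K : nat) : sum_f_R0 (fun k => / INR (fact (S k))) K <= 2.
Proof.
  assert (F2 : forall k, 2 ^ k <= INR (fact (S k))).
  { induction k; [simpl; lra|]. rewrite fact_simpl, mult_INR.
    change (2 ^ S k) with (2 * 2 ^ k). apply Rmult_le_compat; try lra.
    - apply pow_le; lra.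
    - change 2 with (INR 2). apply le_INR. lia. }
  assert (G : forall K, sum_f_R0 (fun k => / INR (fact (S k))) K <= 2 - / 2 ^ K).
  { induction K0; [simpl; lra|rewrite tech5].
    assert (H := Rinv_le_contravar _ _ (pow_lt 2 (S K0) ltac:(lra)) (F2 (S K0))).
    assert (/ 2 ^ K0 = 2 * / 2 ^ S K0).
    { simpl. field. apply pow_nonzero. lra. }
    lra. }
  specialize (G K). assert (0 < / 2 ^ K) by (apply Rinv_0_lt_compat, pow_lt; lra). lra.
Qed.

(** In the value of [F] on [gsum], the coefficient with exponent [m = (k + 1) n] is at most a
    multiple of [exp (m s') / (k + 1)!], and the sample at most a multiple of [m ^ P * exp (- m s)].
    The total tends to 0 with growing [n], uniformly in [K]; this uniformity lets [K] be chosen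
    last. *)
Lemma decays_vanishes_below F s : cdist F -> decays (laplace F) s -> vanishes_below F s.
Proof.
  intros HF [P [C1 [HC1 HA]]] phi0 s' S0 Hs' Z.
  destruct (cdist_local F HF) as [L [HL Hloc]].
  assert (HF' := HF). destruct HF' as [_ [_ [N [C0 [L1 [HC [HL1 H]]]]]]].
  (* With this [r], the seminorm interval lies in [[-r, r]], [rho] is 1 on the whole region that
     [cdist_local] looks at, and a collar of width 1 remains before [r]. *)
  set (r := L + L1 + 3).
  destruct (smooth_bump_at (- (r - 1)) (- (r - 2)) (r - 2) (r - 1)) as [rho [Sr [R1 R0]]]; try lra.
  set (phi := fun x => phi0 x * rho x).
  assert (Sp : smooth phi) by now apply smooth_mult.
  replace (F phi0) with (F phi).
  2:{ apply Hloc; auto. intros x Hx. apply Rabs_lt_between in Hx. unfold phi.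
      rewrite R1; [ring|]. unfold r. lra. }
  assert (Zs : forall x, s' <= x -> phi x = 0).
  { intros x Hx. unfold phi. rewrite Z; auto. ring. }
  assert (Zr : forall x, r - 1 < Rabs x -> phi x = 0).
  { intros x Hx. unfold phi. rewrite R0; [ring|]. unfold Rabs in Hx. destruct (Rcase_abs x); lra. }
  clearbody phi.
  destruct (smooth_bnd phi 1 r Sp) as [M [HM0 HM]].
  (* Half of the gap absorbs [m ^ P], the other half yields the factor [exp (- n * eta)]. *)
  set (eta := (s - s') / 2). assert (Heta : 0 < eta) by (unfold eta; lra).
  destruct (pow_exp_bound P) as [A [HA0 HAb]].
  assert (HAb' : forall m, INR m ^ P * exp (- INR m * eta) <= A * (/ eta) ^ P).
  { intros m. assert (Hm := pos_INR m). specialize (HAb (INR m * eta) ltac:(nra)).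
    assert (Hi := Rinv_0_lt_compat _ Heta).
    replace (INR m ^ P * exp (- INR m * eta)) with
      ((INR m * eta) ^ P * exp (- (INR m * eta)) * (/ eta) ^ P).
    - apply Rmult_le_compat_r; auto. apply pow_le; lra.
    - replace (- INR m * eta) with (- (INR m * eta)) by ring.
      replace (INR m ^ P) with ((INR m * eta) ^ P * (/ eta) ^ P); [ring|].
      rewrite <- Rpow_mult_distr. f_equal. field. lra. }
  set (B := 2 * r * M * C1 * (A * (/ eta) ^ P)).
  assert (HB : 0 <= B).
  { unfold B. repeat apply Rmult_le_pos; try lra; [unfold r; lra|].
    apply pow_le. left. now apply Rinv_0_lt_compat. }
  apply Cmod_le_eps. intros eps Heps.
  assert (Heps' : 0 < eps / (2 * (C0 + 1))) by (apply Rdiv_lt_0_compat; lra).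
  destruct (gsum_density phi r N (eps / (2 * (C0 + 1))) Sp ltac:(unfold r; lra) Zr Heps') as [n0 Hn0].
  (* As [exp (- n * eta) <= 1 / (n * eta)] and the inverse factorials sum to at most 2, this choice
     brings the total below [eps / 2]. *)
  destruct (INR_unbounded (4 * B / (eps * eta))) as [n1 Hn1].
  set (n := (n0 + n1 + 1)%nat).
  destruct (Hn0 n ltac:(lia) ltac:(lia)) as [K HK].
  specialize (HK K (le_n _)).
  assert (Sg : smooth (gsum phi r n K)) by apply smooth_gsum.
  assert (E1 : Cmod (F (fun x => gsum phi r n K x - phi x)) <= eps / 2).
  { eapply Rle_trans; [apply (H _ (smooth_minus _ _ Sg Sp) (eps / (2 * (C0 + 1))))|].
    - apply bnd_weaken with N r (eps / (2 * (C0 + 1))); auto; try lra. unfold r; lra.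
    - replace (C0 * (eps / (2 * (C0 + 1)))) with (eps / 2 * (C0 / (C0 + 1))) by (field; lra).
      assert (C0 / (C0 + 1) <= 1).
      { apply Rmult_le_reg_r with (C0 + 1); [lra|]. unfold Rdiv.
        rewrite Rmult_assoc, Rinv_l by lra. lra. }
      nra. }
  assert (E2 : Cmod (F (gsum phi r n K)) <= eps / 2).
  { unfold gsum.
    eapply Rle_trans; [apply (cdist_sum_bound F _ (fun k x => exp (- INR (S k * n) * x))); auto|].
    { intros k. apply smooth_exp. }
    apply Rle_trans with (sum_f_R0 (fun k => / INR (fact (S k)) * (B * exp (- INR n * eta))) K).
    - apply sum_Rle. intros k _.
      assert (G1 := gcoef_bound phi r Sp ltac:(unfold r; lra) n k M s'
        ltac:(intros t Ht; apply (HM 1%nat); auto) Zs).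
      assert (G2 := HA (S k * n)%nat ltac:(unfold n; lia)).
      specialize (HAb' (S k * n)%nat).
      unfold laplace in G2. set (m := (S k * n)%nat) in *.
      assert (Hf := Rinv_0_lt_compat _ (INR_fact_lt_0 (S k))).
      eapply Rle_trans; [apply Rmult_le_compat; [apply Rabs_pos|apply Cmod_ge_0|exact G1|exact G2]|].
      replace (2 * r * M / INR (fact (S k)) * exp (INR m * s') * (C1 * INR m ^ P * exp (- INR m * s)))
        with (/ INR (fact (S k)) * (2 * r * M * C1 * (INR m ^ P * exp (- INR m * eta))
               * exp (- INR m * eta))).
      + apply Rmult_le_compat_l; [lra|]. unfold B.
        apply Rmult_le_compat; try (left; apply exp_pos).
        * repeat apply Rmult_le_pos; try lra; [unfold r; lra| |left; apply exp_pos].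
          apply pow_le, pos_INR.
        * apply Rmult_le_compat_l; auto. repeat apply Rmult_le_pos; try lra. unfold r; lra.
        * assert (Hmn : INR n <= INR m) by (apply le_INR; unfold m; nia).
          assert (- INR m * eta <= - INR n * eta) by nra.
          destruct H0 as [H0| ->]; [left; now apply exp_increasing|lra].
      + replace (exp (- INR m * s)) with (exp (- INR m * eta) * exp (- INR m * eta) * exp (- INR m * s')).
        * replace (exp (- INR m * s')) with (/ exp (INR m * s')).
          -- field. split; [apply Rgt_not_eq, exp_pos|apply INR_fact_neq_0].
          -- rewrite <- exp_Ropp. f_equal. ring.
        * rewrite <- !exp_plus. f_equal. unfold eta. field.
    - rewrite <- scal_sum. assert (S2 := sum_inv_fact_le K).
      assert (Hn : 0 < INR n) by (apply lt_0_INR; unfold n; lia).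
      assert (Hn1' : INR n1 <= INR n) by (apply le_INR; unfold n; lia).
      assert (Hex : exp (- INR n * eta) * (INR n * eta) <= 1).
      { replace (- INR n * eta) with (- (INR n * eta)) by ring. rewrite exp_Ropp.
        assert (Hp := exp_pos (INR n * eta)). assert (Hi := exp_ineq1_le (INR n * eta)).
        apply Rmult_le_reg_l with (exp (INR n * eta)); auto.
        rewrite <- Rmult_assoc, Rinv_r by lra. lra. }
      assert (H4 : 4 * B <= eps * (INR n * eta)).
      { apply Rmult_le_reg_r with (/ (eps * eta)); [apply Rinv_0_lt_compat; nra|].
        replace (eps * (INR n * eta) * / (eps * eta)) with (INR n) by (field; lra).
        unfold Rdiv in Hn1. lra. }
      assert (He := exp_pos (- INR n * eta)).
      apply Rle_trans with (B * exp (- INR n * eta) * 2).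
      + apply Rmult_le_compat_l; auto. apply Rmult_le_pos; lra.
      + nra. }
  replace (F phi) with (F (gsum phi r n K) - F (fun x => (gsum phi r n K x - phi x)%R))%C.
  - eapply Rle_trans; [apply Cmod_triangle|]. rewrite Cmod_opp. lra.
  - rewrite cdist_minus by auto. ring.
Qed.

(** Null samples decay at every rate, so the functional vanishes below every [s]; take [s] beyond
    its support. *)
Lemma laplace_inj0 F phi : cdist F -> (forall m, (1 <= m)%nat -> laplace F m = RtoC 0) ->
  smooth phi -> F phi = RtoC 0.
Proof.
  intros HF H S. destruct (cdist_local F HF) as [L [HL Hloc]].
  destruct (smooth_bump_at (- (L + 2)) (- (L + 1)) (L + 1) (L + 2)) as [rho [Sr [R1 R0]]]; try lra.
  rewrite (Hloc phi (fun x => phi x * rho x)); auto using smooth_mult.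
  - apply (decays_vanishes_below F (L + 4)) with (L + 3); auto using smooth_mult; try lra.
    + exists 0%nat, 0. split; [lra|]. intros m Hm. rewrite H, Cmod_0 by auto. lra.
    + intros x Hx. rewrite R0 by lra. ring.
  - intros x Hx. apply Rabs_lt_between in Hx. rewrite R1 by lra. ring.
Qed.

(** * Convolution *)

(** [Derive] acts on real functions, so complex functionals are differentiated in a parameter
    through their real and imaginary parts. *)
Definition rdist (Q : (R -> R) -> Prop) (F : (R -> R) -> R) : Prop :=
  (forall phi psi, Q phi -> Q psi -> F (fun x => phi x + psi x) = F phi + F psi) /\
  (forall a phi, Q phi -> F (fun x => a * phi x) = a * F phi) /\
  (exists (N : nat) (C0 L : R), 0 <= C0 /\ 0 <= L /\ forall phi, Q phi -> forall M,
     bnd N L M phi -> Rabs (F phi) <= C0 * M).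

Lemma fst_scal (a : R) (z : C) : fst (RtoC a * z)%C = a * fst z.
Proof. simpl. ring. Qed.

Lemma snd_scal (a : R) (z : C) : snd (RtoC a * z)%C = a * snd z.
Proof. simpl. ring. Qed.

Lemma Rabs_fst_le (z : C) : Rabs (fst z) <= Cmod z.
Proof. eapply Rle_trans; [apply Rmax_l|apply Rmax_Cmod]. Qed.

Lemma Rabs_snd_le (z : C) : Rabs (snd z) <= Cmod z.
Proof. eapply Rle_trans; [apply Rmax_r|apply Rmax_Cmod]. Qed.

Lemma fdist_fst Q F : fdist Q F -> rdist Q (fun phi => fst (F phi)).
Proof.
  intros [H1 [H2 [N [C0 [L [HC [HL H3]]]]]]]. repeat split.
  - intros. now rewrite H1.
  - intros. rewrite H2 by auto. apply fst_scal.
  - exists N, C0, L. repeat split; auto. intros. eapply Rle_trans; [apply Rabs_fst_le|auto].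
Qed.

Lemma fdist_snd Q F : fdist Q F -> rdist Q (fun phi => snd (F phi)).
Proof.
  intros [H1 [H2 [N [C0 [L [HC [HL H3]]]]]]]. repeat split.
  - intros. now rewrite H1.
  - intros. rewrite H2 by auto. apply snd_scal.
  - exists N, C0, L. repeat split; auto. intros. eapply Rle_trans; [apply Rabs_snd_le|auto].
Qed.

(** What a test class must offer so that [F (fun y => phi (x + y))] can be differentiated in [x] any
    number of times. *)
Definition diff_invariant (Q : (R -> R) -> Prop) : Prop :=
  (forall phi, Q phi -> smooth phi) /\
  (forall phi psi, Q phi -> Q psi -> Q (fun x => phi x + psi x)) /\
  (forall a phi, Q phi -> Q (fun x => a * phi x)) /\
  (forall x phi, Q phi -> Q (fun y => phi (x + y))) /\
  (forall phi, Q phi -> Q (Derive phi)).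

Lemma Derive_n_shift (phi : R -> R) (j : nat) (x y : R) :
  Derive_n (fun y => phi (x + y)) j y = Derive_n phi j (x + y).
Proof.
  replace (fun y => phi (x + y)) with (fun y => phi (y + x)).
  - rewrite Derive_n_comp_trans. f_equal. ring.
  - apply functional_extensionality; intros; f_equal; ring.
Qed.

Lemma smooth_shift (phi : R -> R) (x : R) : smooth phi -> smooth (fun y => phi (x + y)).
Proof.
  intros H. replace (fun y => phi (x + y)) with (fun y => phi (y + x)).
  - now apply smooth_trans.
  - apply functional_extensionality; intros; f_equal; ring.
Qed.

Lemma smooth_diff_invariant : diff_invariant smooth.
Proof.
  repeat split; auto using smooth_plus, smooth_scal, smooth_shift, smooth_Derive.
Qed.

Lemma taylor_order_two (D : R -> R) (z h M : R) : smooth D ->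
  (forall t, Rabs (t - z) <= Rabs h -> Rabs (Derive (Derive D) t) <= M) ->
  Rabs (D (z + h) - D z - h * Derive D z) <= M * h ^ 2.
Proof.
  intros S H.
  assert (MV : forall f a b, smooth f -> exists c, Rmin a b <= c <= Rmax a b /\
      f b - f a = Derive f c * (b - a)).
  { intros f a b Sf. apply MVT_gen.
    - intros; now apply smooth_is_derive.
    - intros. apply continuity_pt_filterlim. now apply smooth_continuous. }
  assert (B : forall a b c, Rmin a b <= c <= Rmax a b -> Rabs (c - a) <= Rabs (b - a)).
  { intros a b c Hc. unfold Rmin, Rmax in Hc. destruct (Rle_dec a b).
    - rewrite !Rabs_pos_eq; lra.
    - rewrite !Rabs_left1; lra. }
  destruct (MV D z (z + h) S) as [c [Hc E]].
  destruct (MV (Derive D) z c (smooth_Derive _ S)) as [c' [Hc' E']].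
  apply B in Hc. apply B in Hc'. replace (z + h - z) with h in * by ring.
  replace (D (z + h) - D z - h * Derive D z) with (Derive (Derive D) c' * (c - z) * h).
  - rewrite !Rabs_mult, <- (pow2_abs h). simpl. rewrite Rmult_1_r, <- Rmult_assoc.
    apply Rmult_le_compat_r; [apply Rabs_pos|].
    apply Rmult_le_compat; try apply Rabs_pos; auto. apply H. lra.
  - rewrite E, <- E'. ring.
Qed.

(** The Taylor remainder of [phi] is [O(h ^ 2)] together with its first [N] derivatives, and the
    continuity of [F] carries this bound over. *)
Lemma rdist_is_derive Q F phi x : diff_invariant Q -> rdist Q F -> Q phi ->
  is_derive (fun x => F (fun y => phi (x + y))) x (F (fun y => Derive phi (x + y))).
Proof.
  intros [Q1 [Q2 [Q3 [Q4 Q5]]]] [H1 [H2 [N [C0 [L [HC [HL H3]]]]]]] Hq.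
  (* Two derivatives beyond the order of [F], on an interval containing all [x + y + t] with
     [|y| <= L] and [|t| <= 1]. *)
  destruct (smooth_bnd phi (N + 2) (L + Rabs x + 1) (Q1 _ Hq)) as [M [HM0 HM]].
  apply is_derive_quadratic with (C0 * M). intros h Hh.
  assert (Sp := Q1 _ Hq).
  replace (F (fun y => phi (x + h + y)) - F (fun y => phi (x + y)) - h * F (fun y => Derive phi (x + y)))
    with (F (fun y => phi (x + h + y) + (-1 * phi (x + y) + (- h) * Derive phi (x + y)))).
  - rewrite Rmult_assoc. apply H3; [auto 10|]. intros j y Hj Hy.
    rewrite (Derive_n_Rplus (fun y => phi (x + h + y)) (fun y => -1 * phi (x + y) + - h * Derive phi (x + y)))
      by auto 10.
    rewrite (Derive_n_Rplus (fun y => -1 * phi (x + y)) (fun y => - h * Derive phi (x + y))) by auto 10.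
    rewrite !Derive_n_scal_l, !Derive_n_shift, <- Derive_n_Sl.
    set (D := Derive_n phi j).
    replace (D (x + h + y) + (-1 * D (x + y) + - h * Derive_n phi (S j) (x + y)))
      with (D (x + y + h) - D (x + y) - h * Derive D (x + y)).
    + apply taylor_order_two; [now apply smooth_Derive_n|].
      intros t Ht. change (Derive (Derive D) t) with (Derive_n phi (S (S j)) t).
      apply HM; [lia|].
      replace t with ((t - (x + y)) + (x + y)) by ring.
      eapply Rle_trans; [apply Rabs_triang|].
      assert (T := Rabs_triang x y). lra.
    + simpl. replace (x + y + h) with (x + h + y) by ring. unfold D. ring.
  - rewrite H1, H1, H2, H2 by auto 10. ring.
Qed.

Lemma rdist_smooth Q F phi : diff_invariant Q -> rdist Q F -> Q phi ->
  smooth (fun x => F (fun y => phi (x + y))).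
Proof.
  intros HQ HF Hq k. revert phi Hq. induction k; intros phi Hq; [intros x; exact I|].
  apply ex_derive_n_Sl with (fun x => F (fun y => Derive phi (x + y))).
  - intros x. now apply rdist_is_derive with Q.
  - apply IHk, HQ, Hq.
Qed.

Lemma rdist_Derive_n Q F phi j x : diff_invariant Q -> rdist Q F -> Q phi ->
  Derive_n (fun x => F (fun y => phi (x + y))) j x = F (fun y => Derive_n phi j (x + y)).
Proof.
  intros HQ HF Hq. revert x. induction j; intros x; [reflexivity|].
  simpl. rewrite (Derive_ext _ _ x IHj). apply is_derive_unique.
  apply rdist_is_derive with Q; auto.
  clear IHj x. induction j; auto. simpl. now apply HQ.
Qed.

Lemma rdist_bnd F : rdist smooth F -> exists N C0 L, 0 <= C0 /\ 0 <= L /\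
  forall phi, smooth phi -> forall N' L' M, bnd (N + N') (L + L') M phi ->
    bnd N' L' (C0 * M) (fun x => F (fun y => phi (x + y))).
Proof.
  intros HF. assert (HF' := HF). destruct HF' as [H1 [H2 [N [C0 [L [HC [HL H3]]]]]]].
  exists N, C0, L. repeat split; auto. intros psi Sp N' L' M HM j x Hj Hx.
  rewrite (rdist_Derive_n smooth) by auto using smooth_diff_invariant.
  apply H3; [now apply smooth_shift, smooth_Derive_n|].
  intros i y Hi Hy. rewrite Derive_n_shift, Derive_n_comp. apply HM; [lia|].
  eapply Rle_trans; [apply Rabs_triang|]. lra.
Qed.

Lemma C_eta (z : C) : (RtoC (fst z) + Ci * RtoC (snd z))%C = z.
Proof. destruct z as [u v]. unfold Ci, RtoC, Cplus, Cmult; simpl. f_equal; ring. Qed.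

Lemma pairC_add Q F (h k : R -> C) : fdist Q F ->
  Q (fun x => fst (h x)) -> Q (fun x => snd (h x)) ->
  Q (fun x => fst (k x)) -> Q (fun x => snd (k x)) ->
  pairC F (fun x => (h x + k x)%C) = (pairC F h + pairC F k)%C.
Proof.
  intros HF A1 A2 B1 B2. unfold pairC. simpl.
  rewrite (proj1 HF (fun x => fst (h x)) (fun x => fst (k x))) by auto.
  rewrite (proj1 HF (fun x => snd (h x)) (fun x => snd (k x))) by auto. ring.
Qed.

Lemma pairC_scal Q F (c : C) (h : R -> C) : diff_invariant Q -> fdist Q F ->
  Q (fun x => fst (h x)) -> Q (fun x => snd (h x)) ->
  pairC F (fun x => (c * h x)%C) = (c * pairC F h)%C.
Proof.
  intros [_ [_ [Q3 _]]] [F1 [F2 _]] A1 A2. unfold pairC. simpl.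
  replace (fun x => fst c * fst (h x) - snd c * snd (h x))
    with (fun x => fst c * fst (h x) + (- snd c) * snd (h x))
    by (apply functional_extensionality; intros; ring).
  rewrite (F1 (fun x => fst c * fst (h x)) (fun x => - snd c * snd (h x))) by auto.
  rewrite (F1 (fun x => fst c * snd (h x)) (fun x => snd c * fst (h x))) by auto.
  rewrite !F2 by auto. rewrite <- (C_eta c) at 5. rewrite RtoC_opp.
  set (u := F (fun x => fst (h x))). set (v := F (fun x => snd (h x))).
  assert (E : (Ci * Ci = - RtoC 1)%C).
  { unfold Ci, RtoC, Cmult, Copp; simpl. f_equal; ring. }
  transitivity (RtoC (fst c) * u + Ci * (RtoC (fst c) * v + RtoC (snd c) * u)
     + (- RtoC 1) * (RtoC (snd c) * v))%C; [ring|]. rewrite <- E. ring.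
Qed.

Lemma pairC_scal_real Q F (c : C) (phi : R -> R) : fdist Q F -> Q phi ->
  pairC F (fun x => (c * RtoC (phi x))%C) = (c * F phi)%C.
Proof.
  intros [_ [F2 _]] A. unfold pairC. simpl.
  replace (fun x => fst c * phi x - snd c * 0) with (fun x => fst c * phi x)
    by (apply functional_extensionality; intros; ring).
  replace (fun x => fst c * 0 + snd c * phi x) with (fun x => snd c * phi x)
    by (apply functional_extensionality; intros; ring).
  rewrite !F2 by auto. rewrite <- (C_eta c) at 3. ring.
Qed.

Lemma Cmod_pairC_le F (h : R -> C) (M : R) :
  Cmod (F (fun x => fst (h x))) <= M -> Cmod (F (fun x => snd (h x))) <= M ->
  Cmod (pairC F h) <= 2 * M.
Proof.
  intros H1 H2. unfold pairC. eapply Rle_trans; [apply Cmod_triangle|].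
  rewrite Cmod_mult. replace (Cmod Ci) with 1; [lra|].
  unfold Cmod, Ci; simpl. replace (0 * (0 * 1) + 1 * (1 * 1)) with 1 by ring. symmetry; apply sqrt_1.
Qed.

Lemma fdist_shift_fst_smooth Q G phi : diff_invariant Q -> fdist Q G -> Q phi ->
  smooth (fun x => fst (G (fun y => phi (x + y)))).
Proof. intros HQ HG H. exact (rdist_smooth Q _ phi HQ (fdist_fst Q G HG) H). Qed.

Lemma fdist_shift_snd_smooth Q G phi : diff_invariant Q -> fdist Q G -> Q phi ->
  smooth (fun x => snd (G (fun y => phi (x + y)))).
Proof. intros HQ HG H. exact (rdist_smooth Q _ phi HQ (fdist_snd Q G HG) H). Qed.

Lemma cdist_conv F G : cdist F -> cdist G -> cdist (conv F G).
Proof.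
  intros HF HG. assert (HQ := smooth_diff_invariant).
  assert (HF' := HF). destruct HF' as [F1 [F2 [NF [CF [LF [HCF [HLF F3]]]]]]].
  assert (HG' := HG). destruct HG' as [G1 [G2 _]].
  repeat split.
  - intros phi psi S1 S2. unfold conv.
    rewrite <- (pairC_add smooth F (fun x => G (fun y => phi (x + y))) (fun x => G (fun y => psi (x + y)))).
    2: exact HF.
    2, 4: now apply (fdist_shift_fst_smooth smooth).
    2, 3: now apply (fdist_shift_snd_smooth smooth).
    f_equal. apply functional_extensionality. intros x.
    now rewrite <- (G1 (fun y => phi (x + y))) by auto using smooth_shift.
  - intros a phi S1. unfold conv.
    rewrite <- (pairC_scal smooth F (RtoC a) (fun x => G (fun y => phi (x + y)))); auto.
    2: now apply (fdist_shift_fst_smooth smooth).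
    2: now apply (fdist_shift_snd_smooth smooth).
    f_equal. apply functional_extensionality. intros x.
    now rewrite <- (G2 a (fun y => phi (x + y))) by auto using smooth_shift.
  - destruct (rdist_bnd _ (fdist_fst _ _ HG)) as [N1 [C1 [L1 [HC1 [HL1 B1]]]]].
    destruct (rdist_bnd _ (fdist_snd _ _ HG)) as [N2 [C2 [L2 [HC2 [HL2 B2]]]]].
    exists (N1 + N2 + NF)%nat, (2 * (CF * (C1 + C2))), (L1 + L2 + LF).
    repeat split; [|lra|].
    + assert (0 <= CF * (C1 + C2)) by (apply Rmult_le_pos; lra). lra.
    + intros phi S M HM. rewrite !Rmult_assoc.
      assert (HM0 : 0 <= M).
      { eapply Rle_trans; [apply Rabs_pos|apply (HM 0%nat 0)]; [lia|rewrite Rabs_R0; lra]. }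
      assert (X1 := Rmult_le_pos _ _ HC1 HM0). assert (X2 := Rmult_le_pos _ _ HC2 HM0).
      apply Cmod_pairC_le; apply F3.
      1: now apply (fdist_shift_fst_smooth smooth).
      2: now apply (fdist_shift_snd_smooth smooth).
      * apply bnd_weaken with NF LF (C1 * M); auto; try lra.
        apply B1; auto. apply bnd_weaken with (N1 + N2 + NF)%nat (L1 + L2 + LF) M; auto; try lra; lia.
      * apply bnd_weaken with NF LF (C2 * M); auto; try lra.
        apply B2; auto. apply bnd_weaken with (N1 + N2 + NF)%nat (L1 + L2 + LF) M; auto; try lra; lia.
Qed.

Lemma laplace_conv F G m : cdist F -> cdist G ->
  laplace (conv F G) m = (laplace F m * laplace G m)%C.
Proof.
  intros HF HG. unfold laplace, conv.
  rewrite Cmult_comm, <- (pairC_scal_real smooth) by auto using smooth_exp.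
  f_equal. apply functional_extensionality. intros x.
  rewrite Cmult_comm, <- (proj1 (proj2 HG)) by apply smooth_exp. f_equal.
  apply functional_extensionality. intros y. rewrite <- exp_plus. f_equal. ring.
Qed.

Definition mult_dist (rho : R -> R) (F : (R -> R) -> C) : (R -> R) -> C :=
  fun phi => F (fun x => rho x * phi x).

Lemma cdist_mult_dist rho F : smooth rho -> cdist F -> cdist (mult_dist rho F).
Proof.
  intros Sr [F1 [F2 [N [C0 [L [HC [HL F3]]]]]]]. unfold mult_dist. repeat split.
  - intros phi psi S1 S2. rewrite <- F1 by auto using smooth_mult.
    f_equal. apply functional_extensionality; intros; ring.
  - intros a phi S1. rewrite <- F2 by auto using smooth_mult.
    f_equal. apply functional_extensionality; intros; ring.
  - destruct (smooth_bnd rho N L Sr) as [M0 [HM0 B]].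
    exists N, (C0 * (2 ^ N * M0)), L.
    assert (0 <= 2 ^ N) by (apply pow_le; lra).
    repeat split; auto.
    + repeat apply Rmult_le_pos; auto.
    + intros phi S M HM. rewrite Rmult_assoc. apply F3; [now apply smooth_mult|].
      now apply bnd_mult.
Qed.

Lemma vanishes_below_mult_dist rho F s : smooth rho ->
  vanishes_below F s -> vanishes_below (mult_dist rho F) s.
Proof.
  intros Sr H phi s' S Hs Z. apply (H _ s'); auto using smooth_mult.
  intros x Hx. rewrite Z by auto. ring.
Qed.

Definition xmul : ((R -> R) -> C) -> (R -> R) -> C := mult_dist (fun x => x).

Lemma cdist_xmul F : cdist F -> cdist (xmul F).
Proof. apply cdist_mult_dist, smooth_id. Qed.

Lemma vanishes_below_xmul F s : vanishes_below F s -> vanishes_below (xmul F) s.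
Proof. apply vanishes_below_mult_dist, smooth_id. Qed.

(** A Leibniz rule, from splitting the factor of [phi (x + y)] that multiplication by the coordinate
    produces, namely [x + y]. *)
Lemma xmul_conv F G phi : cdist F -> cdist G -> smooth phi ->
  xmul (conv F G) phi = (conv (xmul F) G phi + conv F (xmul G) phi)%C.
Proof.
  intros HF HG S. assert (HQ := smooth_diff_invariant). unfold conv at 1 2 3.
  set (h := fun x => G (fun y => phi (x + y))).
  assert (S1 := fdist_shift_fst_smooth smooth G phi HQ HG S).
  assert (S2 := fdist_shift_snd_smooth smooth G phi HQ HG S).
  assert (X1 := fdist_shift_fst_smooth smooth (xmul G) phi HQ (cdist_xmul _ HG) S).
  assert (X2 := fdist_shift_snd_smooth smooth (xmul G) phi HQ (cdist_xmul _ HG) S).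
  replace (pairC (xmul F) h) with (pairC F (fun x => (RtoC x * h x)%C)).
  - unfold xmul at 1, mult_dist.
    rewrite <- (pairC_add smooth); auto.
    + f_equal. apply functional_extensionality. intros x. unfold h, xmul, mult_dist.
      assert (Ss := smooth_shift phi x S).
      rewrite <- (proj1 (proj2 HG) x (fun y => phi (x + y)) Ss).
      rewrite <- (proj1 HG _ _ (smooth_scal x _ Ss) (smooth_mult _ _ smooth_id Ss)).
      f_equal. apply functional_extensionality. intros y. ring.
    + eapply eq_ind; [apply (smooth_mult _ _ smooth_id S1)|].
      apply functional_extensionality; intros x. unfold h. now rewrite fst_scal.
    + eapply eq_ind; [apply (smooth_mult _ _ smooth_id S2)|].
      apply functional_extensionality; intros x. unfold h. now rewrite snd_scal.
  - unfold pairC, xmul, mult_dist. f_equal; [|f_equal]; f_equal; apply functional_extensionality;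
      intros x; [apply fst_scal|apply snd_scal].
Qed.

Lemma laplace_xmul_conv F G m : cdist F -> cdist G ->
  laplace (xmul (conv F G)) m =
  (laplace (xmul F) m * laplace G m + laplace F m * laplace (xmul G) m)%C.
Proof.
  intros HF HG. unfold laplace at 1. rewrite xmul_conv by auto using smooth_exp.
  change (laplace (conv (xmul F) G) m + laplace (conv F (xmul G)) m =
    laplace (xmul F) m * laplace G m + laplace F m * laplace (xmul G) m)%C.
  now rewrite !laplace_conv by auto using cdist_xmul.
Qed.

(** * Rates of decay and half-lines of vanishing *)

Lemma decays_ext A B s : (forall m, A m = B m) -> decays A s -> decays B s.
Proof.
  intros E [N [C0 [HC H]]]. exists N, C0. split; auto. intros m Hm. rewrite <- E. auto.
Qed.

Lemma decays_mult A B s t : decays A s -> decays B t -> decays (fun m => A m * B m)%C (s + t).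
Proof.
  intros [N [C0 [HC H]]] [N' [C0' [HC' H']]].
  exists (N + N')%nat, (C0 * C0'). split; [now apply Rmult_le_pos|]. intros m Hm.
  rewrite Cmod_mult, pow_add, Rmult_plus_distr_l, exp_plus.
  eapply Rle_trans; [apply Rmult_le_compat; [apply Cmod_ge_0|apply Cmod_ge_0|apply H, Hm|apply H', Hm]|].
  right; ring.
Qed.

Lemma decays_le A s t : t <= s -> decays A s -> decays A t.
Proof.
  intros Hst [N [C0 [HC H]]]. exists N, C0. split; auto. intros m Hm.
  eapply Rle_trans; [apply H, Hm|].
  assert (P := pow_le (INR m) N (pos_INR m)).
  apply Rmult_le_compat_l; [now apply Rmult_le_pos|].
  assert (H1 := pos_INR m). assert (E : - INR m * s <= - INR m * t) by nra.
  destruct E as [E| ->]; [left; now apply exp_increasing|lra].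
Qed.

Lemma decays_minus A B s : decays A s -> decays B s -> decays (fun m => A m - B m)%C s.
Proof.
  intros [N [C0 [HC H]]] [N' [C0' [HC' H']]].
  exists (N + N')%nat, (C0 + C0'). split; [lra|]. intros m Hm.
  assert (Hm1 : 1 <= INR m) by (apply (le_INR 1); auto).
  assert (He := exp_pos (- INR m * s)).
  eapply Rle_trans; [apply Cmod_triangle|]. rewrite Cmod_opp.
  rewrite !Rmult_plus_distr_r. apply Rplus_le_compat.
  - eapply Rle_trans; [apply H, Hm|]. apply Rmult_le_compat_r; [lra|].
    apply Rmult_le_compat_l; auto. apply Rle_pow; [auto|lia].
  - eapply Rle_trans; [apply H', Hm|]. apply Rmult_le_compat_r; [lra|].
    apply Rmult_le_compat_l; auto. apply Rle_pow; [auto|lia].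
Qed.

(** The square root of [C0 * m ^ N] is at most [(C0 + 1) * m ^ N] for [m >= 1]. Since decay and
    vanishing are equivalent, this is Titchmarsh's theorem for two equal factors. *)
Lemma decays_sqrt A s : decays (fun m => A m * A m)%C (2 * s) -> decays A s.
Proof.
  intros [N [C0 [HC H]]]. exists N, (C0 + 1). split; [lra|]. intros m Hm.
  assert (Hm1 : 1 <= INR m) by (apply (le_INR 1); auto).
  assert (HN := pow_R1_Rle (INR m) N Hm1).
  specialize (H m Hm). rewrite Cmod_mult in H.
  replace (- INR m * (2 * s)) with (- INR m * s + - INR m * s) in H by ring.
  rewrite exp_plus in H. set (e := exp (- INR m * s)) in *.
  assert (He : 0 < e) by apply exp_pos.
  set (p := INR m ^ N) in *. assert (Hc := Cmod_ge_0 (A m)).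
  apply Rsqr_incr_0; [unfold Rsqr| |]; auto.
  - eapply Rle_trans; [exact H|].
    replace ((C0 + 1) * p * e * ((C0 + 1) * p * e)) with (((C0 + 1) * p * ((C0 + 1) * p)) * (e * e)) by ring.
    apply Rmult_le_compat_r; [nra|].
    assert (C0 * p <= (C0 + 1) * p) by nra. assert (1 <= (C0 + 1) * p) by nra. nra.
  - repeat apply Rmult_le_pos; lra.
Qed.

Lemma vanishes_below_iff F s : cdist F -> vanishes_below F s <-> decays (laplace F) s.
Proof. split; [now apply vanishes_below_decays|now apply decays_vanishes_below]. Qed.

Lemma vanishes_below_conv F G s t : cdist F -> cdist G ->
  vanishes_below F s -> vanishes_below G t -> vanishes_below (conv F G) (s + t).
Proof.
  intros HF HG H1 H2. apply vanishes_below_iff; [now apply cdist_conv|].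
  apply decays_ext with (fun m => laplace F m * laplace G m)%C.
  - intros m. now rewrite laplace_conv.
  - apply decays_mult; now apply vanishes_below_decays.
Qed.

Lemma vanishes_below_conv_comm F G s : cdist F -> cdist G ->
  vanishes_below (conv F G) s -> vanishes_below (conv G F) s.
Proof.
  intros HF HG H. apply vanishes_below_iff; [now apply cdist_conv|].
  apply decays_ext with (laplace (conv F G)).
  - intros m. rewrite !laplace_conv by auto. ring.
  - apply vanishes_below_decays; auto using cdist_conv.
Qed.

(** Failure at [k] bounds the admissible [s] from above; the supremum is attained because every test
    stops strictly before it. *)
Lemma vanishes_below_sup F k s0 : vanishes_below F s0 -> ~ vanishes_below F k ->
  exists a, s0 <= a <= k /\ vanishes_below F a /\ forall s, vanishes_below F s -> s <= a.
Proof.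
  intros H0 Hk.
  assert (Ub : forall s, vanishes_below F s -> s <= k).
  { intros s Hs. destruct (Rle_or_lt s k) as [|H]; auto. exfalso. apply Hk.
    intros phi s' S Hs' Z. apply (Hs phi s'); auto. lra. }
  destruct (completeness (vanishes_below F)) as [a [A1 A2]].
  - exists k. exact Ub.
  - now exists s0.
  - exists a. repeat split; [now apply A1|now apply A2| |exact A1].
    intros phi s' S Hs' Z. apply NNPP. intros Hne.
    assert (a <= s'); [|lra]. apply A2. intros s Hs.
    destruct (Rle_or_lt s s') as [|H]; auto. exfalso. apply Hne. now apply (Hs phi s').
Qed.

(* With [v = F * xG], the identity [v * v = v * x(F * G) - (F * G) * (xF * xG)] shows that if
   passing from [F * G] to [F * xG] lowers the bottom of the support by [dl], then passing on to
   [xF * xG] lowers it by at least [dl] again; iterating leaves the half-line on which all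
   these convolutions live. *)
Lemma no_support_drop (dl : R) (j : nat) : 0 < dl -> forall F G a c k, cdist F -> cdist G ->
  vanishes_below F a -> vanishes_below G c -> vanishes_below (conv F G) k ->
  (forall s, vanishes_below (conv F (xmul G)) s -> s <= k - dl) ->
  k <= a + c + INR j * dl -> False.
Proof.
  intros Hd. induction j; intros F G a c k HF HG VF VG VFG Hdrop Hk.
  - assert (V := vanishes_below_conv F (xmul G) a c HF (cdist_xmul _ HG) VF (vanishes_below_xmul _ _ VG)).
    apply Hdrop in V. simpl in Hk. lra.
  - set (v := conv F (xmul G)) in *.
    assert (Hv : cdist v) by (apply cdist_conv; auto using cdist_xmul).
    assert (V0 : vanishes_below v (a + c)).
    { apply vanishes_below_conv; auto using cdist_xmul, vanishes_below_xmul. }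
    destruct (vanishes_below_sup v k (a + c) V0) as [al [Hal [Val Hmax]]].
    { intros H. apply Hdrop in H. lra. }
    assert (Hal' := Hdrop _ Val).
    (* The factors change places, so that the next product is [xmul G] with [xmul F] and the drop
       again concerns a second factor multiplied by [x]. *)
    apply (IHj (xmul G) F c a al); auto using cdist_xmul, vanishes_below_xmul.
    + apply vanishes_below_conv_comm; auto using cdist_xmul.
    + intros l Hl. destruct (Rle_or_lt l (al - dl)) as [|Hlt]; auto. exfalso.
      (* [v * v] is a difference whose terms decay at the rates [al + k] and [k + l]; both exceed
         [2 * al], because [k >= al + dl] and [l > al - dl]. Half of the smaller rate then
         contradicts the maximality of [al]. *)
      set (e := Rmin ((k + l) / 2) ((al + k) / 2)).
      assert (He : al < e) by (unfold e; apply Rmin_glb_lt; lra).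
      assert (Ve : vanishes_below v e); [|apply Hmax in Ve; lra].
      apply vanishes_below_iff; auto. apply decays_sqrt.
      apply decays_ext with (fun m => laplace v m * laplace (xmul (conv F G)) m
         - laplace (conv F G) m * laplace (conv (xmul G) (xmul F)) m)%C.
      * intros m. rewrite laplace_xmul_conv by auto. unfold v.
        rewrite !laplace_conv by auto using cdist_xmul. ring.
      * apply decays_minus.
        -- apply decays_le with (al + k); [unfold e; assert (X := Rmin_r ((k + l) / 2) ((al + k) / 2)); lra|].
           apply decays_mult; apply vanishes_below_decays; auto using cdist_xmul, cdist_conv, vanishes_below_xmul.
        -- apply decays_le with (k + l); [unfold e; assert (X := Rmin_l ((k + l) / 2) ((al + k) / 2)); lra|].
           apply decays_mult; apply vanishes_below_decays; auto using cdist_xmul, cdist_conv.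
    + rewrite S_INR in Hk. lra.
Qed.

(** If the bound for [conv F (xmul G)] stopped at some [al < k], the drop [k - al] would recur at
    each step, and finitely many drops would lead below [a + c], where all these convolutions
    vanish. *)
Lemma vanishes_below_conv_xmul F G a c k : cdist F -> cdist G ->
  vanishes_below F a -> vanishes_below G c ->
  vanishes_below (conv F G) k -> vanishes_below (conv F (xmul G)) k.
Proof.
  intros HF HG VF VG V. apply NNPP. intros Hn.
  destruct (vanishes_below_sup (conv F (xmul G)) k (a + c)) as [al [Hal [Val Hmax]]]; auto.
  { apply vanishes_below_conv; auto using cdist_xmul, vanishes_below_xmul. }
  assert (Hlt : al < k).
  { destruct Hal as [_ [H| ->]]; auto. contradiction. }
  destruct (INR_unbounded ((k - (a + c)) / (k - al))) as [j Hj].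
  apply (no_support_drop (k - al) j ltac:(lra) F G a c k); auto.
  - intros s Hs. apply Hmax in Hs. lra.
  - apply Rmult_lt_compat_r with (r := k - al) in Hj; [|lra].
    unfold Rdiv in Hj. rewrite Rmult_assoc, Rinv_l, Rmult_1_r in Hj by lra. lra.
Qed.

(** * Titchmarsh's theorem *)

Definition exp_rem (q : R) (K : nat) (x : R) : R :=
  exp (q * x) - sum_f_R0 (fun k => q ^ k / INR (fact k) * x ^ k) K.

Lemma smooth_exp_rem (q : R) (K : nat) : smooth (exp_rem q K).
Proof.
  apply smooth_minus; [apply smooth_exp|].
  apply (smooth_sum (fun k x => q ^ k / INR (fact k) * x ^ k)).
  intros i. apply smooth_scal, smooth_pow.
Qed.

Lemma exp_rem_bound_pos (q : R) (K : nat) (x : R) : 0 < x ->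
  Rabs (exp_rem q K x) <= (Rabs q * x) ^ S K / INR (fact (S K)) * exp (Rabs q * x).
Proof.
  intros Hx.
  destruct (Taylor_Lagrange (fun t => exp (q * t)) K 0 x Hx) as [z [Hz E]].
  { intros t _ k _. apply smooth_exp. }
  unfold exp_rem. rewrite E.
  rewrite (sum_eq _ (fun k => q ^ k / INR (fact k) * x ^ k)).
  - rewrite Derive_n_exp, Rminus_0_r.
    replace (sum_f_R0 (fun k => q ^ k / INR (fact k) * x ^ k) K +
      x ^ S K / INR (fact (S K)) * (q ^ S K * exp (q * z)) -
      sum_f_R0 (fun k => q ^ k / INR (fact k) * x ^ k) K)
      with ((q ^ S K * x ^ S K) * / INR (fact (S K)) * exp (q * z)) by (unfold Rdiv; ring).
    rewrite <- Rpow_mult_distr, !Rabs_mult, <- RPow_abs, Rabs_mult, (Rabs_pos_eq x) by lra.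
    rewrite (Rabs_pos_eq (/ _)) by (left; apply Rinv_0_lt_compat, INR_fact_lt_0).
    rewrite (Rabs_pos_eq (exp _)) by (left; apply exp_pos).
    assert (Ha := Rabs_pos q).
    apply Rmult_le_compat_l.
    + apply Rmult_le_pos; [apply pow_le; nra|left; apply Rinv_0_lt_compat, INR_fact_lt_0].
    + assert (Hq := Rle_abs q). assert (q * z <= Rabs q * x) by nra.
      destruct H as [H| ->]; [left; now apply exp_increasing|lra].
  - intros i _. rewrite Derive_n_exp, Rmult_0_r, exp_0, Rminus_0_r. field. apply INR_fact_neq_0.
Qed.

Lemma exp_rem_bound (q : R) (K : nat) (x L : R) : Rabs x <= L ->
  Rabs (exp_rem q K x) <= (Rabs q * L) ^ S K / INR (fact (S K)) * exp (Rabs q * L).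
Proof.
  intros Hx. assert (Hq := Rabs_pos q). assert (H0 := Rabs_pos x).
  assert (Mono : forall y, 0 <= y <= L ->
    (Rabs q * y) ^ S K / INR (fact (S K)) * exp (Rabs q * y) <=
    (Rabs q * L) ^ S K / INR (fact (S K)) * exp (Rabs q * L)).
  { intros y Hy. assert (Hi := Rinv_0_lt_compat _ (INR_fact_lt_0 (S K))).
    assert (E : Rabs q * y <= Rabs q * L) by nra.
    apply Rmult_le_compat.
    - apply Rmult_le_pos; [apply pow_le; nra|lra].
    - left; apply exp_pos.
    - apply Rmult_le_compat_r; [lra|]. apply pow_incr. nra.
    - destruct E as [E| ->]; [left; now apply exp_increasing|lra]. }
  destruct (Rtotal_order x 0) as [H|[->|H]].
  (* Reflection: changing the signs of both [q] and [x] leaves the remainder as it is. *)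
  - replace (exp_rem q K x) with (exp_rem (- q) K (- x)).
    + eapply Rle_trans; [apply exp_rem_bound_pos; lra|]. rewrite Rabs_Ropp. apply Mono.
      rewrite Rabs_left in Hx by lra. lra.
    + unfold exp_rem. f_equal; [f_equal; ring|]. apply sum_eq. intros i _.
      unfold Rdiv. replace (- q) with (-1 * q) by ring. replace (- x) with (-1 * x) by ring.
      rewrite !Rpow_mult_distr.
      replace ((-1) ^ i * q ^ i * / INR (fact i) * ((-1) ^ i * x ^ i))
        with (((-1) ^ i * (-1) ^ i) * (q ^ i * / INR (fact i) * x ^ i)) by ring.
      rewrite <- Rpow_mult_distr. replace (-1 * -1) with 1 by ring. rewrite pow1. ring.
  - replace (exp_rem q K 0) with 0.
    + rewrite Rabs_R0. apply Rmult_le_pos; [|left; apply exp_pos].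
      apply Rdiv_le_0_compat; [|apply INR_fact_lt_0]. apply pow_le. rewrite Rabs_R0 in Hx. nra.
    + unfold exp_rem. rewrite Rmult_0_r, exp_0.
      assert (Z : sum_f_R0 (fun k => q ^ k / INR (fact k) * 0 ^ k) K = 1); [|lra].
      clear. induction K; [simpl; field|]. rewrite tech5, IHK, pow_i by lia. ring.
  - eapply Rle_trans; [apply exp_rem_bound_pos; lra|]. apply Mono.
    rewrite Rabs_pos_eq in Hx by lra. lra.
Qed.

Lemma Derive_exp_rem (q : R) (K : nat) (x : R) : Derive (exp_rem q (S K)) x = q * exp_rem q K x.
Proof.
  apply is_derive_unique. unfold exp_rem. rewrite Rmult_minus_distr_l.
  apply (is_derive_minus (V := R_NormedModule)); [auto_derive; auto; ring|].
  induction K.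
  - simpl. auto_derive; auto. field.
  - rewrite tech5, Rmult_plus_distr_l.
    apply (is_derive_ext (fun x => sum_f_R0 (fun k => q ^ k / INR (fact k) * x ^ k) (S K)
      + q ^ S (S K) / INR (fact (S (S K))) * x ^ S (S K))); [intros t; now rewrite !tech5|].
    apply (is_derive_plus (V := R_NormedModule)); [exact IHK|].
    replace (q * (q ^ S K / INR (fact (S K)) * x ^ S K))
      with (q ^ S (S K) / INR (fact (S (S K))) * (INR (S (S K)) * 1 * x ^ pred (S (S K)))).
    + apply (is_derive_scal (fun x => x ^ S (S K))), (is_derive_pow (fun x => x)), @is_derive_id.
    + rewrite (fact_simpl (S K)), mult_INR. change (q ^ S (S K)) with (q * q ^ S K). simpl pred.
      field. split; [apply INR_fact_neq_0|]. apply not_0_INR. lia.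
Qed.

(** Each derivative of the Taylor remainder is [q] times the remainder of one degree less. Hence the
    degree [K0 + N]: after at most [N] derivatives it is still at least [K0]. The constant [c]
    majorizes all [|q| ^ j] with [j <= N], times the exponential factor. *)
Lemma exp_rem_small (q L : R) (N : nat) (eps : R) : 0 <= L -> 0 < eps ->
  exists K, bnd N L eps (exp_rem q K).
Proof.
  intros HL He. assert (Hq := Rabs_pos q).
  set (c := (1 + Rabs q) ^ N * exp (Rabs q * L)).
  assert (Hc : 0 < c) by (apply Rmult_lt_0_compat; [apply pow_lt; lra|apply exp_pos]).
  destruct (cv_speed_pow_fact (Rabs q * L) (eps / c)) as [K0 HK0]; [apply Rdiv_lt_0_compat; lra|].
  exists (K0 + N)%nat. intros j x Hj Hx.
  assert (D : forall j K y, Derive_n (exp_rem q (K + j)) j y = q ^ j * exp_rem q K y).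
  { clear. induction j; intros K y.
    - rewrite Nat.add_0_r. simpl. ring.
    - rewrite Derive_n_Sl. replace (K + S j)%nat with (S (K + j)) by lia.
      rewrite (Derive_n_ext _ (fun x => q * exp_rem q (K + j) x) j y (Derive_exp_rem q (K + j))).
      rewrite Derive_n_scal_l, IHj. simpl. ring. }
  replace (K0 + N)%nat with ((K0 + (N - j)) + j)%nat by lia.
  rewrite D. set (K := (K0 + (N - j))%nat).
  specialize (HK0 (S K) ltac:(lia)). unfold R_dist in HK0. rewrite Rminus_0_r in HK0.
  apply Rabs_lt_between in HK0. destruct HK0 as [_ HK0].
  assert (B := exp_rem_bound q K x L Hx).
  rewrite Rabs_mult, <- RPow_abs.
  set (w := (Rabs q * L) ^ S K / INR (fact (S K))) in *.
  assert (Hp : Rabs q ^ j <= (1 + Rabs q) ^ N).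
  { apply Rle_trans with ((1 + Rabs q) ^ j); [apply pow_incr; lra|apply Rle_pow; [lra|lia]]. }
  assert (Hw : w * c <= eps).
  { apply Rmult_lt_compat_r with (r := c) in HK0; auto.
    unfold Rdiv in HK0. rewrite Rmult_assoc, Rinv_l, Rmult_1_r in HK0 by lra. lra. }
  apply Rle_trans with ((1 + Rabs q) ^ N * (w * exp (Rabs q * L))).
  - apply Rmult_le_compat; auto using Rabs_pos. now apply pow_le.
  - unfold c in Hw. lra.
Qed.

(** Taylor polynomials approximate [exp (- m x)] in every seminorm, so vanishing moments force
    vanishing samples, and these determine [F]. *)
Lemma cdist_kills_powers F phi : cdist F -> (forall k, F (fun x => x ^ k) = RtoC 0) ->
  smooth phi -> F phi = RtoC 0.
Proof.
  intros HF H. apply laplace_inj0; auto. intros m _. unfold laplace.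
  assert (HF' := HF). destruct HF' as [_ [_ [N [C0 [L [HC [HL HB]]]]]]].
  apply Cmod_le_eps. intros eps He.
  destruct (exp_rem_small (- INR m) L N (eps / (C0 + 1)) HL) as [K HK]; [apply Rdiv_lt_0_compat; lra|].
  set (q := - INR m) in *.
  assert (Sp : smooth (fun x => sum_f_R0 (fun k => q ^ k / INR (fact k) * x ^ k) K)).
  { apply (smooth_sum (fun k x => q ^ k / INR (fact k) * x ^ k)).
    intros i. apply smooth_scal, smooth_pow. }
  assert (Z : F (fun x => sum_f_R0 (fun k => q ^ k / INR (fact k) * x ^ k) K) = RtoC 0).
  { apply Cmod_eq_0, Rle_antisym; [|apply Cmod_ge_0].
    eapply Rle_trans; [apply (cdist_sum_bound F _ (fun k x => x ^ k)); auto using smooth_pow|].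
    right. apply sum_eq_R0. intros k _. rewrite H, Cmod_0. ring. }
  replace (F (fun x => exp (q * x))) with (F (exp_rem q K)).
  - eapply Rle_trans; [apply HB; [apply smooth_exp_rem|exact HK]|].
    replace (C0 * (eps / (C0 + 1))) with (eps * (C0 / (C0 + 1))) by (field; lra).
    assert (C0 / (C0 + 1) <= 1).
    { apply Rmult_le_reg_r with (C0 + 1); [lra|]. unfold Rdiv.
      rewrite Rmult_assoc, Rinv_l by lra. lra. }
    nra.
  - unfold exp_rem. rewrite cdist_minus, Z by auto using smooth_exp. ring.
Qed.

(** The multiplier [chi] is the variable and [phi] is fixed, so that the moments [chi = x ^ k] can
    be fed to [cdist_kills_powers]. *)
Lemma cdist_conv_mult_dist F G phi : cdist F -> cdist G -> smooth phi ->
  cdist (fun chi => conv F (mult_dist chi G) phi).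
Proof.
  intros HF HG Sp. assert (HQ := smooth_diff_invariant).
  assert (S1 : forall chi, smooth chi ->
    smooth (fun x => fst (mult_dist chi G (fun y => phi (x + y))))).
  { intros chi Sc. apply (fdist_shift_fst_smooth smooth); auto using cdist_mult_dist. }
  assert (S2 : forall chi, smooth chi ->
    smooth (fun x => snd (mult_dist chi G (fun y => phi (x + y))))).
  { intros chi Sc. apply (fdist_shift_snd_smooth smooth); auto using cdist_mult_dist. }
  assert (HF' := HF). destruct HF' as [F1 [F2 [NF [CF [LF [HCF [HLF F3]]]]]]].
  assert (HG' := HG). destruct HG' as [G1 [G2 [NG [CG [LG [HCG [HLG G3]]]]]]].
  repeat split.
  - intros chi chi' Sc Sc'. unfold conv.
    rewrite <- (pairC_add smooth F (fun x => mult_dist chi G (fun y => phi (x + y)))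
      (fun x => mult_dist chi' G (fun y => phi (x + y)))); auto.
    f_equal. apply functional_extensionality. intros x. unfold mult_dist.
    rewrite <- G1 by auto using smooth_mult, smooth_shift.
    f_equal. apply functional_extensionality. intros y. ring.
  - intros a chi Sc. unfold conv.
    rewrite <- (pairC_scal smooth F (RtoC a) (fun x => mult_dist chi G (fun y => phi (x + y)))); auto.
    f_equal. apply functional_extensionality. intros x. unfold mult_dist.
    rewrite <- G2 by auto using smooth_mult, smooth_shift.
    f_equal. apply functional_extensionality. intros y. ring.
  - destruct (smooth_bnd phi (NG + NF) (LG + LF) Sp) as [M0 [HM0 B]].
    set (c := CG * (2 ^ NG * M0)).
    assert (Hc : 0 <= c).
    { unfold c. apply Rmult_le_pos; auto. apply Rmult_le_pos; auto. apply pow_le; lra. }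
    exists NG, (2 * (CF * c)), LG. repeat split; auto.
    + assert (0 <= CF * c) by now apply Rmult_le_pos. lra.
    + intros chi Sc M HM. rewrite !Rmult_assoc.
      assert (D : forall j x, (j <= NF)%nat -> Rabs x <= LF ->
        Cmod (mult_dist chi G (fun y => Derive_n phi j (x + y))) <= c * M).
      { intros j x Hj Hx. unfold mult_dist, c.
        replace (CG * (2 ^ NG * M0) * M) with (CG * (2 ^ NG * M * M0)) by ring.
        apply G3; [now apply smooth_mult; [|apply smooth_shift, smooth_Derive_n]|].
        apply (bnd_mult NG LG M M0); auto; [now apply smooth_shift, smooth_Derive_n|].
        intros i y Hi Hy. rewrite Derive_n_shift, Derive_n_comp. apply B; [lia|].
        eapply Rle_trans; [apply Rabs_triang|]. lra. }
      apply Cmod_pairC_le; apply F3.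
      1: now apply S1.
      2: now apply S2.
      * intros j x Hj Hx.
        rewrite (rdist_Derive_n smooth (fun u => fst (mult_dist chi G u)))
          by auto using fdist_fst, cdist_mult_dist.
        eapply Rle_trans; [apply Rabs_fst_le|auto].
      * intros j x Hj Hx.
        rewrite (rdist_Derive_n smooth (fun u => snd (mult_dist chi G u)))
          by auto using fdist_snd, cdist_mult_dist.
        eapply Rle_trans; [apply Rabs_snd_le|auto].
Qed.

Lemma cdist_complex_comb A B : cdist A -> cdist B -> cdist (fun phi => A phi + Ci * B phi)%C.
Proof.
  intros [A1 [A2 [NA [CA [LA [HCA [HLA A3]]]]]]] [B1 [B2 [NB [CB [LB [HCB [HLB B3]]]]]]].
  repeat split.
  - intros. rewrite A1, B1 by auto. ring.
  - intros. rewrite A2, B2 by auto. ring.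
  - exists (NA + NB)%nat, (CA + CB), (LA + LB). repeat split; try lra.
    intros phi S M HM. eapply Rle_trans; [apply Cmod_triangle|]. rewrite Cmod_mult.
    replace (Cmod Ci) with 1.
    + rewrite Rmult_1_l, Rmult_plus_distr_r. apply Rplus_le_compat.
      * apply A3; auto. apply bnd_weaken with (NA + NB)%nat (LA + LB) M; auto; try lra; lia.
      * apply B3; auto. apply bnd_weaken with (NA + NB)%nat (LA + LB) M; auto; try lra; lia.
    + unfold Cmod, Ci; simpl. replace (0 * (0 * 1) + 1 * (1 * 1)) with 1 by ring.
      symmetry; apply sqrt_1.
Qed.

Lemma vanishes_below_conv_pow F G a c s k : cdist F -> cdist G ->
  vanishes_below F a -> vanishes_below G c -> vanishes_below (conv F G) s ->
  vanishes_below (conv F (mult_dist (fun x => x ^ k) G)) s.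
Proof.
  intros HF HG VF VG V.
  assert (E : forall k, mult_dist (fun x => x ^ k) G = Nat.iter k xmul G).
  { clear. induction k.
    - apply functional_extensionality; intros phi. unfold mult_dist. simpl. f_equal.
      apply functional_extensionality; intros; ring.
    - simpl. rewrite <- IHk. apply functional_extensionality; intros phi.
      unfold xmul, mult_dist. f_equal. apply functional_extensionality; intros. ring. }
  rewrite E.
  enough (H : cdist (Nat.iter k xmul G) /\ vanishes_below (Nat.iter k xmul G) c /\
    vanishes_below (conv F (Nat.iter k xmul G)) s) by apply H.
  induction k; [auto|]. destruct IHk as [I1 [I2 I3]]. simpl. repeat split.
  - now apply (cdist_xmul _ I1).
  - now apply (cdist_xmul _ I1).
  - apply (cdist_xmul _ I1).
  - now apply vanishes_below_xmul.
  - now apply vanishes_below_conv_xmul with a c.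
Qed.

(** Powers of [x], hence all smooth multipliers [chi], preserve the vanishing of [F * chi G] below
    [s]. Maximality of [c] supplies a [psi] that vanishes from some [t < c + e] on and has
    [G psi <> 0]. The freedom in [chi] then isolates [F]: the function [h] of the proof satisfies
    [h F = 0] and is the nonzero constant [G psi] left of [s']. *)
Theorem titchmarsh F G a c s : cdist F -> cdist G ->
  vanishes_below F a -> vanishes_below G c -> vanishes_below (conv F G) s ->
  (forall c', vanishes_below G c' -> c' <= c) -> vanishes_below F (s - c).
Proof.
  intros HF HG VF VG V Hc. assert (HQ := smooth_diff_invariant).
  assert (Kill : forall phi s', smooth phi -> s' < s -> (forall x, s' <= x -> phi x = 0) ->
    forall chi, smooth chi -> conv F (mult_dist chi G) phi = RtoC 0).
  { intros phi s' Sp Hs' Z chi Sc.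
    apply (cdist_kills_powers (fun chi => conv F (mult_dist chi G) phi)); auto.
    - now apply cdist_conv_mult_dist.
    - intros k. now apply (vanishes_below_conv_pow F G a c s k HF HG VF VG V phi s'). }
  intros phi s' Sp Hs' Z.
  (* A third of the gap: for [x < s'] and [y < c + e] the sum [x + y] stays below [s - 2 * e], where
     [kap] is 1, while [kap] vanishes from [s - e] on. *)
  set (e := (s - c - s') / 3). assert (He : 0 < e) by (unfold e; lra).
  assert (Hnv : ~ vanishes_below G (c + e)) by (intros H; apply Hc in H; lra).
  assert (Hpsi : exists psi t, smooth psi /\ t < c + e /\ (forall x, t <= x -> psi x = 0) /\
    G psi <> RtoC 0).
  { apply NNPP. intros Hn. apply Hnv. intros psi t S1 Ht Z1. apply NNPP. intros Hne.
    apply Hn. now exists psi, t. }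
  destruct Hpsi as [psi [t [Sps [Ht [Zpsi Gpsi]]]]].
  destruct (smooth_step_at (s - 2 * e) (s - e) ltac:(lra)) as [sg [Ssg [Sg0 Sg1]]].
  set (kap := fun x => 1 - sg x).
  assert (Sk : smooth kap) by (apply smooth_minus; [apply smooth_const|exact Ssg]).
  set (h := fun x => mult_dist psi G (fun y => kap (x + y))).
  assert (HpG := cdist_mult_dist psi G Sps HG).
  assert (Sh1 : smooth (fun x => fst (h x))) by (now apply (fdist_shift_fst_smooth smooth)).
  assert (Sh2 : smooth (fun x => snd (h x))) by (now apply (fdist_shift_snd_smooth smooth)).
  set (H := fun chi => (mult_dist (fun x => fst (h x)) F chi
     + Ci * mult_dist (fun x => snd (h x)) F chi)%C).
  assert (EH : forall chi, H chi = pairC F (fun x => (RtoC (chi x) * h x)%C)).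
  { intros chi. unfold H, pairC, mult_dist. f_equal; [|f_equal]; f_equal;
      apply functional_extensionality; intros x; rewrite ?fst_scal, ?snd_scal; ring. }
  assert (HH : cdist H) by (apply cdist_complex_comb; now apply cdist_mult_dist).
  assert (H0 : H phi = RtoC 0).
  { apply laplace_inj0; auto. intros m _. unfold laplace. rewrite EH.
    (* Multiplying [psi] by [exp (m y)] and the test by [exp (- m z)] leaves [exp (- m x)] at
       [z = x + y]: the vanishing convolution becomes a Laplace sample of [H]. *)
    rewrite <- (Kill (fun z => kap z * exp (- INR m * z)) (s - e)) with (chi := fun y => exp (INR m * y) * psi y).
    - unfold conv. f_equal. apply functional_extensionality. intros x. unfold h, mult_dist.
      rewrite <- (proj1 (proj2 HG)) by auto using smooth_mult, smooth_shift.
      f_equal. apply functional_extensionality. intros y.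
      replace (exp (- INR m * x)) with (exp (INR m * y) * exp (- INR m * (x + y))); [ring|].
      rewrite <- exp_plus. f_equal. ring.
    - apply smooth_mult; auto using smooth_exp.
    - lra.
    - intros x Hx. unfold kap. rewrite Sg1 by lra. ring.
    - apply smooth_mult; auto using smooth_exp. }
  rewrite EH in H0.
  replace (fun x => (RtoC (phi x) * h x)%C) with (fun x => (G psi * RtoC (phi x))%C) in H0.
  - rewrite (pairC_scal_real smooth) in H0 by auto.
    destruct (classic (F phi = RtoC 0)) as [|Hn]; auto.
    exfalso. now apply (Cmult_neq_0 _ _ Gpsi Hn).
  - apply functional_extensionality. intros x. rewrite Cmult_comm.
    destruct (Rle_or_lt s' x) as [Hx|Hx]; [rewrite Z by auto; ring|].
    f_equal. unfold h, mult_dist. f_equal. apply functional_extensionality. intros y.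
    destruct (Rle_or_lt t y) as [Hy|Hy]; [rewrite Zpsi by auto; ring|].
    unfold kap. rewrite Sg0; [ring|]. unfold e in *. lra.
Qed.

(** * Localization on the circle *)

(** The [2 PI]-periodic function that agrees with [psi] on [[p, p + 2 PI)]. *)
Definition per (p : R) (psi : R -> R) (x : R) : R :=
  psi (x - 2 * PI * IZR (Int_part ((x - p) / (2 * PI)))).

Lemma two_pi_pos : 0 < 2 * PI.
Proof. assert (H := PI_RGT_0). lra. Qed.

Lemma reduce_mod_two_pi (p x : R) :
  exists y z, p <= y < p + 2 * PI /\ x = y + 2 * PI * IZR z.
Proof.
  assert (H := two_pi_pos).
  exists (x - 2 * PI * IZR (Int_part ((x - p) / (2 * PI)))), (Int_part ((x - p) / (2 * PI))).
  split; [|ring]. destruct (base_Int_part ((x - p) / (2 * PI))) as [H1 H2].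
  set (i := IZR (Int_part ((x - p) / (2 * PI)))) in *.
  assert (E : 2 * PI * ((x - p) / (2 * PI)) = x - p) by (field; lra).
  set (w := (x - p) / (2 * PI)) in *.
  assert (A1 := Rmult_le_compat_l (2 * PI) _ _ ltac:(lra) H1).
  assert (A2 := Rmult_lt_compat_l (2 * PI) (w - 1) i ltac:(lra) ltac:(lra)). lra.
Qed.

Lemma IZR_small (z : Z) : -1 < IZR z < 1 -> z = 0%Z.
Proof. intros [H1 H2]. apply lt_IZR in H1, H2. lia. Qed.

Lemma per_eq (p : R) (psi : R -> R) (y : R) (z : Z) :
  p <= y < p + 2 * PI -> per p psi (y + 2 * PI * IZR z) = psi y.
Proof.
  intros Hy. unfold per. assert (H := two_pi_pos).
  set (x := y + 2 * PI * IZR z).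
  destruct (base_Int_part ((x - p) / (2 * PI))) as [H1 H2].
  set (i := Int_part ((x - p) / (2 * PI))) in *.
  assert (E : (x - p) / (2 * PI) = (y - p) / (2 * PI) + IZR z) by (unfold x; field; lra).
  rewrite E in H1, H2.
  assert (B : 0 <= (y - p) / (2 * PI) < 1).
  { split; [apply Rdiv_le_0_compat; lra|].
    apply Rmult_lt_reg_r with (2 * PI); auto. unfold Rdiv.
    rewrite Rmult_assoc, Rinv_l by lra. lra. }
  assert (Z0 : (i - z)%Z = 0%Z).
  { apply IZR_small. rewrite minus_IZR. lra. }
  replace i with z by lia. unfold x. f_equal. ring.
Qed.

Lemma per_periodic (p : R) (psi : R -> R) (x : R) (z : Z) :
  per p psi (x + 2 * PI * IZR z) = per p psi x.
Proof.
  destruct (reduce_mod_two_pi p x) as [y [w [Hy ->]]].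
  rewrite (per_eq p psi y w Hy).
  replace (y + 2 * PI * IZR w + 2 * PI * IZR z) with (y + 2 * PI * IZR (w + z)).
  - now apply per_eq.
  - rewrite plus_IZR. ring.
Qed.

Lemma per_nonzero (p : R) (psi : R -> R) (x : R) : per p psi x <> 0 ->
  exists w z, x = w + 2 * PI * IZR z /\ psi w <> 0.
Proof.
  intros H. exists (x - 2 * PI * IZR (Int_part ((x - p) / (2 * PI)))), (Int_part ((x - p) / (2 * PI))).
  split; [ring|exact H].
Qed.

(** The margin at both ends makes [per p psi] vanish on a neighbourhood of the seam, hence smooth
    there. *)
Definition in_window (p : R) (psi : R -> R) : Prop :=
  exists dl, 0 < dl /\ forall y, y <= p + dl \/ p + 2 * PI - dl <= y -> psi y = 0.

Lemma per_local (p : R) (psi : R -> R) (y0 : R) (z : Z) : in_window p psi ->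
  p <= y0 < p + 2 * PI -> exists dl, 0 < dl /\
  forall x, y0 + 2 * PI * IZR z - dl < x < y0 + 2 * PI * IZR z + dl ->
    per p psi x = psi (x + - (2 * PI * IZR z)).
Proof.
  intros [dl [Hd H]] Hy. assert (H2 := two_pi_pos).
  exists (Rmin dl (2 * PI)). split; [now apply Rmin_pos|]. intros x Hx.
  assert (M1 := Rmin_l dl (2 * PI)). assert (M2 := Rmin_r dl (2 * PI)).
  set (w := x + - (2 * PI * IZR z)).
  assert (Hw : y0 - Rmin dl (2 * PI) < w < y0 + Rmin dl (2 * PI)) by (unfold w; lra).
  replace x with (w + 2 * PI * IZR z) by (unfold w; ring).
  rewrite per_periodic.
  destruct (Rlt_or_le w p) as [L1|L1].
  - rewrite (H w) by lra.
    rewrite <- (per_periodic p psi w 1), <- (Rplus_0_r (w + _)).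
    replace (w + 2 * PI * 1 + 0) with ((w + 2 * PI) + 2 * PI * IZR 0) by (simpl; ring).
    rewrite per_eq by lra. apply H. lra.
  - destruct (Rlt_or_le w (p + 2 * PI)) as [L2|L2].
    + replace w with (w + 2 * PI * IZR 0) at 1 by (simpl; ring). apply per_eq; lra.
    + rewrite (H w) by lra.
      rewrite <- (per_periodic p psi w (-1)).
      replace (w + 2 * PI * -1) with ((w - 2 * PI) + 2 * PI * IZR 0) by (simpl; ring).
      rewrite per_eq by lra. apply H. lra.
Qed.

Lemma Derive_n_per (p : R) (psi : R -> R) (j : nat) (y0 : R) (z : Z) : in_window p psi ->
  p <= y0 < p + 2 * PI -> Derive_n (per p psi) j (y0 + 2 * PI * IZR z) = Derive_n psi j y0.
Proof.
  intros W Hy. destruct (per_local p psi y0 z W Hy) as [dl [Hd H]].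
  rewrite (Derive_n_locally_eq _ (fun x => psi (x + - (2 * PI * IZR z))) j _
    (y0 + 2 * PI * IZR z - dl) (y0 + 2 * PI * IZR z + dl)); [|lra|exact H].
  rewrite Derive_n_comp_trans. f_equal. ring.
Qed.

Lemma per_test_fun (p : R) (psi : R -> R) : smooth psi -> in_window p psi -> test_fun (per p psi).
Proof.
  intros S W. split.
  - intros x. rewrite <- (per_periodic p psi x 1). f_equal. ring.
  - intros k x. destruct (reduce_mod_two_pi p x) as [y [z [Hy ->]]].
    destruct (per_local p psi y z W Hy) as [dl [Hd H]].
    apply ex_derive_n_ext_loc with (fun x => psi (x + - (2 * PI * IZR z))).
    + apply (locally_interval _ _ (y + 2 * PI * IZR z - dl) (y + 2 * PI * IZR z + dl)); simpl; try lra.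
      intros x H1 H2. symmetry. apply H. split; auto.
    + apply ex_derive_n_comp_trans, S.
Qed.

Lemma test_fun_smooth phi : test_fun phi -> smooth phi.
Proof. intros [_ H]. exact H. Qed.

Lemma test_fun_period phi x z : test_fun phi -> phi (x + 2 * PI * IZR z) = phi x.
Proof.
  intros [H _].
  assert (N : forall k x, phi (x + 2 * PI * INR k) = phi x).
  { induction k; intros y.
    - simpl. f_equal. ring.
    - rewrite S_INR. replace (y + 2 * PI * (INR k + 1)) with ((y + 2 * PI * INR k) + 2 * PI) by ring.
      now rewrite H. }
  destruct (Z_le_gt_dec 0 z) as [Hz|Hz].
  - rewrite <- (Z2Nat.id z) by lia. rewrite <- INR_IZR_INZ. apply N.
  - rewrite <- (N (Z.to_nat (- z)) (x + 2 * PI * IZR z)). f_equal.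
    rewrite INR_IZR_INZ, Z2Nat.id, opp_IZR by lia. ring.
Qed.

Lemma test_fun_plus phi psi : test_fun phi -> test_fun psi -> test_fun (fun x => phi x + psi x).
Proof.
  intros [P1 S1] [P2 S2]. split; [|now apply smooth_plus]. intros x. now rewrite P1, P2.
Qed.

Lemma test_fun_scal a phi : test_fun phi -> test_fun (fun x => a * phi x).
Proof. intros [P1 S1]. split; [|now apply smooth_scal]. intros x. now rewrite P1. Qed.

Lemma test_fun_mult phi psi : test_fun phi -> test_fun psi -> test_fun (fun x => phi x * psi x).
Proof.
  intros [P1 S1] [P2 S2]. split; [|now apply smooth_mult]. intros x. now rewrite P1, P2.
Qed.

Lemma test_fun_minus phi psi : test_fun phi -> test_fun psi -> test_fun (fun x => phi x - psi x).
Proof.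
  intros [P1 S1] [P2 S2]. split; [|now apply smooth_minus]. intros x. now rewrite P1, P2.
Qed.

Lemma test_fun_const c : test_fun (fun _ => c).
Proof. split; auto. apply smooth_const. Qed.

Lemma test_fun_shift t phi : test_fun phi -> test_fun (fun y => phi (t + y)).
Proof.
  intros [P1 S1]. split; [|now apply smooth_shift]. intros x. now rewrite <- Rplus_assoc, P1.
Qed.

Lemma test_fun_trans t phi : test_fun phi -> test_fun (fun y => phi (y + t)).
Proof.
  intros H. replace (fun y => phi (y + t)) with (fun y => phi (t + y)).
  - now apply test_fun_shift.
  - apply functional_extensionality; intros; f_equal; ring.
Qed.

Lemma Derive_n_periodic phi j x z : test_fun phi ->
  Derive_n phi j (x + 2 * PI * IZR z) = Derive_n phi j x.
Proof.
  intros H. rewrite <- (Derive_n_comp_trans phi j x (2 * PI * IZR z)).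
  apply Derive_n_ext. intros t. now apply test_fun_period.
Qed.

Lemma test_fun_Derive phi : test_fun phi -> test_fun (Derive phi).
Proof.
  intros H. split; [|now apply smooth_Derive, test_fun_smooth]. intros x.
  assert (E := Derive_n_periodic phi 1 x 1 H). simpl in E. now rewrite Rmult_1_r in E.
Qed.

Lemma test_fun_diff_invariant : diff_invariant test_fun.
Proof.
  exact (conj test_fun_smooth (conj test_fun_plus (conj test_fun_scal
    (conj test_fun_shift test_fun_Derive)))).
Qed.

Lemma distribution_fdist f : distribution f -> fdist test_fun f.
Proof.
  intros [H1 [H2 [N [C0 H3]]]]. assert (HP := two_pi_pos). repeat split; auto.
  (* [Rabs C0], as the sign of [C0] is not prescribed; one period suffices because the derivatives
     are periodic. *)
  exists N, (Rabs C0), (2 * PI). repeat split; [apply Rabs_pos|lra|]. intros phi T M HM.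
  assert (HM0 : 0 <= M).
  { eapply Rle_trans; [apply Rabs_pos|apply (HM 0%nat 0)]; [lia|rewrite Rabs_R0; lra]. }
  apply Rle_trans with (C0 * M); [|apply Rmult_le_compat_r; auto; apply Rle_abs].
  apply H3; auto. intros j x Hj. destruct (reduce_mod_two_pi 0 x) as [y [z [Hy ->]]].
  rewrite Derive_n_periodic by auto. apply HM; auto. rewrite Rabs_pos_eq; lra.
Qed.

(** Finite partitions of unity ask only for additivity, so localization applies to [conv f g] on the
    circle without a continuity estimate. *)
Definition additive_on_tests (F : (R -> R) -> C) : Prop :=
  forall phi psi, test_fun phi -> test_fun psi -> F (fun x => phi x + psi x) = (F phi + F psi)%C.

Lemma additive_zero F : additive_on_tests F -> F (fun _ => 0) = RtoC 0.
Proof.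
  intros H. assert (E := H (fun _ => 0) (fun _ => 0) (test_fun_const 0) (test_fun_const 0)).
  simpl in E. replace (fun _ : R => 0 + 0) with (fun _ : R => 0) in E
    by (apply functional_extensionality; intros; ring).
  set (w := F (fun _ => 0)) in *.
  replace w with (w + w - w)%C by ring. rewrite <- E. ring.
Qed.

Lemma supported_in_weaken p q p' q' phi : p' <= p -> q <= q' ->
  supported_in p q phi -> supported_in p' q' phi.
Proof.
  intros Hp Hq [dl [Hd H]]. exists dl. split; auto. intros x Hx.
  destruct (H x Hx) as [z Hz]. exists z. lra.
Qed.

Lemma supported_in_mult p q phi psi : supported_in p q psi -> supported_in p q (fun x => phi x * psi x).
Proof.
  intros [dl [Hd H]]. exists dl. split; auto. intros x Hx. apply H. intros E. apply Hx. rewrite E. ring.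
Qed.

(** A Lebesgue number: every point has a radius within which products with [Phi] are killed, since
    [Phi] vanishes near points of the support and [F] near all others; compactness of a period makes
    the radius uniform. *)
Lemma local_kill_uniform F Phi : additive_on_tests F -> test_fun Phi ->
  (forall x, in_supp F x -> exists e, 0 < e /\ forall y, x - e < y < x + e -> Phi y = 0) ->
  exists d, 0 < d /\ d < 1 /\ forall x psi, 0 <= x <= 2 * PI -> test_fun psi ->
    supported_in (x - d) (x + d) psi -> F (fun y => Phi y * psi y) = RtoC 0.
Proof.
  intros HF HT H.
  (* The radius is doubled so that a ball of radius [e] around a point within [e] of [x] still
     fits. *)
  assert (L : forall x, exists e : posreal, forall psi, test_fun psi ->
    supported_in (x - 2 * e) (x + 2 * e) psi -> F (fun y => Phi y * psi y) = RtoC 0).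
  { intros x. destruct (classic (in_supp F x)) as [Hx|Hx].
    - destruct (H x Hx) as [e [He Z]]. assert (He2 : 0 < e / 2) by lra.
      exists (mkposreal _ He2). simpl. intros psi Tp [dl [Hd Hs]].
      rewrite <- (additive_zero F HF). f_equal. apply functional_extensionality. intros y.
      destruct (Req_dec (psi y) 0) as [E|E]; [rewrite E; ring|].
      destruct (Hs y E) as [z Hz]. rewrite <- (test_fun_period Phi y z HT), Z by lra. ring.
    - assert (X : exists eps, 0 < eps /\ forall phi, test_fun phi ->
        supported_in (x - eps) (x + eps) phi -> F phi = RtoC 0).
      { apply NNPP. intros Hn. apply Hx. intros eps He. apply NNPP. intros Hn2.
        apply Hn. exists eps. split; auto. intros phi T S. apply NNPP. intros Hne.
        apply Hn2. now exists phi. }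
      destruct X as [eps [He X]]. assert (He2 : 0 < eps / 2) by lra.
      exists (mkposreal _ He2). simpl. intros psi Tp Hs. apply X; [now apply test_fun_mult|].
      apply supported_in_mult. apply supported_in_weaken with (x - 2 * (eps / 2)) (x + 2 * (eps / 2)); auto; lra. }
  set (e := fun x => proj1_sig (constructive_indefinite_description _ (L x))).
  assert (He : forall x psi, test_fun psi -> supported_in (x - 2 * e x) (x + 2 * e x) psi ->
    F (fun y => Phi y * psi y) = RtoC 0).
  { intros x. exact (proj2_sig (constructive_indefinite_description _ (L x))). }
  destruct (compactness_value_1d 0 (2 * PI) e) as [d Hd].
  assert (Hdp := cond_pos d).
  exists (Rmin d (1 / 2)). repeat split.
  - apply Rmin_pos; lra.
  - eapply Rle_lt_trans; [apply Rmin_r|lra].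
  - intros x psi Hx Tp Hs. apply NNPP. intros Hne. apply (Hd x Hx).
    intros [t [Ht [Hxt Hdt]]]. apply Hne. apply (He t); auto.
    assert (M := Rmin_l d (1 / 2)). apply Rabs_lt_between in Hxt.
    apply supported_in_weaken with (x - Rmin d (1 / 2)) (x + Rmin d (1 / 2)); auto; lra.
Qed.

Lemma per_mult p phi psi x : test_fun phi -> per p (fun y => phi y * psi y) x = phi x * per p psi x.
Proof.
  intros T. unfold per. f_equal. set (z := Int_part _).
  rewrite <- (test_fun_period phi x (- z) T). f_equal. rewrite opp_IZR. ring.
Qed.

Lemma zero_near_support F Phi : additive_on_tests F -> test_fun Phi ->
  (forall x, in_supp F x -> exists e, 0 < e /\ forall y, x - e < y < x + e -> Phi y = 0) ->
  F Phi = RtoC 0.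
Proof.
  intros HF HT H. assert (HP := PI2_3_2). assert (H4 := PI_4).
  destruct (local_kill_uniform F Phi HF HT H) as [d [Hd [Hd1 Kill]]]. clear H.
  (* A partition of unity by induction: [psi * sg] lives in [[x - d / 4, x + d / 2]] and is killed
     by the uniform radius, while the rest ends at [x], one step lower. *)
  assert (Ind : forall j psi, smooth psi ->
    (forall y, y <= 0 + d / 8 \/ 0 + 2 * PI - d / 8 <= y -> psi y = 0) ->
    (forall y, INR j * (d / 2) <= y -> psi y = 0) -> F (fun y => Phi y * per 0 psi y) = RtoC 0).
  { induction j; intros psi Sp Z1 Z2.
    - rewrite <- (additive_zero F HF). f_equal. apply functional_extensionality. intros y.
      unfold per. set (w := y - _). destruct (Rle_or_lt w 0); [rewrite Z1 by lra; ring|].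
      rewrite Z2 by (simpl; lra). ring.
    - set (x := INR j * (d / 2)) in *.
      assert (Hx0 : 0 <= x) by (apply Rmult_le_pos; [apply pos_INR|lra]).
      destruct (Rle_or_lt x (2 * PI)) as [Hx|Hx].
      2:{ apply IHj; auto. intros y Hy. apply Z1. lra. }
      destruct (smooth_step_at (x - d / 4) x ltac:(lra)) as [sg [Ssg [A B]]].
      assert (S1 : smooth (fun y => psi y * (1 - sg y))).
      { apply smooth_mult; auto. apply smooth_minus; auto. apply smooth_const. }
      assert (S2 : smooth (fun y => psi y * sg y)) by now apply smooth_mult.
      assert (W1 : in_window 0 (fun y => psi y * (1 - sg y))).
      { exists (d / 8). split; [lra|]. intros y Hy. rewrite Z1 by auto. ring. }
      assert (W2 : in_window 0 (fun y => psi y * sg y)).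
      { exists (d / 8). split; [lra|]. intros y Hy. rewrite Z1 by auto. ring. }
      replace (fun y => Phi y * per 0 psi y) with
        (fun y => Phi y * per 0 (fun y => psi y * (1 - sg y)) y + Phi y * per 0 (fun y => psi y * sg y) y)
        by (apply functional_extensionality; intros; unfold per; ring).
      rewrite HF by (apply test_fun_mult; auto; now apply per_test_fun).
      rewrite IHj, (Kill x); auto.
      + ring.
      + now apply per_test_fun.
      + exists (d / 4). split; [lra|]. intros y Hy.
        destruct (per_nonzero _ _ _ Hy) as [w [z [-> Hw]]]. exists (- z)%Z.
        rewrite opp_IZR. replace (w + 2 * PI * IZR z + 2 * PI * - IZR z) with w by ring.
        split.
        * destruct (Rle_or_lt (x - d / 4) w); [lra|]. exfalso. apply Hw. rewrite A by lra. ring.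
        * destruct (Rle_or_lt w (x + d / 2)) as [|Hgt]; [lra|]. exfalso. apply Hw.
          rewrite Z2; [ring|]. rewrite S_INR. unfold x in Hgt. lra.
      + intros y Hy. rewrite Z1 by auto. ring.
      + intros y Hy. rewrite B by auto. ring. }
  (* The induction needs functions vanishing at both ends of the period, so a neighbourhood of the
     seam at 0 is split off first; [zt] turns [1 - rho] into the periodization of such a
     function. *)
  destruct (smooth_bump_at (- (d / 2)) (- (d / 4)) (d / 4) (d / 2)) as [rho0 [Sr [R1 R0]]]; try lra.
  set (rho := per (- PI) rho0).
  assert (Tr : test_fun rho).
  { apply per_test_fun; auto. exists (PI - d / 2). split; [lra|]. intros y Hy. apply R0. lra. }
  destruct (smooth_bump_at (d / 8) (d / 4) (2 * PI - d / 4) (2 * PI - d / 8)) as [zt [Sz [Z1 Z0]]]; try lra.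
  assert (T1 : test_fun (fun y => 1 - rho y)) by (apply test_fun_minus; auto; apply test_fun_const).
  assert (Ez : forall y, (1 - rho y) * per 0 zt y = 1 - rho y).
  { intros y. destruct (reduce_mod_two_pi 0 y) as [w [z [Hw ->]]].
    rewrite per_eq by lra.
    destruct (Rlt_or_le w (d / 4)) as [C1|C1].
    - unfold rho. rewrite per_eq by lra. rewrite R1 by lra. ring.
    - destruct (Rlt_or_le (2 * PI - d / 4) w) as [C2|C2].
      + unfold rho. replace (w + 2 * PI * IZR z) with ((w - 2 * PI) + 2 * PI * IZR (z + 1))
          by (rewrite plus_IZR; ring).
        rewrite per_eq by lra. rewrite R1 by lra. ring.
      + rewrite Z1 by lra. ring. }
  assert (Sz' : smooth (fun y => (1 - rho y) * zt y)).
  { apply smooth_mult; auto. now apply test_fun_smooth. }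
  assert (I1 : F (fun y => Phi y * rho y) = RtoC 0).
  { apply (Kill 0); auto; [lra|]. exists (d / 4). split; [lra|]. intros y Hy.
    destruct (per_nonzero _ _ _ Hy) as [w [z [-> Hw]]]. exists (- z)%Z.
    rewrite opp_IZR. replace (w + 2 * PI * IZR z + 2 * PI * - IZR z) with w by ring.
    destruct (Rle_or_lt w (- (d / 2))); [exfalso; apply Hw, R0; lra|].
    destruct (Rle_or_lt (d / 2) w); [exfalso; apply Hw, R0; lra|]. lra. }
  assert (I2 : F (fun y => Phi y * per 0 (fun y => (1 - rho y) * zt y) y) = RtoC 0).
  { destruct (INR_unbounded (4 * PI / d)) as [j Hj]. apply (Ind j); auto.
    - intros y Hy. rewrite Z0 by lra. ring.
    - intros y Hy. rewrite Z0; [ring|]. right.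
      apply Rmult_gt_compat_r with (r := d / 2) in Hj; [|lra].
      replace (4 * PI / d * (d / 2)) with (2 * PI) in Hj by (field; lra). lra. }
  replace Phi with (fun y => Phi y * rho y + Phi y * per 0 (fun y => (1 - rho y) * zt y) y).
  - rewrite HF, I1, I2; [ring|now apply test_fun_mult|].
    apply test_fun_mult; auto. apply per_test_fun; auto.
    exists (d / 8). split; [lra|]. intros y Hy. rewrite Z0 by lra. ring.
  - apply functional_extensionality. intros y. rewrite per_mult, Ez by auto. ring.
Qed.

(** * Lifting rotation sums to the line *)

Definition arc (n : nat) : R := 2 * PI / INR n.

Lemma arc_pos n : (1 <= n)%nat -> 0 < arc n.
Proof. intros H. apply Rdiv_lt_0_compat; [apply two_pi_pos|apply lt_0_INR; lia]. Qed.

Lemma two_pi_arc n : (1 <= n)%nat -> 2 * PI = arc n * INR n.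
Proof. intros H. unfold arc. field. apply not_0_INR. lia. Qed.

Lemma arc_le_PI n : (2 <= n)%nat -> arc n <= PI.
Proof.
  intros H. assert (E := two_pi_arc n ltac:(lia)). assert (P := arc_pos n ltac:(lia)).
  assert (2 <= INR n) by (apply (le_INR 2); auto). nra.
Qed.

Lemma arc_gap n z : (1 <= n)%nat -> - arc n < arc n * IZR z < arc n -> z = 0%Z.
Proof.
  intros H Hz. assert (P := arc_pos n H). apply IZR_small. split.
  - apply Rmult_lt_reg_l with (arc n); auto. lra.
  - apply Rmult_lt_reg_l with (arc n); auto. lra.
Qed.

Lemma rot_residue n z : (1 <= n)%nat -> exists k q, (k < n)%nat /\
  forall x, x + arc n * IZR z = x + arc n * INR k + 2 * PI * IZR q.
Proof.
  intros H. exists (Z.to_nat (z mod Z.of_nat n)), (z / Z.of_nat n)%Z.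
  assert (B := Z.mod_pos_bound z (Z.of_nat n) ltac:(lia)). split; [lia|]. intros x.
  rewrite INR_IZR_INZ, Z2Nat.id by lia. rewrite (two_pi_arc n H), INR_IZR_INZ.
  rewrite (Z.div_mod z (Z.of_nat n)) at 1 by lia. rewrite plus_IZR, mult_IZR. ring.
Qed.

Lemma zero_off_rot n F a b eta Phi : (1 <= n)%nat -> additive_on_tests F ->
  supp_sub F (rot_set n a b) -> 0 < eta -> test_fun Phi ->
  (forall y z, a - eta <= y <= b + eta -> Phi (y + arc n * IZR z) = 0) -> F Phi = RtoC 0.
Proof.
  intros Hn HF HS He HT H. apply zero_near_support; auto.
  intros x Hx. destruct (HS x Hx) as [z Hz]. exists eta. split; auto. intros y Hy.
  replace y with ((y - arc n * IZR z) + arc n * IZR z) by ring. apply H.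
  unfold arc. replace (2 * PI / INR n * IZR z) with (2 * PI * IZR z / INR n).
  - lra.
  - field. apply not_0_INR. lia.
Qed.

Lemma csum_ext m S T : (forall k, (k < m)%nat -> S k = T k) -> csum m S = csum m T.
Proof. intros H. induction m; simpl; auto. rewrite IHm, H; auto. Qed.

Lemma csum_zero m T : (forall k, (k < m)%nat -> T k = RtoC 0) -> csum m T = RtoC 0.
Proof. intros H. induction m; simpl; auto. rewrite IHm, H; auto. ring. Qed.

Lemma csum_scal m c T : csum m (fun k => c * T k)%C = (c * csum m T)%C.
Proof. induction m; simpl; [ring|]. rewrite IHm. ring. Qed.

Lemma csum_plus m S T : csum m (fun k => S k + T k)%C = (csum m S + csum m T)%C.
Proof. induction m; simpl; [ring|]. rewrite IHm. ring. Qed.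

Lemma csum_single m T k0 : (k0 < m)%nat -> (forall k, (k < m)%nat -> k <> k0 -> T k = RtoC 0) ->
  csum m T = T k0.
Proof.
  intros Hk H. induction m; [lia|]. simpl. destruct (Nat.eq_dec k0 m) as [->|Hne].
  - rewrite csum_zero; [ring|]. intros k Hkm. apply H; lia.
  - rewrite IHm, (H m); [ring|lia|lia|lia|]. intros k Hkm. apply H. lia.
Qed.

Lemma csum_rotate m T : (csum m (fun k => T (S k)) + T 0%nat)%C = (csum m T + T m)%C.
Proof.
  induction m; simpl; [ring|].
  transitivity ((csum m (fun k => T (S k)) + T 0%nat) + T (S m))%C; [ring|]. rewrite IHm. ring.
Qed.

Lemma csum_exchange m p (T : nat -> nat -> C) :
  csum m (fun j => csum p (T j)) = csum p (fun k => csum m (fun j => T j k)).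
Proof.
  induction m; simpl; [symmetry; now apply csum_zero|].
  rewrite IHm, <- csum_plus. apply csum_ext. auto.
Qed.

Lemma fdist_shift f t : fdist test_fun f -> fdist test_fun (Defs.shift t f).
Proof.
  intros [H1 [H2 [N [C0 [L [HC [HL H3]]]]]]]. unfold Defs.shift. split; [|split].
  - intros. now rewrite H1 by auto using test_fun_trans.
  - intros. now rewrite H2 by auto using test_fun_trans.
  - exists N, C0, (L + Rabs t). assert (Ht := Rabs_pos t). repeat split; try lra.
    intros phi T M HM. apply H3; [now apply test_fun_trans|].
    intros j x Hj Hx. rewrite Derive_n_comp_trans. apply HM; auto.
    eapply Rle_trans; [apply Rabs_triang|]. lra.
Qed.

Lemma fdist_cscal c f : fdist test_fun f -> fdist test_fun (fun phi => c * f phi)%C.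
Proof.
  intros [H1 [H2 [N [C0 [L [HC [HL H3]]]]]]]. split; [|split].
  - intros. rewrite H1 by auto. ring.
  - intros. rewrite H2 by auto. ring.
  - exists N, (Cmod c * C0), L. repeat split; auto.
    + apply Rmult_le_pos; auto. apply Cmod_ge_0.
    + intros phi T M HM. rewrite Cmod_mult, Rmult_assoc.
      apply Rmult_le_compat_l; [apply Cmod_ge_0|auto].
Qed.

Lemma fdist_cadd f g : fdist test_fun f -> fdist test_fun g ->
  fdist test_fun (fun phi => f phi + g phi)%C.
Proof.
  intros [A1 [A2 [NA [CA [LA [HCA [HLA A3]]]]]]] [B1 [B2 [NB [CB [LB [HCB [HLB B3]]]]]]].
  split; [|split].
  - intros. rewrite A1, B1 by auto. ring.
  - intros. rewrite A2, B2 by auto. ring.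
  - exists (NA + NB)%nat, (CA + CB), (LA + LB). repeat split; try lra.
    intros phi S M HM. eapply Rle_trans; [apply Cmod_triangle|].
    rewrite Rmult_plus_distr_r. apply Rplus_le_compat.
    + apply A3; auto. apply bnd_weaken with (NA + NB)%nat (LA + LB) M; auto; try lra; lia.
    + apply B3; auto. apply bnd_weaken with (NA + NB)%nat (LA + LB) M; auto; try lra; lia.
Qed.

Lemma fdist_rot_sum n al f : fdist test_fun f -> fdist test_fun (rot_sum n al f).
Proof.
  intros Hf. unfold rot_sum.
  enough (H : forall m, fdist test_fun (fun phi => csum m (fun k =>
    (Cpow al k * Defs.shift (2 * PI * INR k / INR n) f phi)%C))) by apply H.
  induction m; simpl.
  - split; [|split].
    + intros. ring.
    + intros. ring.
    + exists 0%nat, 0, 0. repeat split; try lra. intros. rewrite Cmod_0. lra.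
  - apply fdist_cadd; auto. now apply fdist_cscal, fdist_shift.
Qed.

Lemma rot_sum_arc n al f phi : (1 <= n)%nat ->
  rot_sum n al f phi = csum n (fun k => (Cpow al k * f (fun x => phi (x + arc n * INR k)%R))%C).
Proof.
  intros Hn. apply csum_ext. intros k _. unfold Defs.shift. f_equal. f_equal.
  apply functional_extensionality. intros x. f_equal. unfold arc. field. apply not_0_INR. lia.
Qed.

(** A shift by one arc moves the sum by one index. The term that leaves returns at the other end,
    because [al ^ n = 1] and [phi] has period [2 PI]. *)
Lemma rot_sum_quasi_periodic n al f phi k : (1 <= n)%nat -> Cpow al n = RtoC 1 -> test_fun phi ->
  (Cpow al k * rot_sum n al f (fun x => phi (x + arc n * INR k)%R))%C = rot_sum n al f phi.
Proof.
  intros Hn Hal. revert phi.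
  assert (Step : forall phi, test_fun phi ->
    (al * rot_sum n al f (fun x => phi (x + arc n)%R))%C = rot_sum n al f phi).
  { intros phi T. rewrite !rot_sum_arc by auto.
    set (t := fun k => (Cpow al k * f (fun x => phi (x + arc n * INR k)%R))%C).
    rewrite <- csum_scal.
    assert (R := csum_rotate n t).
    assert (E : t n = t 0%nat).
    { unfold t. rewrite Hal. rewrite <- two_pi_arc by auto. simpl. f_equal.
      f_equal. apply functional_extensionality. intros x.
      rewrite (proj1 T). f_equal. ring. }
    rewrite E in R.
    rewrite (csum_ext n _ (fun k => t (S k))).
    - transitivity ((csum n (fun k => t (S k)) + t 0%nat) - t 0%nat)%C; [ring|]. rewrite R. ring.
    - intros i _. unfold t. rewrite Cpow_S, Cmult_assoc. f_equal. f_equal.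
      apply functional_extensionality. intros x. rewrite S_INR. f_equal. ring. }
  induction k; intros phi T.
  - rewrite Cmult_1_l. f_equal. apply functional_extensionality. intros x. simpl. f_equal. ring.
  - rewrite <- (IHk phi T), <- (Step (fun x => phi (x + arc n * INR k)%R)) by now apply test_fun_trans.
    rewrite Cpow_S. rewrite <- Cmult_assoc.
    transitivity (Cpow al k * (al * rot_sum n al f (fun x => phi (x + arc n * INR (S k))%R)))%C; [ring|].
    f_equal. f_equal. f_equal. apply functional_extensionality. intros x.
    rewrite S_INR. f_equal. ring.
Qed.

Lemma rot_sum_zero_off n al f a b eta Phi : (1 <= n)%nat -> fdist test_fun f ->
  supp_sub f (rot_set n a b) -> 0 < eta -> test_fun Phi ->
  (forall y z, a - eta <= y <= b + eta -> Phi (y + arc n * IZR z) = 0) ->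
  rot_sum n al f Phi = RtoC 0.
Proof.
  intros Hn Hf HS He T H. rewrite rot_sum_arc by auto. apply csum_zero. intros k _.
  rewrite (zero_off_rot n f a b eta (fun x => Phi (x + arc n * INR k))); auto.
  - ring.
  - exact (proj1 Hf).
  - now apply test_fun_trans.
  - intros y z Hy. rewrite INR_IZR_INZ, Rplus_assoc, <- Rmult_plus_distr_l, <- plus_IZR. auto.
Qed.

(** For [chi] supported inside the window this is [chi u] carried to the line; [phi] need not be
    periodic, since [chi] cuts it off. *)
Definition lift (u : (R -> R) -> C) (p : R) (chi : R -> R) : (R -> R) -> C :=
  fun phi => u (per p (fun y => chi y * phi y)).

Lemma cdist_lift u p chi : fdist test_fun u -> smooth chi -> in_window p chi -> cdist (lift u p chi).
Proof.
  intros [H1 [H2 [N [C0 [L [HC [HL H3]]]]]]] Sc [dl [Hd W]]. assert (HP := two_pi_pos).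
  assert (W' : forall phi, in_window p (fun y => chi y * phi y)).
  { intros phi. exists dl. split; auto. intros y Hy. rewrite W by auto. ring. }
  assert (T : forall phi, smooth phi -> test_fun (per p (fun y => chi y * phi y))).
  { intros phi S. apply per_test_fun; auto. now apply smooth_mult. }
  unfold lift. split; [|split].
  - intros phi psi S1 S2. rewrite <- H1 by auto. f_equal.
    apply functional_extensionality. intros x. unfold per. ring.
  - intros a phi S1. rewrite <- H2 by auto. f_equal.
    apply functional_extensionality. intros x. unfold per. ring.
  - set (L' := Rabs p + 2 * PI). assert (Hp := Rabs_pos p).
    destruct (smooth_bnd chi N L' Sc) as [M0 [HM0 B]].
    exists N, (C0 * (2 ^ N * M0)), L'. repeat split.
    + repeat apply Rmult_le_pos; auto. apply pow_le; lra.
    + unfold L'. lra.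
    + intros phi S M HM. rewrite Rmult_assoc. apply H3; auto.
      intros j x Hj Hx. destruct (reduce_mod_two_pi p x) as [y [z [Hy ->]]].
      rewrite Derive_n_per by auto. apply (bnd_mult N L' M0 M chi phi); auto.
      unfold L'. apply Rabs_le_between.
      assert (Q1 := Rle_abs p). assert (Q2 := Rle_abs (- p)). rewrite Rabs_Ropp in Q2. lra.
Qed.

(** Three scales: the plateau reaches [eta] beyond [[a, b]], the support [2 * eta], and the window
    of the lift starts at [a - 3 * eta]. *)
Definition cutoff (a b eta : R) (chi : R -> R) : Prop :=
  smooth chi /\ (forall y, a - eta <= y <= b + eta -> chi y = 1) /\
  (forall y, y <= a - 2 * eta \/ b + 2 * eta <= y -> chi y = 0).

Lemma cutoff_exists a b eta : 0 < eta -> exists chi, cutoff a b eta chi.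
Proof.
  intros H. destruct (smooth_bump_at (a - 2 * eta) (a - eta) (b + eta) (b + 2 * eta))
    as [chi [S [H1 H0]]]; try lra. now exists chi.
Qed.

Section Lift.

Variables (n : nat) (al : C) (f : (R -> R) -> C) (a b eta : R) (chi : R -> R).
Hypothesis n_ge : (2 <= n)%nat.
Hypothesis f_dist : fdist test_fun f.
Hypothesis f_supp : supp_sub f (rot_set n a b).
Hypothesis a_le_b : a <= b.
Hypothesis eta_pos : 0 < eta.
Hypothesis ab_small : b - a + 6 * eta < arc n.
Hypothesis chi_cutoff : cutoff a b eta chi.

Let u : (R -> R) -> C := rot_sum n al f.
Let U : (R -> R) -> C := lift u (a - 3 * eta) chi.

Lemma chi_support y : chi y <> 0 -> a - 2 * eta < y < b + 2 * eta.
Proof.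
  destruct chi_cutoff as [_ [_ H]]. intros Hy.
  destruct (Rle_or_lt y (a - 2 * eta)); [exfalso; apply Hy, H; lra|].
  destruct (Rle_or_lt (b + 2 * eta) y); [exfalso; apply Hy, H; lra|]. lra.
Qed.

Lemma chi_window phi : in_window (a - 3 * eta) (fun y => chi y * phi y).
Proof.
  destruct chi_cutoff as [_ [_ H]]. exists eta. split; auto. intros y Hy.
  assert (X := arc_le_PI n n_ge). assert (P := PI_RGT_0).
  rewrite H by lra. ring.
Qed.

Lemma chi_test_fun phi : smooth phi -> test_fun (per (a - 3 * eta) (fun y => chi y * phi y)).
Proof.
  intros S. apply per_test_fun; [|apply chi_window]. apply smooth_mult; auto. apply chi_cutoff.
Qed.

Lemma per_chi_eq phi y z : a - eta <= y <= b + eta ->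
  per (a - 3 * eta) (fun y => chi y * phi y) (y + 2 * PI * IZR z) = phi y.
Proof.
  intros Hy. assert (X := arc_le_PI n n_ge). assert (P := PI_RGT_0).
  rewrite per_eq by lra. destruct chi_cutoff as [_ [H _]]. rewrite H by auto. ring.
Qed.

(** A point within [eta] of [[a, b]] and one in the support of [chi] differ by less than
    [b - a + 3 * eta], which is below one arc; so only a full turn leads from one to the other. *)
Lemma per_chi_off phi y z : a - eta <= y <= b + eta ->
  per (a - 3 * eta) (fun y => chi y * phi y) (y + arc n * IZR z) <> 0 ->
  exists q, y + arc n * IZR z = y + 2 * PI * IZR q.
Proof.
  intros Hy Hne. destruct (per_nonzero _ _ _ Hne) as [w [q [E Hw]]].
  assert (Hc : chi w <> 0) by (intros E0; apply Hw; rewrite E0; ring).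
  apply chi_support in Hc.
  assert (Z0 : (z - q * Z.of_nat n)%Z = 0%Z).
  { apply (arc_gap n); [lia|]. rewrite minus_IZR, mult_IZR, <- INR_IZR_INZ.
    rewrite (two_pi_arc n ltac:(lia)) in E. nra. }
  exists q. replace z with (q * Z.of_nat n)%Z by lia.
  rewrite mult_IZR, <- INR_IZR_INZ, (two_pi_arc n ltac:(lia)). ring.
Qed.

Lemma lift_cdist : cdist U.
Proof.
  apply cdist_lift; [now apply fdist_rot_sum|apply chi_cutoff|].
  destruct (chi_window (fun _ => 1)) as [dl [Hd H]]. exists dl. split; auto.
  intros y Hy. rewrite <- (H y Hy). ring.
Qed.

Lemma lift_vanishes_below : vanishes_below U a.
Proof.
  intros phi s' S Hs' Z. unfold U, lift, u.
  set (e := Rmin eta (a - s')).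
  assert (M1 := Rmin_l eta (a - s')). assert (M2 := Rmin_r eta (a - s')).
  assert (He : 0 < e) by (apply Rmin_pos; lra).
  apply rot_sum_zero_off with a b e; auto; [lia|now apply chi_test_fun|].
  intros y z Hy. apply NNPP. intros Hne.
  destruct (per_chi_off phi y z ltac:(unfold e in *; lra) Hne) as [q Hq].
  rewrite Hq, per_chi_eq in Hne by (unfold e in *; lra). apply Hne, Z. unfold e in *; lra.
Qed.

(** [b - arc n] is the top of the preceding copy of [[a, b]] and [a + arc n] the bottom of the next
    one. Between them only [[a, b]] can carry the rotation sum, and there the lift sees all of
    it. *)
Lemma lift_zero_on q0 : q0 <= a + arc n -> vanishes_below U q0 -> zero_on u (b - arc n) q0.
Proof.
  intros Hq0 V Phi T [dl [Hd Hs]].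
  assert (X := arc_le_PI n n_ge). assert (P := PI_RGT_0).
  assert (S := test_fun_smooth _ T).
  assert (Sc : smooth chi) by apply chi_cutoff.
  (* [Phi] is periodic and in general does not vanish far to the right; [chi * Phi] does, and the
     second [chi] brought in by [lift] changes nothing near [[a, b]]. *)
  assert (E0 : U (fun y => chi y * Phi y) = RtoC 0).
  { apply (V _ (q0 - dl / 2)); [now apply smooth_mult|lra|].
    intros y Hy. apply NNPP. intros Hne.
    assert (Hc : chi y <> 0) by (intros E; apply Hne; rewrite E; ring).
    assert (Hp : Phi y <> 0) by (intros E; apply Hne; rewrite E; ring).
    apply chi_support in Hc. destruct (Hs y Hp) as [z Hz].
    assert (z = 0%Z); [|subst z; lra].
    assert (B : -1 < IZR z < 1); [|now apply IZR_small].
    split; apply Rmult_lt_reg_l with (2 * PI); lra. }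
  assert (T1 : test_fun (per (a - 3 * eta) (fun y => chi y * (chi y * Phi y)))).
  { apply chi_test_fun. now apply smooth_mult. }
  assert (Hu : fdist test_fun u) by now apply fdist_rot_sum.
  replace Phi with (fun x => per (a - 3 * eta) (fun y => chi y * (chi y * Phi y)) x
    + (Phi x - per (a - 3 * eta) (fun y => chi y * (chi y * Phi y)) x))
    by (apply functional_extensionality; intros; ring).
  rewrite (proj1 Hu) by (auto using test_fun_minus).
  unfold U, lift in E0. rewrite E0.
  (* As [e < dl], a point within [e] of [[a, b]] can be rotated into the support of [Phi] only by
     full turns. *)
  set (e := Rmin eta (dl / 2)).
  assert (M1 := Rmin_l eta (dl / 2)). assert (M2 := Rmin_r eta (dl / 2)).
  assert (He : 0 < e) by (apply Rmin_pos; lra).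
  unfold u at 1. rewrite (rot_sum_zero_off n al f a b e); auto using test_fun_minus; [ring|lia|].
  intros y z Hy. unfold e in Hy.
  destruct (classic (exists q, y + arc n * IZR z = y + 2 * PI * IZR q)) as [[q Hq]|Hno].
  - rewrite Hq, per_chi_eq by lra. rewrite test_fun_period by auto.
    destruct chi_cutoff as [_ [H1 _]]. rewrite H1 by lra. ring.
  - assert (Z1 : per (a - 3 * eta) (fun y => chi y * (chi y * Phi y)) (y + arc n * IZR z) = 0).
    { apply NNPP. intros Hne. apply Hno. apply (per_chi_off (fun y => chi y * Phi y)); auto. lra. }
    assert (Z2 : Phi (y + arc n * IZR z) = 0); [|lra].
    apply NNPP. intros Hne. apply Hno. destruct (Hs _ Hne) as [q Hq].
    assert (Z0 : (z + q * Z.of_nat n)%Z = 0%Z).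
    { apply (arc_gap n); [lia|]. rewrite plus_IZR, mult_IZR, <- INR_IZR_INZ.
      rewrite (two_pi_arc n ltac:(lia)) in Hq. nra. }
    exists (- q)%Z. replace z with (- q * Z.of_nat n)%Z by lia.
    rewrite mult_IZR, <- INR_IZR_INZ, (two_pi_arc n ltac:(lia)). ring.
Qed.

(** Maximality of [a] gives a test reaching only slightly above [a] on which [U] is nonzero. Its
    part below [a - eps / 4] contributes nothing, and what remains is supported near [a]. *)
Lemma lift_in_supp : (forall a', vanishes_below U a' -> a' <= a) -> in_supp u a.
Proof.
  intros Hmax eps He.
  assert (Hn : ~ vanishes_below U (a + eps / 2)) by (intros V; apply Hmax in V; lra).
  assert (X : exists phi s', smooth phi /\ s' < a + eps / 2 /\ (forall x, s' <= x -> phi x = 0) /\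
    U phi <> RtoC 0).
  { apply NNPP. intros Hno. apply Hn. intros phi s' S Hs Z. apply NNPP. intros Hne.
    apply Hno. now exists phi, s'. }
  destruct X as [phi [s' [S [Hs [Z Hne]]]]].
  destruct (smooth_step_at (a - eps / 2) (a - eps / 4) ltac:(lra)) as [sg [Ssg [A B]]].
  assert (S1 : smooth (fun y => phi y * sg y)) by now apply smooth_mult.
  assert (S2 : smooth (fun y => phi y * (1 - sg y))).
  { apply smooth_mult; auto. apply smooth_minus; auto. apply smooth_const. }
  exists (per (a - 3 * eta) (fun y => chi y * (phi y * sg y))). split; [now apply chi_test_fun|]. split.
  - exists (eps / 2). split; [lra|]. intros x Hx.
    destruct (per_nonzero _ _ _ Hx) as [w [q [-> Hw]]]. exists (- q)%Z.
    rewrite opp_IZR. replace (w + 2 * PI * IZR q + 2 * PI * - IZR q) with w by ring.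
    split.
    + destruct (Rle_or_lt (a - eps / 2) w) as [|H]; [lra|]. exfalso. apply Hw. rewrite A by lra. ring.
    + destruct (Rle_or_lt s' w) as [H|H]; [|lra]. exfalso. apply Hw. rewrite Z by lra. ring.
  - intros E. apply Hne.
    replace phi with (fun y => phi y * sg y + phi y * (1 - sg y))
      by (apply functional_extensionality; intros; ring).
    rewrite (proj1 lift_cdist) by auto.
    rewrite (lift_vanishes_below (fun y => phi y * (1 - sg y)) (a - eps / 4)); auto; [|lra|].
    + unfold U at 1, lift. rewrite E. ring.
    + intros x Hx. rewrite B by lra. ring.
Qed.

End Lift.

(** * Convolution of lifts *)

Definition ctest (h : R -> C) : Prop :=
  test_fun (fun x => fst (h x)) /\ test_fun (fun x => snd (h x)).

Lemma ctest_scal c h : ctest h -> ctest (fun x => c * h x)%C.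
Proof.
  intros [H1 H2]. split; simpl.
  - apply test_fun_minus; now apply test_fun_scal.
  - apply test_fun_plus; now apply test_fun_scal.
Qed.

Lemma ctest_csum m (c : nat -> C) (H : nat -> R -> C) : (forall k, ctest (H k)) ->
  ctest (fun x => csum m (fun k => c k * H k x)%C).
Proof.
  intros HH. induction m; simpl; [split; apply test_fun_const|].
  destruct IHm as [I1 I2]. destruct (ctest_scal (c m) (H m) (HH m)) as [J1 J2].
  split; simpl; now apply test_fun_plus.
Qed.

Lemma pairC_csum F m (c : nat -> C) (H : nat -> R -> C) : fdist test_fun F ->
  (forall k, ctest (H k)) ->
  pairC F (fun x => csum m (fun k => c k * H k x)%C) = csum m (fun k => c k * pairC F (H k))%C.
Proof.
  intros HF HH. induction m; simpl csum.
  - unfold pairC. simpl. rewrite (fdist_zero test_fun F (fun _ => 0)); auto using test_fun_const. ring.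
  - destruct (ctest_csum m c H HH) as [A1 A2]. destruct (ctest_scal (c m) (H m) (HH m)) as [B1 B2].
    rewrite (pairC_add test_fun F (fun x => csum m (fun k => c k * H k x)%C) (fun x => c m * H m x)%C); auto.
    rewrite IHm. f_equal.
    apply (pairC_scal test_fun); auto using test_fun_diff_invariant; apply HH.
Qed.

Lemma ctest_translates g phi : fdist test_fun g -> test_fun phi ->
  ctest (fun x => g (fun y => phi (x + y)%R)).
Proof.
  intros Hg T.
  assert (P : forall x, (fun y => phi (x + 2 * PI + y)) = (fun y => phi (x + y))).
  { intros x. apply functional_extensionality. intros y.
    replace (x + 2 * PI + y) with ((x + y) + 2 * PI) by ring. apply T. }
  split.
  - split; [intros x; now rewrite P|].
    apply (fdist_shift_fst_smooth test_fun); auto using test_fun_diff_invariant.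
  - split; [intros x; now rewrite P|].
    apply (fdist_shift_snd_smooth test_fun); auto using test_fun_diff_invariant.
Qed.

Lemma conv_additive f g : fdist test_fun f -> fdist test_fun g -> additive_on_tests (conv f g).
Proof.
  intros Hf Hg phi psi T1 T2. unfold conv.
  destruct (ctest_translates g phi Hg T1) as [A1 A2].
  destruct (ctest_translates g psi Hg T2) as [B1 B2].
  rewrite <- (pairC_add test_fun f (fun x => g (fun y => phi (x + y)%R)) (fun x => g (fun y => psi (x + y)%R))); auto.
  f_equal. apply functional_extensionality. intros x.
  apply (proj1 Hg (fun y => phi (x + y)) (fun y => psi (x + y))); now apply test_fun_shift.
Qed.

Lemma eq_off_rot n F a b eta phi psi : (1 <= n)%nat -> fdist test_fun F ->
  supp_sub F (rot_set n a b) -> 0 < eta -> test_fun phi -> test_fun psi ->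
  (forall y z, a - eta <= y <= b + eta -> phi (y + arc n * IZR z) = psi (y + arc n * IZR z)) ->
  F phi = F psi.
Proof.
  intros Hn HF HS He T1 T2 H.
  replace phi with (fun x => psi x + (phi x - psi x)) by (apply functional_extensionality; intros; ring).
  rewrite (proj1 HF) by auto using test_fun_minus.
  rewrite (zero_off_rot n F a b eta (fun x => phi x - psi x)); auto using test_fun_minus.
  - ring.
  - exact (proj1 HF).
  - intros y z Hy. rewrite H by auto. ring.
Qed.

Lemma rot_sum_eq_off n al f a b eta phi psi : (1 <= n)%nat -> fdist test_fun f ->
  supp_sub f (rot_set n a b) -> 0 < eta -> test_fun phi -> test_fun psi ->
  (forall y z, a - eta <= y <= b + eta -> phi (y + arc n * IZR z) = psi (y + arc n * IZR z)) ->
  rot_sum n al f phi = rot_sum n al f psi.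
Proof.
  intros Hn HF HS He T1 T2 H. rewrite !rot_sum_arc by auto. apply csum_ext. intros k _. f_equal.
  apply (eq_off_rot n f a b eta); auto using test_fun_trans.
  intros y z Hy. rewrite INR_IZR_INZ, Rplus_assoc, <- Rmult_plus_distr_l, <- plus_IZR. auto.
Qed.

(* On the circle, summing the [n] rotated pieces of the cut-off recovers any function that is
   quasi-periodic with the inverse multiplier; this identifies the convolution of the lifts with
   a piece of the rotation sum of [conv f g]. *)
Lemma pairC_rot_lift n al f a b eta chi h : (2 <= n)%nat -> fdist test_fun f ->
  supp_sub f (rot_set n a b) -> a <= b -> 0 < eta -> b - a + 6 * eta < arc n ->
  cutoff a b eta chi -> ctest h ->
  (forall x k, (Cpow al k * h (x + arc n * INR k)%R)%C = h x) ->
  pairC (lift (rot_sum n al f) (a - 3 * eta) chi) h = pairC f h.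
Proof.
  intros Hn Hf HS Hab He Hs Hc [T1 T2] Hq.
  assert (Hn1 : (1 <= n)%nat) by lia.
  set (H := fun x => (per (a - 3 * eta) (fun y => chi y * fst (h y)) x,
                      per (a - 3 * eta) (fun y => chi y * snd (h y)) x) : C).
  assert (TH : ctest H).
  { split; simpl; apply (chi_test_fun n a b eta chi); auto using test_fun_smooth. }
  assert (TH' : forall k, ctest (fun x => H (x + arc n * INR k)%R)).
  { intros k. destruct TH as [A1 A2].
    split; [exact (test_fun_trans _ _ A1)|exact (test_fun_trans _ _ A2)]. }
  transitivity (pairC f (fun x => csum n (fun k => Cpow al k * H (x + arc n * INR k)%R)%C)).
  - rewrite (pairC_csum f n (Cpow al) (fun k x => H (x + arc n * INR k)%R)) by auto.
    unfold pairC, lift. rewrite !rot_sum_arc by auto.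
    rewrite <- csum_scal, <- csum_plus. apply csum_ext. intros k _. simpl. ring.
  - destruct (ctest_csum n (Cpow al) (fun k x => H (x + arc n * INR k)%R) TH') as [W1 W2].
    assert (E : forall y z, a - eta <= y <= b + eta ->
      csum n (fun k => Cpow al k * H (y + arc n * IZR z + arc n * INR k)%R)%C = h (y + arc n * IZR z)%R).
    { intros y z Hy.
      (* [k0] is the one rotation that brings the copy with index [z] back to the window; [q] counts
         full turns. *)
      destruct (rot_residue n (- z) Hn1) as [k0 [q [Hk0 Hr]]].
      assert (Hx : y + arc n * IZR z + arc n * INR k0 = y + 2 * PI * IZR (- q)).
      { specialize (Hr 0). rewrite opp_IZR in *. lra. }
      rewrite (csum_single n _ k0 Hk0).
      - rewrite <- (Hq (y + arc n * IZR z) k0). f_equal. rewrite Hx. unfold H.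
        rewrite !(per_chi_eq n a b eta chi) by auto.
        assert (P1 := test_fun_period _ y (- q) T1). assert (P2 := test_fun_period _ y (- q) T2).
        simpl in P1, P2. rewrite (surjective_pairing (h (y + 2 * PI * IZR (- q)))).
        now rewrite P1, P2.
      - intros k Hk Hne.
        assert (Hno : ~ exists q', y + arc n * IZR (z + Z.of_nat k) = y + 2 * PI * IZR q').
        { intros [q' Hq']. apply Hne.
          rewrite (two_pi_arc n Hn1), plus_IZR, <- INR_IZR_INZ in Hq'.
          rewrite (two_pi_arc n Hn1) in Hx.
          assert (Z0 : (Z.of_nat k - Z.of_nat k0 - Z.of_nat n * (q' + q))%Z = 0%Z).
          { apply (arc_gap n); auto. assert (Pn := arc_pos n Hn1).
            rewrite !minus_IZR, mult_IZR, plus_IZR, <- !INR_IZR_INZ.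
            rewrite opp_IZR in Hx. nra. }
          assert (Hd : (Z.of_nat k - Z.of_nat k0 = Z.of_nat n * (q' + q))%Z) by lia.
          generalize (q' + q)%Z Hd. clear - Hk Hk0. intros m Hd.
          destruct (Z_lt_le_dec m 0); [nia|]. destruct (Z_lt_le_dec 0 m); [nia|].
          replace m with 0%Z in Hd by lia. lia. }
        assert (Z0 : forall phi, per (a - 3 * eta) (fun y => chi y * phi y)
          (y + arc n * IZR z + arc n * INR k) = 0).
        { intros phi. apply NNPP. intros Hnz. apply Hno.
          rewrite INR_IZR_INZ, Rplus_assoc, <- Rmult_plus_distr_l, <- plus_IZR in Hnz.
          now apply (per_chi_off n a b eta chi) in Hnz. }
        unfold H. rewrite !Z0. apply Cmult_0_r. }
    unfold pairC. f_equal; [|f_equal]; apply (eq_off_rot n f a b eta); auto;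
      intros y z Hy; now rewrite E by auto.
Qed.

(** The test is cut off near [[a + c, b + d]] and periodized. The resulting [h] has the inverse
    multiplier, so [pairC_rot_lift] replaces the lift of the rotation sum of [f] by [f] itself.
    Expanding the other rotation sum leaves multiples of [conv f g] on rotated tests, all of which
    vanish near the copies of [[k1, k2]]. *)
Lemma lift_conv_vanishes n al f g a b c d k1 k2 eta chi1 chi2 : (2 <= n)%nat ->
  Cpow al n = RtoC 1 -> fdist test_fun f -> fdist test_fun g ->
  supp_sub f (rot_set n a b) -> supp_sub g (rot_set n c d) ->
  supp_sub (conv f g) (rot_set n k1 k2) -> a <= b -> c <= d -> k2 <= b + d ->
  0 < eta -> b - a + (d - c) + 16 * eta < arc n ->
  cutoff a b eta chi1 -> cutoff c d eta chi2 ->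
  vanishes_below (conv (lift (rot_sum n al f) (a - 3 * eta) chi1)
                       (lift (rot_sum n al g) (c - 3 * eta) chi2)) k1.
Proof.
  intros Hn Hal Hf Hg Sf Sg Sfg Hab Hcd Hk2 He Hs C1 C2 phi s' Sp Hs' Z.
  assert (Hn1 : (1 <= n)%nat) by lia.
  assert (X := arc_le_PI n Hn). assert (P := PI_RGT_0).
  set (v := rot_sum n al g). assert (Hv : fdist test_fun v) by now apply fdist_rot_sum.
  (* A point in the support of [chi1] plus one within [eta] of [[c, d]] lies within [3 * eta] of
     [[a + c, b + d]], inside the plateau; [kap] is 0 beyond [5 * eta], and the window starts
     [6 * eta] below. *)
  destruct (smooth_bump_at (a + c - 5 * eta) (a + c - 4 * eta) (b + d + 4 * eta) (b + d + 5 * eta))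
    as [kap [Sk [K1 K0]]]; try lra.
  set (phi2 := fun y => kap y * phi y).
  assert (Sup : forall w, phi2 w <> 0 -> a + c - 5 * eta < w < b + d + 5 * eta /\ w < s').
  { intros w Hw. unfold phi2 in Hw.
    destruct (Rle_or_lt w (a + c - 5 * eta)); [exfalso; apply Hw; rewrite K0 by lra; ring|].
    destruct (Rle_or_lt (b + d + 5 * eta) w); [exfalso; apply Hw; rewrite K0 by lra; ring|].
    destruct (Rle_or_lt s' w); [exfalso; apply Hw; rewrite Z by lra; ring|]. lra. }
  set (Phi := per (a + c - 6 * eta) phi2).
  assert (TP : test_fun Phi).
  { apply per_test_fun; [now apply smooth_mult|]. exists eta. split; auto.
    intros y Hy. unfold phi2. rewrite K0 by lra. ring. }
  set (h := fun x => v (fun y => Phi (x + y)%R)).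
  assert (Th : ctest h) by now apply ctest_translates.
  assert (Hq : forall x k, (Cpow al k * h (x + arc n * INR k)%R)%C = h x).
  { intros x k. unfold h, v.
    rewrite <- (rot_sum_quasi_periodic n al g (fun y => Phi (x + y)) k) by auto using test_fun_shift.
    f_equal. f_equal. apply functional_extensionality. intros y. f_equal. ring. }
  (* For [x] in the support of [chi1] the two tests agree near all copies of [[c, d]], which is all
     that the rotation sum of [g] sees. *)
  assert (Eh : forall x, chi1 x <> 0 ->
    lift v (c - 3 * eta) chi2 (fun y => phi (x + y)) = h x).
  { intros x Hx. apply (chi_support a b eta chi1 C1) in Hx. unfold lift, h, v.
    apply (rot_sum_eq_off n al g c d eta); auto.
    - apply (chi_test_fun n c d eta chi2); auto using smooth_shift. lra.
    - now apply test_fun_shift.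
    - intros y z Hy.
      destruct (classic (exists q, y + arc n * IZR z = y + 2 * PI * IZR q)) as [[q E]|Hno].
      + rewrite E, (per_chi_eq n c d eta chi2) by (auto; lra).
        unfold Phi. rewrite <- Rplus_assoc, per_eq by lra. unfold phi2. rewrite K1 by lra. ring.
      + transitivity 0.
        * apply NNPP. intros Hne. apply Hno.
          apply (per_chi_off n c d eta chi2 Hn He ltac:(lra) C2 (fun y => phi (x + y)) y z Hy Hne).
        * symmetry. apply NNPP. intros Hne. apply Hno.
          destruct (per_nonzero _ _ _ Hne) as [w [q [E Hw]]]. apply Sup in Hw.
          assert (Z0 : (z - q * Z.of_nat n)%Z = 0%Z).
          { apply (arc_gap n); auto. rewrite minus_IZR, mult_IZR, <- INR_IZR_INZ.
            rewrite (two_pi_arc n Hn1) in E. nra. }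
          exists q. replace z with (q * Z.of_nat n)%Z by lia.
          rewrite mult_IZR, <- INR_IZR_INZ, (two_pi_arc n Hn1). ring. }
  transitivity (pairC (lift (rot_sum n al f) (a - 3 * eta) chi1) h).
  { unfold conv, pairC. fold v. unfold lift at 1 3 5 6.
    assert (Ex : forall pr : C -> R,
      (fun y => chi1 y * pr (lift v (c - 3 * eta) chi2 (fun y0 => phi (y + y0))))
      = (fun y => chi1 y * pr (h y))).
    { intros pr. apply functional_extensionality. intros x.
      destruct (Req_dec (chi1 x) 0) as [E|E]; [rewrite E; ring|]. now rewrite Eh. }
    now rewrite (Ex fst), (Ex snd). }
  rewrite (pairC_rot_lift n al f a b eta chi1 h); auto; [|lra].
  transitivity (pairC f (fun x => csum n (fun l =>
    Cpow al l * g (fun y => Phi (x + y + arc n * INR l)%R))%C)).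
  { f_equal. apply functional_extensionality. intros x. unfold h, v. rewrite rot_sum_arc by auto.
    apply csum_ext. intros l _. f_equal. f_equal. apply functional_extensionality. intros y.
    f_equal. ring. }
  assert (Ts : forall l, test_fun (fun t => Phi (t + arc n * INR l))) by (intros; now apply test_fun_trans).
  rewrite (pairC_csum f n (Cpow al) (fun l x => g (fun y => Phi (x + y + arc n * INR l)%R))); auto.
  2:{ intros l. exact (ctest_translates g _ Hg (Ts l)). }
  apply csum_zero. intros l _.
  change (Cpow al l * conv f g (fun t => Phi (t + arc n * INR l)%R) = RtoC 0)%C.
  set (e := Rmin eta (k1 - s')).
  assert (M1 := Rmin_l eta (k1 - s')). assert (M2 := Rmin_r eta (k1 - s')).
  assert (He' : 0 < e) by (apply Rmin_pos; lra).
  rewrite (zero_off_rot n (conv f g) k1 k2 e); auto.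
  - apply Cmult_0_r.
  - now apply conv_additive.
  - intros y z Hy. apply NNPP. intros Hne.
    destruct (per_nonzero _ _ _ Hne) as [w [q [E Hw]]]. apply Sup in Hw.
    (* Here [y >= k1 - e >= s' > w], while [k2 <= b + d] and the cut-off keep [y - w] below one arc.
       So no rotation is left and [y = w], which is absurd. *)
    assert (Z0 : (z + Z.of_nat l - q * Z.of_nat n)%Z = 0%Z).
    { apply (arc_gap n); auto. rewrite minus_IZR, plus_IZR, mult_IZR, <- !INR_IZR_INZ.
      rewrite (two_pi_arc n Hn1) in E. unfold e in *. nra. }
    assert (IZR (z + Z.of_nat l - q * Z.of_nat n) = 0) by now rewrite Z0.
    rewrite minus_IZR, plus_IZR, mult_IZR, <- !INR_IZR_INZ in H.
    rewrite (two_pi_arc n Hn1) in E.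
    assert (y = w); [|unfold e in *; lra].
    assert (arc n * (IZR z + INR l - IZR q * INR n) = 0) by (rewrite H; ring). lra.
Qed.

(** * Roots of unity and inversion of rotation sums *)

Definition root1 (n : nat) : C := (cos (arc n), sin (arc n)).

Lemma Cpow_root1 n k : Cpow (root1 n) k = (cos (arc n * INR k), sin (arc n * INR k)).
Proof.
  induction k.
  - simpl. rewrite Rmult_0_r, cos_0, sin_0. reflexivity.
  - rewrite Cpow_S, IHk, S_INR, Rmult_plus_distr_l, Rmult_1_r, cos_plus, sin_plus.
    unfold root1, Cmult; simpl. f_equal; ring.
Qed.

Lemma root1_pow_n n : (1 <= n)%nat -> Cpow (root1 n) n = RtoC 1.
Proof. intros H. rewrite Cpow_root1, <- two_pi_arc, cos_2PI, sin_2PI by auto. reflexivity. Qed.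

Lemma root1_primitive n k : (0 < k < n)%nat -> Cpow (root1 n) k <> RtoC 1.
Proof.
  intros Hk E. rewrite Cpow_root1 in E. apply (f_equal fst) in E. simpl in E.
  assert (P := arc_pos n ltac:(lia)). assert (T := two_pi_arc n ltac:(lia)).
  assert (K0 : 0 < INR k) by (apply lt_0_INR; lia).
  assert (K1 : INR k < INR n) by (apply lt_INR; lia).
  set (x := arc n * INR k) in *.
  assert (Hx : 0 < x < 2 * PI) by (unfold x; nra).
  assert (S := sin_gt_0 (x / 2) ltac:(lra) ltac:(lra)).
  (* [cos x = 1] would force [sin (x / 2) = 0], impossible for [0 < x / 2 < PI]. *)
  replace x with (2 * (x / 2)) in E by field. rewrite cos_2a_sin in E. nra.
Qed.

Lemma csum_geometric n w : Cpow w n = RtoC 1 -> w <> RtoC 1 -> csum n (fun j => Cpow w j) = RtoC 0.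
Proof.
  intros Hw Hne.
  assert (E : forall m, ((w - RtoC 1) * csum m (fun j => Cpow w j))%C = (Cpow w m - RtoC 1)%C).
  { induction m; [cbn [csum Cpow]; ring|]. cbn [csum]. rewrite Cmult_plus_distr_l, IHm, Cpow_S. ring. }
  specialize (E n). rewrite Hw in E.
  destruct (classic (csum n (fun j => Cpow w j) = RtoC 0)) as [|H]; auto.
  exfalso. apply (Cmult_neq_0 (w - RtoC 1) (csum n (fun j => Cpow w j))); auto.
  - intros H1. apply Hne. replace w with ((w - RtoC 1) + RtoC 1)%C by ring. rewrite H1. ring.
  - rewrite E. ring.
Qed.

(** Fourier inversion on [Z_n]: for [k < n], the [k]-th powers of the [n]-th roots of unity sum to 0
    unless [k = 0], where they sum to [n]. *)
Lemma rot_sum_inversion n f phi : (1 <= n)%nat ->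
  csum n (fun j => rot_sum n (Cpow (root1 n) j) f phi) = (RtoC (INR n) * f phi)%C.
Proof.
  intros Hn.
  rewrite (csum_ext n _ (fun j => csum n (fun k =>
    (Cpow (Cpow (root1 n) k) j * f (fun x => phi (x + arc n * INR k)%R))%C))).
  2:{ intros j _. rewrite rot_sum_arc by auto. apply csum_ext. intros k _.
      rewrite <- !Cpow_mult_r. now rewrite Nat.mul_comm. }
  rewrite csum_exchange.
  rewrite (csum_single n _ 0%nat ltac:(lia)).
  - assert (E : forall m, csum m (fun j => (Cpow (Cpow (root1 n) 0) j *
      f (fun x => phi (x + arc n * INR 0)%R))%C) = (RtoC (INR m) * f phi)%C); [|apply E].
    assert (E0 : (fun x => phi (x + arc n * INR 0)) = phi).
    { apply functional_extensionality. intros x. simpl. f_equal. ring. }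
    rewrite E0. induction m; cbn [csum]; [simpl; ring|].
    rewrite IHm, S_INR, RtoC_plus. change (Cpow (root1 n) 0) with (RtoC 1).
    rewrite Cpow_1_l. ring.
  - intros k Hk Hk0.
    rewrite (csum_ext n _ (fun j => (f (fun x => phi (x + arc n * INR k)%R) * Cpow (Cpow (root1 n) k) j)%C))
      by (intros; ring).
    rewrite csum_scal, csum_geometric.
    + ring.
    + rewrite <- Cpow_mult_r, Nat.mul_comm, Cpow_mult_r, root1_pow_n by auto. apply Cpow_1_l.
    + apply root1_primitive. lia.
Qed.

Lemma supported_in_trans p q t phi : supported_in p q phi ->
  supported_in (p - t) (q - t) (fun x => phi (x + t)).
Proof.
  intros [dl [Hd H]]. exists dl. split; auto. intros x Hx. destruct (H _ Hx) as [z Hz].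
  exists z. lra.
Qed.

Lemma supported_in_period p q z phi : supported_in p q phi ->
  supported_in (p + 2 * PI * IZR z) (q + 2 * PI * IZR z) phi.
Proof.
  intros [dl [Hd H]]. exists dl. split; auto. intros x Hx. destruct (H _ Hx) as [w Hw].
  exists (w + z)%Z. rewrite plus_IZR. lra.
Qed.

Lemma vanishes_below_le F s t : t <= s -> vanishes_below F s -> vanishes_below F t.
Proof. intros Hts H phi s' S Hs Z. apply (H phi s'); auto. lra. Qed.

(* By minimality of [a, b], the lower end [a] is reached by some rotation sum, since [f] is the
   average of its rotation sums over all [n]-th roots of unity. *)
Lemma exists_root_reaching_inf n f a b eta chi : (2 <= n)%nat -> fdist test_fun f ->
  minimal_interval n f a b -> a <= b -> 0 < eta -> b - a + 6 * eta < arc n ->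
  cutoff a b eta chi ->
  exists al, Cpow al n = RtoC 1 /\
    forall a', vanishes_below (lift (rot_sum n al f) (a - 3 * eta) chi) a' -> a' <= a.
Proof.
  intros Hn Hf [HS [[x0 Hx0] Hmin]] Hab He Hs Hc.
  assert (Hn1 : (1 <= n)%nat) by lia. assert (Pn := arc_pos n Hn1).
  apply NNPP. intros Hno.
  assert (All : forall al, Cpow al n = RtoC 1 -> exists a', a < a' /\
    vanishes_below (lift (rot_sum n al f) (a - 3 * eta) chi) a').
  { intros al Hal. apply NNPP. intros Hn2. apply Hno. exists al. split; auto.
    intros a' V. destruct (Rle_or_lt a' a); auto. exfalso. apply Hn2. now exists a'. }
  (* A common bound for finitely many roots, capped at [a + arc n] as [lift_zero_on] requires. *)
  assert (Com : forall m, exists a', a < a' /\ a' <= a + arc n /\ forall j, (j < m)%nat ->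
    vanishes_below (lift (rot_sum n (Cpow (root1 n) j) f) (a - 3 * eta) chi) a').
  { induction m.
    - exists (a + arc n). repeat split; try lra. intros; lia.
    - destruct IHm as [a1 [H1 [H2 H3]]].
      destruct (All (Cpow (root1 n) m)) as [a2 [H4 H5]].
      { rewrite <- Cpow_mult_r, Nat.mul_comm, Cpow_mult_r, root1_pow_n by auto. apply Cpow_1_l. }
      assert (M1 := Rmin_l a1 a2). assert (M2 := Rmin_r a1 a2).
      exists (Rmin a1 a2). repeat split; [now apply Rmin_glb_lt|lra|].
      intros j Hj. destruct (Nat.eq_dec j m) as [->|Hne].
      + now apply vanishes_below_le with a2.
      + apply vanishes_below_le with a1; auto. apply H3. lia. }
  destruct (Com n) as [a1 [H1 [H2 H3]]].
  assert (Sub : supp_sub f (rot_set n a1 b)).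
  { intros x Hx. destruct (HS x Hx) as [z Hz]. exists z.
    replace (2 * PI * IZR z / INR n) with (arc n * IZR z) in *
      by (unfold arc; field; apply not_0_INR; lia).
    set (y := x - arc n * IZR z) in *.
    destruct (Rle_or_lt a1 y) as [|Hlt]; [lra|]. exfalso.
    (* With this [e] the interval [(y - e, y + e)] lies in [(b - arc n, a1)], because [y >= a]. *)
    set (e := Rmin (a1 - y) (arc n - (b - a))).
    assert (M1 : e <= a1 - y) by apply Rmin_l.
    assert (M2 : e <= arc n - (b - a)) by apply Rmin_r.
    assert (He' : 0 < e) by (apply Rmin_pos; lra).
    assert (Ey : y = x - arc n * IZR z) by reflexivity.
    clearbody e y.
    destruct (Hx e He') as [phi [T [Sp Hne]]]. apply Hne.
    assert (E : (RtoC (INR n) * f phi)%C = RtoC 0).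
    { rewrite <- rot_sum_inversion by auto. apply csum_zero. intros j Hj.
      assert (Hal : Cpow (Cpow (root1 n) j) n = RtoC 1).
      { rewrite <- Cpow_mult_r, Nat.mul_comm, Cpow_mult_r, root1_pow_n by auto. apply Cpow_1_l. }
      destruct (rot_residue n z Hn1) as [k [q [Hk Hr]]].
      rewrite <- (rot_sum_quasi_periodic n _ f phi k) by auto.
      rewrite (lift_zero_on n (Cpow (root1 n) j) f a b eta chi Hn Hf HS Hab He Hs Hc a1 H2 (H3 j Hj)).
      - ring.
      - now apply test_fun_trans.
      - apply supported_in_weaken with (x - e - arc n * INR k + 2 * PI * IZR (- q))
          (x + e - arc n * INR k + 2 * PI * IZR (- q)).
        + specialize (Hr 0). rewrite opp_IZR. lra.
        + specialize (Hr 0). rewrite opp_IZR. lra.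
        + now apply supported_in_period, supported_in_trans. }
    destruct (classic (f phi = RtoC 0)) as [|Hf0]; auto. exfalso.
    apply (Cmult_neq_0 (RtoC (INR n)) (f phi)); auto.
    intros E0. apply RtoC_inj in E0. revert E0. apply not_0_INR. lia. }
  (* A point of the support shows that [[a1, b]] is nonempty, so it is a smaller interval of the
     kind that minimality excludes. *)
  assert (Hb : a1 <= b).
  { destruct (Sub x0 Hx0) as [z Hz]. lra. }
  apply (Hmin a1 b); auto; try lra.
Qed.

Lemma zero_on_not_in_supp u p q x : zero_on u p q -> p < x < q -> ~ in_supp u x.
Proof.
  intros Hz Hx Hs. destruct (Hs (Rmin (x - p) (q - x))) as [phi [T [S Hne]]].
  - apply Rmin_pos; lra.
  - assert (M1 := Rmin_l (x - p) (q - x)). assert (M2 := Rmin_r (x - p) (q - x)).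
    apply Hne, Hz; auto. eapply supported_in_weaken; [| |exact S]; lra.
Qed.

Lemma inf_supp_rot_sum n al f a b eta chi q0 : (2 <= n)%nat -> fdist test_fun f ->
  supp_sub f (rot_set n a b) -> a <= b -> 0 < eta -> b - a + 6 * eta < arc n ->
  cutoff a b eta chi -> a < q0 ->
  (forall a', vanishes_below (lift (rot_sum n al f) (a - 3 * eta) chi) a' -> a' <= a) ->
  inf_supp_restr_eq (rot_sum n al f) (b - arc n) q0 a.
Proof.
  intros Hn Hf HS Hab He Hs Hc Hq Hmax. assert (Pn := arc_pos n ltac:(lia)). split.
  - intros x [Hx Hsx]. destruct (Rle_or_lt a x) as [|Hlt]; auto. exfalso.
    apply (zero_on_not_in_supp (rot_sum n al f) (b - arc n) a x); auto; [|lra].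
    apply (lift_zero_on n al f a b eta chi); auto; [lra|].
    now apply (lift_vanishes_below n al f a b eta chi).
  - intros m' Hm. apply Hm. split; [lra|]. now apply (lift_in_supp n al f a b eta chi).
Qed.

Theorem theorem1 (n : nat) (f g : (R -> R) -> C) (a b c d k1 k2 : R) :
  (2 <= n)%nat ->
  distribution f -> distribution g ->
  a <= b -> c <= d ->
  minimal_interval n f a b ->
  minimal_interval n g c d ->
  (b - a) + (d - c) < 2 * PI / INR n ->
  a + c <= k1 -> k1 <= k2 -> k2 <= b + d ->
  supp_sub (conv f g) (rot_set n k1 k2) ->
  0 < k1 - a - c ->
  exists alpha beta : C,
    Cpow alpha n = RtoC 1 /\ Cpow beta n = RtoC 1 /\ alpha <> beta /\
    zero_on (rot_sum n alpha f) (b - 2 * PI / INR n) (a + (k1 - a - c)) /\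
    inf_supp_restr_eq (rot_sum n alpha g) (d - 2 * PI / INR n) (c + (k1 - a - c)) c /\
    inf_supp_restr_eq (rot_sum n beta f) (b - 2 * PI / INR n) (a + (k1 - a - c)) a /\
    zero_on (rot_sum n beta g) (d - 2 * PI / INR n) (c + (k1 - a - c)).
Proof.
  intros Hn Hf Hg Hab Hcd Mf Mg Hlen Hk1 Hk12 Hk2 Sfg Hlam.
  apply distribution_fdist in Hf. apply distribution_fdist in Hg.
  fold (arc n) in *.
  (* The cut-offs need room [16 * eta]; this choice spends half of the spare length on it. *)
  set (eta := (arc n - ((b - a) + (d - c))) / 32).
  assert (He : 0 < eta) by (unfold eta; lra).
  assert (Hs : b - a + (d - c) + 16 * eta < arc n) by (unfold eta; lra).
  destruct (cutoff_exists a b eta He) as [chi1 C1].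
  destruct (cutoff_exists c d eta He) as [chi2 C2].
  assert (Sf := proj1 Mf). assert (Sg := proj1 Mg).
  destruct (exists_root_reaching_inf n f a b eta chi1) as [beta [Rb Mb]]; auto; [lra|].
  destruct (exists_root_reaching_inf n g c d eta chi2) as [alpha [Ra Ma]]; auto; [lra|].
  assert (DU : forall al, cdist (lift (rot_sum n al f) (a - 3 * eta) chi1)).
  { intros al. apply (lift_cdist n al f a b eta chi1); auto. lra. }
  assert (DV : forall al, cdist (lift (rot_sum n al g) (c - 3 * eta) chi2)).
  { intros al. apply (lift_cdist n al g c d eta chi2); auto. lra. }
  assert (VU : forall al, vanishes_below (lift (rot_sum n al f) (a - 3 * eta) chi1) a).
  { intros al. apply (lift_vanishes_below n al f a b eta chi1); auto. lra. }
  assert (VV : forall al, vanishes_below (lift (rot_sum n al g) (c - 3 * eta) chi2) c).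
  { intros al. apply (lift_vanishes_below n al g c d eta chi2); auto. lra. }
  assert (VC : forall al, Cpow al n = RtoC 1 ->
    vanishes_below (conv (lift (rot_sum n al f) (a - 3 * eta) chi1)
                         (lift (rot_sum n al g) (c - 3 * eta) chi2)) k1).
  { intros al Hal. apply lift_conv_vanishes with (b := b) (d := d) (k2 := k2); auto. }
  assert (Zf : zero_on (rot_sum n alpha f) (b - arc n) (a + (k1 - a - c))).
  { apply (lift_zero_on n alpha f a b eta chi1); auto; try lra.
    replace (a + (k1 - a - c)) with (k1 - c) by ring.
    apply titchmarsh with (lift (rot_sum n alpha g) (c - 3 * eta) chi2) a; auto. }
  assert (Zg : zero_on (rot_sum n beta g) (d - arc n) (c + (k1 - a - c))).
  { apply (lift_zero_on n beta g c d eta chi2); auto; try lra.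
    replace (c + (k1 - a - c)) with (k1 - a) by ring.
    apply titchmarsh with (lift (rot_sum n beta f) (a - 3 * eta) chi1) c; auto.
    apply vanishes_below_conv_comm; auto. }
  assert (If : inf_supp_restr_eq (rot_sum n beta f) (b - arc n) (a + (k1 - a - c)) a).
  { apply (inf_supp_rot_sum n beta f a b eta chi1); auto; lra. }
  assert (Ig : inf_supp_restr_eq (rot_sum n alpha g) (d - arc n) (c + (k1 - a - c)) c).
  { apply (inf_supp_rot_sum n alpha g c d eta chi2); auto; lra. }
  exists alpha, beta. repeat split; auto; try apply If; try apply Ig.
  (* With equal roots, the same rotation sum of [f] would vanish around [a] and have [a] in its
     support. *)
  intros ->. apply (zero_on_not_in_supp _ _ _ a Zf); [lra|].
  apply (lift_in_supp n beta f a b eta chi1); auto. lra.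
Qed.
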